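(* Let $\Sigma$ be a connected surface and let $\Phi=(\phi_1,\phi_2):\Sigma\to\mathbb{H}^2\times\mathbb{H}^2$ be a Lagrangian immersion, with associated function $\Gamma$ (defined by $\phi_1^*\omega_{\mathbb{H}^2}=\phi_2^*\omega_{\mathbb{H}^2}=\Gamma\,\omega_\Sigma$). Then $0\le\Gamma^2\le 1/4$ and (a) $\Gamma^2\equiv 0$ if and only if the image of $\Phi$ is a product of curves; (b) $\Gamma^2\equiv 1/4$ if and only if, up to a holomorphic or anti-holomorphic isometry of $\mathbb{H}^2\times\mathbb{H}^2$, the image of $\Phi$ is an open part of the diagonal.
   Context: All manifolds, maps and curves are smooth. $\mathbb{R}^3_1$ is $\mathbb{R}^3$ with the metric $\langle a,b\rangle=-a_1b_1+a_2b_2+a_3b_3$, and $a\boxtimes b=(a_3b_2-a_2b_3,\ a_3b_1-a_1b_3,\ a_1b_2-a_2b_1)$ is the Lorentzian cross product. For $c<0$, $\mathbb{H}^2(c)=\{x\in\mathbb{R}^3_1\mid\langle x,x\rangle=1/c,\ x_1>0\}$ with the induced Riemannian metric (of constant Gaussian curvature $c$), complex structure $(J_{\mathbb{H}^2(c)})_xv=\sqrt{-c}\,x\boxtimes v$ and Kähler form $\omega_{\mathbb{H}^2(c)}(v,w)=\langle J_{\mathbb{H}^2(c)}v,w\rangle$. Write $\mathbb{H}^2=\mathbb{H}^2(-1)$. The product $\mathbb{H}^2\times\mathbb{H}^2\subset\mathbb{R}^3_1\times\mathbb{R}^3_1$ carries the Riemannian product metric and the complex structure $J=(J_{\mathbb{H}^2},-J_{\mathbb{H}^2})$.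 A holomorphic (respectively, anti-holomorphic) isometry is an isometry whose differential preserves $J$ (respectively, takes $J$ to $-J$). An immersion $\Phi=(\phi_1,\phi_2)$ of a surface $\Sigma$ into $\mathbb{H}^2\times\mathbb{H}^2$ is Lagrangian if $J$ maps each tangent plane of the surface to its orthogonal complement; equivalently $\phi_1^*\omega_{\mathbb{H}^2}=\phi_2^*\omega_{\mathbb{H}^2}$. $\Sigma$ carries the induced metric, and $\omega_\Sigma$ denotes a volume form of this metric (chosen only locally if $\Sigma$ is not orientable). The function $\Gamma$ is then defined by $\phi_1^*\omega_{\mathbb{H}^2}=\phi_2^*\omega_{\mathbb{H}^2}=\Gamma\,\omega_\Sigma$. A product of curves is the surface given by an immersion $I_1\times I_2\subseteq\mathbb{R}^2\to\mathbb{H}^2\times\mathbb{H}^2:(s_1,s_2)\mapsto(\beta_1(s_1),\beta_2(s_2))$, where $I_1,I_2\subseteq\mathbb{R}$ are open intervals and $\beta_1:I_1\to\mathbb{H}^2$, $\beta_2:I_2\to\mathbb{H}^2$ are curves parametrized by arc length. The diagonal is the image of the immersion $\mathbb{H}^2(-1/2)\to\mathbb{H}^2\times\mathbb{H}^2:x\mapsto\tfrac{1}{\sqrt2}(x,x)$.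
   Formalization: In (a), ''the image of Φ is a product of curves'' is read locally (each point has an open neighbourhood whose image is a product of curves), since an L-shaped piece of a product of geodesics has Γ=0 but is no global product; a global product of curves implying Γ²≡0 is also stated. *)

(* Defs.v *)
From mathcomp Require Import all_boot all_order all_algebra.
From mathcomp Require Import all_classical all_reals all_analysis.

Set Implicit Arguments.
Unset Strict Implicit.
Unset Printing Implicit Defensive.

Import Order.TTheory GRing.Theory Num.Theory.
Import numFieldNormedType.Exports.

Local Open Scope classical_set_scope.
Local Open Scope ring_scope.

(* C^infty on [U], meant for [U] open: every iterated directional derivative
   of [f], of any order and along any directions, is (Frechet) differentiable
   at every point of [U]. *)
Definition smooth_on (R : realType) (V W : normedModType R)
    (U : set V) (f : V -> W) : Prop :=
  forall (vs : seq V) (x : V), U x ->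
    differentiable (foldr (fun v (g : V -> W) => 'D_v g) f vs) x.

(* A chart with open domain; [chart_inv] is only meaningful on the image of
   the chart. *)
Record chart (R : realType) (T : topologicalType) := Chart {
  chart_dom : set T;
  chart_map : T -> 'rV[R]_2;
  chart_inv : 'rV[R]_2 -> T;
  chart_dom_open : open chart_dom;
  chart_img_open : open (chart_map @` chart_dom);
  chart_mapK : forall p, chart_dom p -> chart_inv (chart_map p) = p;
  chart_map_cont : {in chart_dom, continuous chart_map};
  chart_inv_cont : {in chart_map @` chart_dom, continuous chart_inv} }.

Definition chart_img (R : realType) (T : topologicalType) (c : chart R T) :
  set 'rV[R]_2 := chart_map c @` chart_dom c.

(* Smooth 2-manifolds without boundary. The atlas need not be maximal. *)
Record surface (R : realType) := Surface {
  surface_space :> topologicalType;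
  surface_hausdorff : hausdorff_space surface_space;
  surface_second_countable : @second_countable surface_space;
  atlas : set (chart R surface_space);
  atlas_cover : forall p, exists2 c, atlas c & chart_dom c p;
  atlas_compat : forall c c', atlas c -> atlas c' ->
    smooth_on (chart_map c @` (chart_dom c `&` chart_dom c'))
              (chart_map c' \o chart_inv c) }.

Section Hyperbolic.
Context {R : realType}.
Implicit Types (a b x v w : 'rV[R]_3) (c : R).

Definition lor a b : R :=
  - (a 0 0 * b 0 0) + a 0 1 * b 0 1 + a 0 2%:R * b 0 2%:R.

Definition lcross a b : 'rV[R]_3 :=
  \row_(i < 3) nth 0
    [:: a 0 2%:R * b 0 1 - a 0 1 * b 0 2%:R;
        a 0 2%:R * b 0 0 - a 0 0 * b 0 2%:R;
        a 0 0 * b 0 1 - a 0 1 * b 0 0] i.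

Definition hyp c : set 'rV[R]_3 :=
  [set x | lor x x = c^-1 /\ 0 < x 0 0].

Definition hypJ c x v : 'rV[R]_3 := Num.sqrt (- c) *: lcross x v.

Definition kahler c x v w : R := lor (hypJ c x v) w.

Local Notation E := ('rV[R]_3 * 'rV[R]_3)%type.
Implicit Types (p q : E) (u z : E).

Definition HH : set E := hyp (-1) `*` hyp (-1).

Definition tangentHH p : set E :=
  [set u | lor p.1 u.1 = 0 /\ lor p.2 u.2 = 0].

Definition metricHH u z : R := lor u.1 z.1 + lor u.2 z.2.

Definition JHH p u : E := (hypJ (-1) p.1 u.1, - hypJ (-1) p.2 u.2).

(* HH is an embedded submanifold of E, so its smooth self-maps are exactly the
   restrictions of maps that are smooth near HH and send HH to itself. Such an
   extension stands for the self-map; along vectors tangent to HH its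
   differential does not depend on the extension. *)
Definition smooth_selfmap (F : E -> E) : Prop :=
  (exists U : set E, [/\ open U, HH `<=` U & smooth_on U F]) /\
  (forall p, HH p -> HH (F p)).

Definition isometryHH (F : E -> E) : Prop :=
  [/\ smooth_selfmap F,
      exists G : E -> E,
        [/\ smooth_selfmap G,
            forall p, HH p -> G (F p) = p &
            forall p, HH p -> F (G p) = p] &
      forall p u z, HH p -> tangentHH p u -> tangentHH p z ->
        metricHH ('d F p u) ('d F p z) = metricHH u z].

Definition holomorphicHH (F : E -> E) : Prop :=
  forall p u, HH p -> tangentHH p u ->
    'd F p (JHH p u) = JHH (F p) ('d F p u).

Definition antiholomorphicHH (F : E -> E) : Prop :=
  forall p u, HH p -> tangentHH p u ->
    'd F p (JHH p u) = - JHH (F p) ('d F p u).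

Definition arclength_curve (I : set R) (beta : R -> 'rV[R]_3) : Prop :=
  [/\ smooth_on I beta,
      forall s, I s -> hyp (-1) (beta s) &
      forall s, I s -> lor (derive1 beta s) (derive1 beta s) = 1].

Definition open_interval (I : set R) : Prop :=
  [/\ I !=set0, open I & is_interval I].

Definition product_of_curves (A : set E) : Prop :=
  exists (I1 I2 : set R) (beta1 beta2 : R -> 'rV[R]_3),
    [/\ open_interval I1, open_interval I2,
        arclength_curve I1 beta1, arclength_curve I2 beta2 &
        A = [set (beta1 s.1, beta2 s.2) | s in I1 `*` I2]].

Definition diagonalHH : set E :=
  [set ((Num.sqrt 2)^-1 *: x, (Num.sqrt 2)^-1 *: x) | x in hyp (- 2^-1)].

Definition open_part (A B : set E) : Prop :=
  exists2 O : set E, open O & A = O `&` B.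

End Hyperbolic.

Section Immersions.
Context {R : realType} {S : surface R}.
Local Notation E := ('rV[R]_3 * 'rV[R]_3)%type.
Implicit Types (Phi : S -> E) (c : chart R S) (x u v : 'rV[R]_2).

(* Tangent vectors of S are represented by their coordinates in a chart. *)
Definition dchart (W : normedModType R) (f : S -> W) c x : 'rV[R]_2 -> W :=
  'd (f \o chart_inv c) x.

Definition smooth_map (W : normedModType R) (f : S -> W) : Prop :=
  forall c, atlas c -> smooth_on (chart_img c) (f \o chart_inv c).

Definition immersionHH Phi : Prop :=
  [/\ smooth_map Phi,
      forall p, HH (Phi p) &
      forall c x, atlas c -> chart_img c x -> injective (dchart Phi c x)].

Definition lagrangian Phi : Prop :=
  forall c x u v, atlas c -> chart_img c x ->
    metricHH (JHH (Phi (chart_inv c x)) (dchart Phi c x u)) (dchart Phi c x v)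
    = 0.

Definition induced_metric Phi c x u v : R :=
  metricHH (dchart Phi c x u) (dchart Phi c x v).

Definition pullback_kahler (phi : S -> 'rV[R]_3) c x u v : R :=
  kahler (-1) (phi (chart_inv c x)) (dchart phi c x u) (dchart phi c x v).

Definition is_area_form (g w : 'rV[R]_2 -> 'rV[R]_2 -> R) : Prop :=
  [/\ forall (a : R) u u' v, w (a *: u + u') v = a * w u v + w u' v,
      forall u v, w v u = - w u v &
      forall u v, g u u = 1 -> g v v = 1 -> g u v = 0 -> `|w u v| = 1].

(* Each tangent plane has exactly two area forms, opposite to each other. The
   choice is left free at every point, so the sign of Gam is arbitrary and
   only Gam ^+ 2 is determined by Phi; this covers every local choice of a
   volume form, S being orientable or not. *)
Definition associated_function Phi (Gam : S -> R) : Prop :=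
  forall c x, atlas c -> chart_img c x ->
    exists2 w, is_area_form (induced_metric Phi c x) w &
      forall u v,
        pullback_kahler (fst \o Phi) c x u v = Gam (chart_inv c x) * w u v /\
        pullback_kahler (snd \o Phi) c x u v = Gam (chart_inv c x) * w u v.

(* For an immersion of a surface that is not assumed complete, being a product
   of curves is a local property of the immersed surface: the immersion of an
   L-shaped planar region as part of a product of two geodesics is not globally
   a product of two intervals. *)
Definition locally_product_of_curves Phi : Prop :=
  forall p, exists V : set S, [/\ open V, V p & product_of_curves (Phi @` V)].

End Immersions.

(* Main.v *)
Require Import Defs.
From HB Require Import structures.
From mathcomp Require Import all_boot all_order all_algebra.
From mathcomp Require Import all_classical all_reals all_analysis.
From mathcomp Require Import ring lra.

Set Implicit Arguments.
Unset Strict Implicit.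
Unset Printing Implicit Defensive.

Import Order.TTheory GRing.Theory Num.Theory.
Import numFieldNormedType.Exports.

Local Open Scope classical_set_scope.
Local Open Scope ring_scope.

(** In a chart the immersion is a pair (f1, f2) of maps from an open set of the
    plane to the hyperbolic plane; let g1 and g2 be the two pulled back metrics,
    so that the induced metric is g1 + g2.

    The bound. The square of the Kaehler form of the hyperbolic plane on two
    tangent vectors is their Gram determinant ([kahler_sq]), so the Lagrangian
    condition gives g1 and g2 the same Gram determinant. In a basis u, v that is
    orthonormal for g1 + g2 the Gram matrix of g2 is the identity minus that of
    g1; equality of the two determinants says that g1 has trace 1. With
    a = g1(u, u) and c = g1(u, v) this yields Gamma^2 = a (1 - a) - c^2, which
    is at most 1/4. It equals 1/4 exactly when g1 = g2 at the point, and it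
    vanishes exactly when g1 (equivalently g2) is degenerate there.

    Vanishing, from the function to the curves. If both metrics are degenerate,
    each component has a differential of rank one. An entry of f1 and an entry
    of f2 with independent differentials form a local diffeomorphism y, and each
    component depends only on its own coordinate of y
    ([functional_dependence]). Restricting each component to a line transverse to
    the kernel of its differential and reparametrizing by arc length produces
    the two curves ([component_curve], [local_product]).

    Vanishing, from the curves to the function. The first component of the
    immersion takes its values in the trace of a regular curve. That trace is a
    countable union of compact pieces on each of which one entry controls the
    others; by the theorem of Baire one piece is met on an open set, where the
    rank of the differential is at most one. This happens in every ball, and the
    Gram determinant is continuous ([rank_drop_everywhere]).

    Extremality, from the function to the diagonal. Now f1 and f2 pull back the
    same metric and the same Kaehler form. The metric determines the tangential
    part of the second derivatives by the formula of Koszul, hence the Darboux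
    frames (f, a, f x a) along f1 and along f2 have the same connection
    coefficients, and the linear Lorentz map carrying the first frame to the
    second is locally constant ([local_congruence]). By connectedness one map A
    satisfies phi2 = A phi1 on the whole surface ([global_congruence]); then
    (x, y) |-> (x, A^-1 y) is a holomorphic isometry that moves the surface into
    the diagonal, and the image is open there because phi1 is a local
    diffeomorphism ([first_component_open]).

    Extremality, from the diagonal to the function. Curvature is an isometric
    invariant: for every tangent u, v the sum of the Gram determinants of the
    two components is preserved ([isometry_gram]). Its value on an orthonormal
    basis is 2 Gamma^2 on the Lagrangian surface. On the diagonal the two
    components of a vector agree, so each has half the squared length and the
    value is 1/4 + 1/4. *)

(** * Differentiability of finite order *)

Section LocalDifferentiability.
Context {R : realType} {V W : normedModType R}.
Implicit Types (f g : V -> W) (x v : V).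

(** The differential of f at x is also one for g, because the increments of f
    and g agree for small vectors; uniqueness of differentials then gives
    differentiability of g. *)
Lemma near_eq_differentiable f g x :
  (\near x, f x = g x) -> differentiable f x -> differentiable g x.
Proof.
move=> fg df.
have fgx : f x = g x by exact: (nbhs_singleton fg).
have E : g \o shift x = cst (g x) + 'd f x +o_ (0 : V) id.
  apply/eqaddoP => _/posnumP[e].
  have /diff_locally/eqaddoP/(_ e%:num)/(_ [gt0 of e%:num]) := df.
  have : \forall h \near (0 : V), f (h + x) = g (h + x).
    have := fg; rewrite (near_shift 0 x) /= subr0.
    by apply: filterS => h /=.
  apply: filter_app2; near=> h => E; apply: le_trans.
  by rewrite !fctE /= -E -fgx.
apply/diff_locallyP; have [] := diff_unique (diff_continuous df) E.
by move=> dE; rewrite dE; split=> //; exact: diff_continuous.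
Unshelve. all: by end_near. Qed.

Lemma open_eq_near (U : set V) f g x :
  open U -> U x -> {in U, f =1 g} -> \near x, f x = g x.
Proof.
move=> oU Ux fg; have : nbhs x U by exact: open_nbhs_nbhs.
by apply: filterS => y Uy; apply: fg; rewrite inE.
Qed.

End LocalDifferentiability.

Section FiniteSmoothness.
Context {R : realType}.

(** Iterated derivatives counted by order instead of indexed by a list of
    directions: the product rule turns one iterated derivative of a product into
    a sum of others, so closure of smooth maps under products and compositions
    is proved by induction on the order, where such sums are harmless. *)
Fixpoint Cn (V W : normedModType R) (n : nat) (U : set V) (f : V -> W) : Prop :=
  if n is m.+1 then
    (forall x, U x -> differentiable f x) /\ (forall v, Cn m U ('D_v f))
  else True.

Section Basic.
Context {V W : normedModType R} (U : set V).
Implicit Types (f g : V -> W).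

Lemma smooth_on_derive f v : smooth_on U f -> smooth_on U ('D_v f).
Proof. by move=> sf vs x Ux; have := sf (rcons vs v) x Ux; rewrite foldr_rcons. Qed.

Lemma smooth_on_differentiable f x : smooth_on U f -> U x -> differentiable f x.
Proof. by move=> sf Ux; exact: (sf [::] x Ux). Qed.

Lemma smooth_onP f : smooth_on U f <-> forall n, Cn n U f.
Proof.
split=> [sf n|cf vs].
  elim: n f sf => //= n IH f sf; split=> [x|v].
    exact: smooth_on_differentiable.
  exact/IH/smooth_on_derive.
elim/last_ind: vs f cf => [|vs v IH] f cf x Ux.
  by have /= [df _] := cf 1%N; exact: df.
rewrite foldr_rcons; apply: IH => // n; exact: (cf n.+1).2.
Qed.

Lemma CnW n f : Cn n.+1 U f -> Cn n U f.
Proof.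
elim: n f => //= n IH f [df Df]; split=> // v; exact/IH/Df.
Qed.

Lemma eq_Cn n f g : open U -> {in U, f =1 g} -> Cn n U f -> Cn n U g.
Proof.
move=> oU; elim: n f g => //= n IH f g fg [df Df]; split=> [x Ux|v].
  exact: near_eq_differentiable (open_eq_near oU Ux fg) (df _ Ux).
apply: IH (Df v) => x; rewrite inE => Ux.
exact: near_eq_derive (open_eq_near oU Ux fg).
Qed.

Lemma sub_Cn n (U' : set V) f : U' `<=` U -> Cn n U f -> Cn n U' f.
Proof.
move=> sU; elim: n f => //= n IH f [df Df]; split=> [x /sU|v]; [exact: df|exact: IH].
Qed.

Lemma Cn_cst n (c : W) : Cn n U (cst c).
Proof.
elim: n c => //= n IH c; split=> [x _|v]; first exact: differentiable_cst.
have -> : 'D_v (cst c : V -> W) = cst 0 by apply/funext => x; exact: derive_cst.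
exact: IH.
Qed.

Lemma CnD n f g : open U -> Cn n U f -> Cn n U g -> Cn n U (fun x => f x + g x).
Proof.
move=> oU; elim: n f g => //= n IH f g [df Df] [dg Dg]; split=> [x Ux|v].
  exact: differentiableD (df _ Ux) (dg _ Ux).
apply: eq_Cn (IH _ _ (Df v) (Dg v)) => // x; rewrite inE => Ux.
by rewrite (@deriveD _ _ _ f g) //; apply: diff_derivable; [exact: df|exact: dg].
Qed.

Lemma Cn_sum n m (F : 'I_m -> V -> W) : open U -> (forall i, Cn n U (F i)) ->
  Cn n U (fun x => \sum_(i < m) F i x).
Proof.
move=> oU; elim: m F => [|m IH] F cF.
  apply: eq_Cn (Cn_cst n 0) => // x _; by rewrite big_ord0.
apply: eq_Cn (CnD oU (IH (fun i => F (widen_ord (leqnSn m) i)) _) (cF ord_max)) => //.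
by move=> x _; rewrite big_ord_recr.
Qed.

End Basic.

Section LinearComposition.
Context {V W W' : normedModType R} (L : {linear W -> W'}) (cL : continuous L).
Implicit Types f : V -> W.

Lemma differentiable_lin_comp f x :
  differentiable f x -> differentiable (L \o f) x.
Proof. by move=> df; apply: differentiable_comp => //; exact: linear_differentiable. Qed.

Lemma derive_lin_comp f x v : differentiable f x ->
  'D_v (L \o f) x = L ('D_v f x).
Proof.
move=> df; rewrite !deriveE //; last exact: differentiable_lin_comp.
by rewrite diff_comp //=; [rewrite diff_lin|exact: linear_differentiable].
Qed.

Lemma Cn_lin_comp n (U : set V) f : open U -> Cn n U f -> Cn n U (L \o f).
Proof.
move=> oU; elim: n f => //= n IH f [df Df]; split=> [x Ux|v].
  exact/differentiable_lin_comp/df.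
apply: eq_Cn (IH _ (Df v)) => // x; rewrite inE => Ux /=.
by rewrite derive_lin_comp //; exact: df.
Qed.

End LinearComposition.

Section Scaling.
Context {V W : normedModType R} (U : set V) (oU : open U).

(** Scalar multiplication as a bilinear map, so that the general theory of
    derivatives of bilinear maps yields the product rule. *)
Lemma scale_is_bilinear (X : normedModType R) :
  bilinear_for
    (GRing.Scale.Law.clone _ _ *:%R _) (GRing.Scale.Law.clone _ _ *:%R _)
    (@GRing.scale R X : R -> X -> X).
Proof.
split=> [u'|u] a x y /=; first by rewrite scalerDl scalerA.
by rewrite scalerDr !scalerA mulrC.
Qed.

HB.instance Definition _ (X : normedModType R) :=
  bilinear_isBilinear.Build R R X X _ _ (@GRing.scale R X : R -> X -> X)
    (@scale_is_bilinear X).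

Lemma differentiable_scale (k : V -> R) (f : V -> W) x :
  differentiable k x -> differentiable f x ->
  differentiable (fun y => k y *: f y) x /\
  forall v, 'D_v (fun y => k y *: f y) x = 'D_v k x *: f x + k x *: 'D_v f x.
Proof.
move=> dk df.
have bil : continuous (fun p : R * W => p.1 *: p.2).
  by move=> p; exact: scale_continuous.
have dB : differentiable (fun p : R * W => p.1 *: p.2) (k x, f x).
  exact: (differentiable_bilin _ bil).
have dp := differentiable_pair dk df.
have := differentiable_comp dp dB.
split=> // v; have E : 'd (fun p : R * W => p.1 *: p.2) (k x, f x) =
  (fun q : R * W => k x *: q.2 + q.1 *: f x) :> (R * W -> W) := diff_bilin _ bil.
rewrite !deriveE // (diff_comp dp dB) [LHS]/= E diff_pair //=.
by rewrite addrC.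
Qed.

Lemma CnZ n (k : V -> R) (f : V -> W) : Cn n U k -> Cn n U f ->
  Cn n U (fun x => k x *: f x).
Proof.
elim: n k f => //= n IH k f [dk Dk] [df Df]; split=> [x Ux|v].
  exact: (differentiable_scale (dk _ Ux) (df _ Ux)).1.
have ck : Cn n U k by apply: CnW; split.
have cf : Cn n U f by apply: CnW; split.
apply: eq_Cn (CnD oU (IH _ _ (Dk v) cf) (IH _ _ ck (Df v))) => // x.
rewrite inE => Ux /=.
by rewrite (differentiable_scale (dk _ Ux) (df _ Ux)).2.
Qed.

End Scaling.

Section Composition.
Context {V V' W : normedModType R} (m : nat).
Variables (e : 'I_m -> V') (coord : 'I_m -> {linear V' -> R}).
Hypothesis coord_cont : forall i, continuous (coord i).
Hypothesis coordE : forall v, v = \sum_(i < m) coord i v *: e i.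

Lemma derive_comp_dir (F : V' -> W) (g : V -> V') x v :
  differentiable g x -> differentiable F (g x) ->
  'D_v (F \o g) x = 'D_('D_v g x) F (g x).
Proof.
move=> dg dF; have dc := differentiable_comp dg dF.
by rewrite (deriveE _ dF) (deriveE _ dc) (deriveE _ dg) (diff_comp dg dF).
Qed.

(** The chain rule writes a derivative of F o g as the sum over a finite basis of
    the source of F of the coordinates of the derivative of g times the partial
    derivatives of F along g. Every factor is again of one order less, which
    makes the induction work; the finite basis is essential because the
    direction of differentiation of F varies with the point. *)
Lemma Cn_comp n (U : set V) (U' : set V') (F : V' -> W) (g : V -> V') :
  open U -> (forall x, U x -> U' (g x)) ->
  Cn n U g -> Cn n U' F -> Cn n U (F \o g).
Proof.
move=> oU gU; elim: n F => //= n IH F [dg Dg] [dF DF]; split=> [x Ux|v].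
  exact: differentiable_comp (dg _ Ux) (dF _ (gU _ Ux)).
have cg : Cn n U g by apply: CnW; split.
suff : Cn n U (fun x => \sum_(i < m) (coord i \o 'D_v g) x *: ('D_(e i) F \o g) x).
  apply: eq_Cn => // x; rewrite inE => Ux /=.
  have dFx : differentiable F (g x) by exact/dF/gU.
  rewrite (derive_comp_dir _ (dg _ Ux) dFx).
  rewrite [in RHS](coordE ('D_v g x)) (deriveE _ dFx) linear_sum /=.
  by apply: eq_bigr => i _; rewrite linearZ /= (deriveE _ dFx).
apply: Cn_sum => // i; apply: CnZ => //; last exact: IH.
by apply: Cn_lin_comp => //; exact: Dg.
Qed.

End Composition.

End FiniteSmoothness.

(** * Mean values and the symmetry of second derivatives *)

Section MeanValue.
Context {R : realType}.

Section Line.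
Context {V W : normedModType R}.
Implicit Types (f : V -> W) (x u : V).

(** Reduction of directional derivatives to one real variable, where the mean
    value theorem is available. *)
Lemma is_derive_line f x u (t : R) : differentiable f (x + t *: u) ->
  is_derive t (1 : R) (fun s : R => f (x + s *: u)) ('D_u f (x + t *: u)).
Proof.
move=> df.
have dl : is_diff t (fun s : R => x + s *: u) (fun s : R => s *: u).
  have -> : (fun s : R => x + s *: u) = cst x + (fun s : R => s *: u) by [].
  rewrite -[X in is_diff _ _ X]add0r.
  exact: is_diffD (is_diff_cst x t) (is_diff_scalel t u).
have [dl1 dl2] := dl.
have dc : differentiable (f \o (fun s : R => x + s *: u)) t.
  exact: differentiable_comp.
apply: DeriveDef; first exact: diff_derivable.
by rewrite (deriveE _ dc) (deriveE _ df) (diff_comp dl1 df) /= dl2 scale1r.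
Qed.

End Line.

Lemma mean_value_segment (V : normedModType R) (f : V -> R) (x u : V) :
  (forall t : R, 0 <= t <= 1 -> differentiable f (x + t *: u)) ->
  exists2 t : R, 0 < t < 1 & f (x + u) - f x = 'D_u f (x + t *: u).
Proof.
move=> df.
have dl (t : R) : t \in `]0, 1[ ->
    is_derive t (1 : R) (fun s : R => f (x + s *: u)) ('D_u f (x + t *: u)).
  by rewrite in_itv /= => /andP[/ltW t0 /ltW t1]; apply/is_derive_line/df/andP.
have cl : {within `[(0 : R), 1], continuous (fun s : R => f (x + s *: u))}.
  apply: continuous_in_subspaceT => t; rewrite inE /= in_itv /= => t01.
  have [d _] := is_derive_line (df _ t01).
  exact/differentiable_continuous/derivable1_diffP.
have [t t01] := MVT ltr01 dl cl.
by rewrite in_itv /= in t01; rewrite scale1r scale0r addr0 subr0 mulr1; exists t.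
Qed.

(** The mean value theorem applied first to the difference of two translates of f
    and then to its derivative along u. *)
Lemma second_difference (V : normedModType R) (f : V -> R) (x u v : V) :
  (forall s t : R, 0 <= s <= 1 -> 0 <= t <= 1 ->
    differentiable f (x + s *: u + t *: v) /\
    differentiable ('D_u f) (x + s *: u + t *: v)) ->
  exists s t : R, [/\ 0 < s < 1, 0 < t < 1 &
    f (x + u + v) - f (x + u) - (f (x + v) - f x)
      = 'D_v ('D_u f) (x + s *: u + t *: v)].
Proof.
move=> df.
have b0 : 0 <= (0 : R) <= 1 by rewrite lexx ler01.
have b1 : 0 <= (1 : R) <= 1 by rewrite lexx ler01.
pose g := (f \o shift v) - f.
have dg (s : R) : 0 <= s <= 1 -> differentiable (f \o shift v) (x + s *: u).
  move=> s01; apply: differentiable_comp.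
    by apply: differentiableD => //; exact: differentiable_cst.
  by have [+ _] := df s 1 s01 b1; rewrite scale1r.
have df0 (s : R) : 0 <= s <= 1 -> differentiable f (x + s *: u).
  by move=> s01; have [+ _] := df s 0 s01 b0; rewrite scale0r addr0.
have [s s01 Es] : exists2 s : R, 0 < s < 1 & g (x + u) - g x = 'D_u g (x + s *: u).
  apply: (@mean_value_segment V g x u) => s s01.
  by apply: differentiableB; [exact: dg|exact: df0].
have s01' : 0 <= s <= 1 by case/andP: s01 => /ltW -> /ltW ->.
have [t t01 Et] : exists2 t : R, 0 < t < 1 &
   'D_u f (x + s *: u + v) - 'D_u f (x + s *: u) = 'D_v ('D_u f) (x + s *: u + t *: v).
  apply: (@mean_value_segment V ('D_u f) _ v) => t t01.
  by have [] := df s t s01' t01.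
exists s, t; split=> //; rewrite -Et.
have -> : f (x + u + v) - f (x + u) - (f (x + v) - f x) = g (x + u) - g x by [].
rewrite Es /g deriveB; last 2 first.
- by apply: diff_derivable; exact: dg.
- by apply: diff_derivable; exact: df0.
congr (_ - _); rewrite /derive.
by under eq_fun do rewrite /= -addrA.
Qed.

Lemma derive_scalel (V W : normedModType R) (f : V -> W) (x u : V) (h : R) :
  differentiable f x -> 'D_(h *: u) f x = h *: 'D_u f x.
Proof. by move=> df; rewrite !(deriveE _ df) linearZ. Qed.

Lemma two_continuous_ball (V : normedModType R) (U : set V) (F G : V -> R) (x : V)
    (e : R) :
  open U -> U x -> {for x, continuous F} -> {for x, continuous G} -> 0 < e ->
  exists2 d : R, 0 < d & forall y, ball x d y ->
    [/\ U y, `|F x - F y| < e & `|G x - G y| < e].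
Proof.
move=> oU Ux cF cG e0.
have /cvgrPdist_lt/(_ _ e0) N1 := cF.
have /cvgrPdist_lt/(_ _ e0) N2 := cG.
have NU : nbhs x U by exact: open_nbhs_nbhs.
have /nbhs_ballP[d /= d0 dP] : nbhs x [set y | [/\ U y, `|F x - F y| < e &
    `|G x - G y| < e]].
  by apply: filterS (filterI NU (filterI N1 N2)) => y [? [? ?]]; split.
by exists d.
Qed.

Section Schwarz.
Context {V : normedModType R} (U : set V) (oU : open U) (f : V -> R).
Hypothesis cf : Cn 3 U f.

Let d1 x : U x -> differentiable f x.
Proof. by case: cf => + _; apply. Qed.

Let d2 u x : U x -> differentiable ('D_u f) x.
Proof. by case: cf => _ /(_ u)[+ _]; apply. Qed.

Let d3 u v x : U x -> differentiable ('D_v ('D_u f)) x.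
Proof. by case: cf => _ /(_ u)[_ /(_ v)[+ _]]; apply. Qed.

Let mixed_scale u v x (h : R) : U x ->
  'D_(h *: v) ('D_(h *: u) f) x = h ^+ 2 * 'D_v ('D_u f) x.
Proof.
move=> Ux.
have E : \near x, 'D_(h *: u) f x = (h *: 'D_u f) x.
  by apply: (open_eq_near oU Ux) => y; rewrite inE => Uy; exact/derive_scalel/d1.
rewrite (near_eq_derive _ E) derive_scalel; last by apply: differentiableZ; exact: d2.
rewrite deriveZ; last by apply: diff_derivable; exact: d2.
by rewrite scalerA -expr2.
Qed.

(** The second difference of f along h u and h v does not depend on the order of
    the two vectors. By [second_difference] it is h^2 times a mixed derivative,
    taken in either order, at a point of a small parallelogram at x; as h tends
    to 0 continuity identifies both mixed derivatives at x. *)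
Lemma schwarz x u v : U x -> 'D_v ('D_u f) x = 'D_u ('D_v f) x.
Proof.
move=> Ux; apply/eqP; rewrite -subr_eq0 -normr_le0; apply/ler_addgt0Pl => e e0.
rewrite addr0.
have c1 := differentiable_continuous (d3 u v Ux).
have c2 := differentiable_continuous (d3 v u Ux).
have e2 : 0 < e / 2 by rewrite divr_gt0.
have [d d0 dP] := two_continuous_ball oU Ux c1 c2 e2.
(* A scale at which the whole parallelogram spanned by h u and h v stays in the ball. *)
have [h h0 hd] : exists2 h : R, 0 < h & h * (`|u| + `|v|) < d.
  have m0 : 0 < `|u| + `|v| + 1 by rewrite ltr_wpDl // addr_ge0.
  exists (d / (`|u| + `|v| + 1)); first by rewrite divr_gt0.
  by rewrite mulrAC ltr_pdivrMr // ltr_pM2l // ltrDl.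
have hin (s t : R) : 0 <= s <= 1 -> 0 <= t <= 1 ->
    ball x d (x + s *: (h *: u) + t *: (h *: v)).
  move=> /andP[s0 s1] /andP[t0 t1]; rewrite -ball_normE /ball_ /=.
  rewrite -addrA opprD addNKr normrN.
  apply: le_lt_trans (ler_normD _ _) _.
  rewrite !normrZ (ger0_norm s0) (ger0_norm t0) (gtr0_norm h0).
  apply: le_lt_trans hd.
  by rewrite mulrDr lerD // ler_piMl // mulr_ge0 // ltW.
have hinU (s t : R) : 0 <= s <= 1 -> 0 <= t <= 1 ->
    U (x + s *: (h *: u) + t *: (h *: v)).
  by move=> s01 t01; have [] := dP _ (hin s t s01 t01).
have hin' (s t : R) : 0 <= s <= 1 -> 0 <= t <= 1 ->
    U (x + s *: (h *: v) + t *: (h *: u)).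
  by move=> s01 t01; rewrite addrAC; exact: hinU.
have [s [t [s01 t01 E1]]] := @second_difference V f x (h *: u) (h *: v)
  (fun s t s01 t01 => conj (d1 (hinU s t s01 t01)) (d2 _ (hinU s t s01 t01))).
have [s' [t' [s01' t01' E2]]] := @second_difference V f x (h *: v) (h *: u)
  (fun s t s01 t01 => conj (d1 (hin' s t s01 t01)) (d2 _ (hin' s t s01 t01))).
have W (r : R) : 0 < r < 1 -> 0 <= r <= 1 by case/andP => /ltW -> /ltW ->.
have /= [_ B1 _] := dP _ (hin s t (W _ s01) (W _ t01)).
have /= [_ _ B2] := dP _ (hin t' s' (W _ t01') (W _ s01')).
rewrite mixed_scale in E1; last by apply: hinU; exact: W.
rewrite mixed_scale in E2; last by apply: hin'; exact: W.
rewrite (addrAC x (s' *: _)) in E2.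
have E : f (x + h *: u + h *: v) - f (x + h *: u) - (f (x + h *: v) - f x) =
  f (x + h *: v + h *: u) - f (x + h *: v) - (f (x + h *: u) - f x).
  by rewrite (addrAC x); ring.
have EE : 'D_v ('D_u f) (x + s *: (h *: u) + t *: (h *: v)) =
  'D_u ('D_v f) (x + t' *: (h *: u) + s' *: (h *: v)).
  apply: (@mulfI _ (h ^+ 2)); first by rewrite expf_neq0 // gt_eqF.
  exact: (etrans (esym E1) (etrans E E2)).
rewrite EE in B1; rewrite distrC in B2; move: B1 B2.
move: ('D_v _ x) ('D_u _ x) ('D_u _ _) => a b c B1 B2.
rewrite -(subrKA c); apply: le_trans (ler_normD _ _) _.
rewrite (splitr e); exact: (lerD (ltW B1) (ltW B2)).
Qed.

End Schwarz.

End MeanValue.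

(** * Smooth maps in coordinates *)

Section Coordinates.
Context {R : realType}.

Definition entry (m n : nat) (i : 'I_m) (j : 'I_n) (A : 'M[R]_(m, n)) : R := A i j.

Fact entry_is_linear m n i j : linear (@entry m n i j).
Proof. by move=> a A B; rewrite /entry !mxE. Qed.

HB.instance Definition _ m n i j :=
  GRing.isLinear.Build R 'M[R]_(m, n) R _ (@entry m n i j) (@entry_is_linear m n i j).

Lemma entry_continuous m n i j : continuous (@entry m n i j).
Proof. exact: coord_continuous. Qed.

Lemma fst_continuous (V W : normedModType R) : continuous (fst : V * W -> V).
Proof. by move=> p; exact: cvg_fst. Qed.

Lemma snd_continuous (V W : normedModType R) : continuous (snd : V * W -> W).
Proof. by move=> p; exact: cvg_snd. Qed.

Lemma derive_entry (V : normedModType R) m n (f : V -> 'M[R]_(m, n)) x v i j :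
  differentiable f x -> 'D_v (fun y => f y i j) x = ('D_v f x) i j.
Proof. by move=> df; exact: (derive_lin_comp (@entry_continuous m n i j) v df). Qed.

Lemma differentiable_entry (V : normedModType R) m n (f : V -> 'M[R]_(m, n)) x i j :
  differentiable f x -> differentiable (fun y => f y i j) x.
Proof. by move=> df; exact: (differentiable_lin_comp (@entry_continuous m n i j)). Qed.

Section Smooth.
Context {V W : normedModType R} (U : set V) (oU : open U).

Lemma smoothD (f g : V -> W) : smooth_on U f -> smooth_on U g ->
  smooth_on U (fun x => f x + g x).
Proof. by move=> /smooth_onP cf /smooth_onP cg; apply/smooth_onP => n; exact: CnD. Qed.

Lemma smoothZ (k : V -> R) (f : V -> W) : smooth_on U k -> smooth_on U f ->
  smooth_on U (fun x => k x *: f x).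
Proof. by move=> /smooth_onP ck /smooth_onP cf; apply/smooth_onP => n; exact: CnZ. Qed.

Lemma smooth_lin_comp (W' : normedModType R) (L : {linear W -> W'}) (f : V -> W) :
  continuous L -> smooth_on U f -> smooth_on U (L \o f).
Proof. by move=> cL /smooth_onP cf; apply/smooth_onP => n; exact: Cn_lin_comp. Qed.

Lemma eq_smooth (f g : V -> W) : {in U, f =1 g} -> smooth_on U f -> smooth_on U g.
Proof. by move=> fg /smooth_onP cf; apply/smooth_onP => n; exact: eq_Cn fg _. Qed.

Lemma sub_smooth (U' : set V) (f : V -> W) : U' `<=` U -> smooth_on U f -> smooth_on U' f.
Proof. by move=> sU sf vs x /sU; exact: sf. Qed.

Lemma smooth_cst (c : W) : smooth_on U (cst c).
Proof. by apply/smooth_onP => n; exact: Cn_cst. Qed.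

End Smooth.

Lemma smooth_lin (V W : normedModType R) (U : set V) (L : {linear V -> W}) :
  continuous L -> smooth_on U L.
Proof.
move=> cL; apply/smooth_onP => -[|n] //=; split=> [x _|v].
  exact: linear_differentiable.
have -> : 'D_v L = cst (L v) :> (V -> W); last exact: Cn_cst.
apply/funext => x; rewrite deriveE ?diff_lin //; exact: linear_differentiable.
Qed.

Lemma smoothM (V : normedModType R) (U : set V) (f g : V -> R) : open U ->
  smooth_on U f -> smooth_on U g -> smooth_on U (fun x => f x * g x).
Proof. by move=> oU; exact: smoothZ. Qed.

Lemma smooth_entry (V : normedModType R) (U : set V) m n (f : V -> 'M[R]_(m, n)) i j :
  open U -> smooth_on U f -> smooth_on U (fun x => f x i j).
Proof. by move=> oU; exact: (smooth_lin_comp oU (@entry_continuous m n i j)). Qed.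

Lemma Cn_comp_real (V W : normedModType R) n (U : set V) (J : set R)
    (F : R -> W) (g : V -> R) :
  open U -> (forall x, U x -> J (g x)) -> Cn n U g -> Cn n J F -> Cn n U (F \o g).
Proof.
move=> oU gU.
pose co (i : 'I_1) : {linear R -> R} := [the {linear R -> R} of idfun].
have cc i : continuous (co i) by move=> x; exact: cvg_id.
have ce (v : R) : v = \sum_(i < 1) co i v *: (1 : R).
  by rewrite big_ord1 /= [RHS]mulr1.
exact: (@Cn_comp R V R W 1 (fun=> 1) co cc ce n U J F g oU gU).
Qed.

Lemma smooth_comp_real (V W : normedModType R) (U : set V) (J : set R)
    (F : R -> W) (g : V -> R) :
  open U -> (forall x, U x -> J (g x)) -> smooth_on U g -> smooth_on J F ->
  smooth_on U (F \o g).
Proof.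
move=> oU gU /smooth_onP cg /smooth_onP cF; apply/smooth_onP => n.
exact: Cn_comp_real oU gU (cg n) (cF n).
Qed.

Definition pair_basis (k : 'I_(3 + 3)) : 'rV[R]_3 * 'rV[R]_3 :=
  match fintype.split k with
  | inl i => (delta_mx 0 i, 0)
  | inr i => (0, delta_mx 0 i)
  end.

Definition pair_coord (k : 'I_(3 + 3)) :
    {linear ('rV[R]_3 * 'rV[R]_3)%type -> R} :=
  match fintype.split k with
  | inl i => [the {linear _ -> _} of @entry 1 3 0 i \o fst]
  | inr i => [the {linear _ -> _} of @entry 1 3 0 i \o snd]
  end.

Lemma pair_coord_continuous k : continuous (pair_coord k).
Proof.
rewrite /pair_coord; case: fintype.split => i x.
  by apply: continuous_comp; [exact: fst_continuous|exact: entry_continuous].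
by apply: continuous_comp; [exact: snd_continuous|exact: entry_continuous].
Qed.

Lemma pair_coordE v : v = \sum_(k < 3 + 3) pair_coord k v *: pair_basis k.
Proof.
case: v => a b; rewrite big_split_ord /=.
have El (i : 'I_3) : pair_coord (lshift 3 i) (a, b) *: pair_basis (lshift 3 i) =
    (a 0 i *: delta_mx 0 i, 0).
  rewrite /pair_coord /pair_basis (unsplitK (inl i : 'I_3 + 'I_3)).
  by apply/eqP; rewrite xpair_eqE /= scaler0 !eqxx.
have Er (i : 'I_3) : pair_coord (rshift 3 i) (a, b) *: pair_basis (rshift 3 i) =
    (0, b 0 i *: delta_mx 0 i).
  rewrite /pair_coord /pair_basis (unsplitK (inr i : 'I_3 + 'I_3)).
  by apply/eqP; rewrite xpair_eqE /= scaler0 !eqxx.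
rewrite (eq_bigr _ (fun i _ => El i)) (eq_bigr _ (fun i _ => Er i)).
apply/eqP; rewrite xpair_eqE /=.
rewrite !(raddf_sum fst) !(raddf_sum snd) /=.
by rewrite -!row_sum_delta !big1_eq addr0 add0r !eqxx.
Qed.

Lemma smooth_comp_pair (V W : normedModType R) (U : set V)
    (U' : set ('rV[R]_3 * 'rV[R]_3)) (F : 'rV[R]_3 * 'rV[R]_3 -> W)
    (g : V -> 'rV[R]_3 * 'rV[R]_3) :
  open U -> (forall x, U x -> U' (g x)) -> smooth_on U g -> smooth_on U' F ->
  smooth_on U (F \o g).
Proof.
move=> oU gU /smooth_onP cg /smooth_onP cF; apply/smooth_onP => n.
exact: (Cn_comp pair_coord_continuous pair_coordE oU gU).
Qed.

Lemma derive_rsqrt (V : normedModType R) (L : V -> R) x v :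
  differentiable L x -> 0 < L x ->
  differentiable (fun y => (Num.sqrt (L y))^-1) x /\
  'D_v (fun y => (Num.sqrt (L y))^-1) x =
    - 2^-1 * ((Num.sqrt (L x))^-1) ^+ 3 * 'D_v L x.
Proof.
move=> dL L0; have s0 : Num.sqrt (L x) != 0 by rewrite gt_eqF // sqrtr_gt0.
have [d1 E1] := @is_deriveV R Num.sqrt (L x) _ 1 s0 (is_derive1_sqrt L0).
have d2 : differentiable (fun s : R => (Num.sqrt s)^-1) (L x).
  exact/derivable1_diffP.
have dc := differentiable_comp dL d2; split; first exact: dc.
rewrite (deriveE _ dc) (diff_comp dL d2) /= -(deriveE _ dL).
have -> : 'D_v L x = 'D_v L x *: (1 : R) by rewrite [RHS]mulr1.
rewrite linearZ /= -(deriveE _ d2) E1 scaler1 /=.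
rewrite /GRing.scale /=; move: ('D_v L x) (Num.sqrt (L x)) s0 => D s s0.
by field.
Qed.

(** The derivative of L^(-1/2) is a polynomial expression in L^(-1/2) and the
    derivative of L, hence smoothness by induction on the order. *)
Lemma smooth_rsqrt (V : normedModType R) (U : set V) (L : V -> R) :
  open U -> smooth_on U L -> (forall x, U x -> 0 < L x) ->
  smooth_on U (fun x => (Num.sqrt (L x))^-1).
Proof.
move=> oU sL L0; apply/smooth_onP => n.
have dL x : U x -> differentiable L x by exact: smooth_on_differentiable.
elim: n => //= n IH; split=> [x Ux|v].
  exact: (derive_rsqrt 0 (dL _ Ux) (L0 _ Ux)).1.
set r := (fun x => _) in IH *.
have C : Cn n U (fun x => (- 2^-1) *: ((r x *: (r x *: r x)) *: 'D_v L x)).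
  apply: (@CnZ _ _ _ _ oU n (cst _)); first exact: Cn_cst.
  apply: CnZ => //; last exact: (smooth_onP _ _).1 (smooth_on_derive v sL) n.
  by apply: CnZ => //; apply: CnZ.
apply: eq_Cn C => // x; rewrite inE => Ux.
rewrite (derive_rsqrt v (dL _ Ux) (L0 _ Ux)).2 -/(r x).
by rewrite /GRing.scale /=; move: (r x) ('D_v L x) => a b; ring.
Qed.

Lemma ball_segment (V : normedModType R) (x0 x y : V) (r t : R) :
  ball x0 r x -> ball x0 r y -> 0 <= t <= 1 -> ball x0 r (x + t *: (y - x)).
Proof.
move=> Bx By /andP[t0 t1]; move: Bx By; rewrite -ball_normE /ball_ /= => Bx By.
have -> : x0 - (x + t *: (y - x)) = (1 - t) *: (x0 - x) + t *: (x0 - y).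
  rewrite scalerBl scale1r -addrA [- _ + _]addrC -scalerBr.
  have -> : x0 - y - (x0 - x) = x - y by rewrite opprB addrC subrKA.
  by rewrite opprD addrA -scalerN opprB.
apply: le_lt_trans (ler_normD _ _) _.
rewrite !normrZ (ger0_norm t0) ger0_norm ?subr_ge0 //.
have [->|t1'] := eqVneq t 1; first by rewrite subrr mul0r add0r mul1r.
apply: (@lt_le_trans _ _ ((1 - t) * r + t * r)); last by rewrite -mulrDl subrK mul1r.
apply: ltr_leD.
  by rewrite ltr_pM2l // subr_gt0 lt_neqAle t1' t1.
by rewrite ler_wpM2l // ltW.
Qed.

Lemma mean_value_ball (V : normedModType R) (f : V -> R) (x0 x y : V) (r : R) :
  (forall z, ball x0 r z -> differentiable f z) -> ball x0 r x -> ball x0 r y ->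
  exists2 z, ball x0 r z & f y - f x = 'D_(y - x) f z.
Proof.
move=> df Bx By.
have [t /andP[/ltW t0 /ltW t1]] :=
  mean_value_segment (fun t t01 => df _ (ball_segment Bx By t01)).
rewrite addrCA subrr addr0 => E; exists (x + t *: (y - x)) => //.
by apply: ball_segment => //; rewrite t0 t1.
Qed.

Lemma const_on_ball (V : normedModType R) (f : V -> R) (x0 : V) (r : R) :
  (forall x, ball x0 r x -> differentiable f x /\ forall v, 'D_v f x = 0) ->
  forall x y, ball x0 r x -> ball x0 r y -> f x = f y.
Proof.
move=> df x y Bx By.
have [z Bz] := mean_value_ball (fun z Bz => (df z Bz).1) Bx By.
by rewrite (df z Bz).2 => /subr0_eq.
Qed.

End Coordinates.

(** * Maps with injective differential are locally open *)

Section LocalInversion.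
Context {R : realType}.

Lemma normr_entry_le n (v : 'rV[R]_n) j : `|v 0 j| <= `|v|.
Proof.
rewrite [leRHS]/Num.norm /= mx_normrE.
exact: (le_bigmax _ (fun ij : 'I_1 * 'I_n => `|v ij.1 ij.2|) (0, j)).
Qed.

Lemma normr_row_le n (v : 'rV[R]_n) c :
  0 <= c -> (forall j, `|v 0 j| <= c) -> `|v| <= c.
Proof.
move=> c0 vc; rewrite [leLHS]/Num.norm /= mx_normrE.
by apply: bigmax_le => // -[i j] _ /=; rewrite ord1.
Qed.

Lemma normr_row_lt n (v : 'rV[R]_n) c :
  0 < c -> (forall j, `|v 0 j| < c) -> `|v| < c.
Proof.
move=> c0 vc; rewrite [ltLHS]/Num.norm /= mx_normrE.
by apply: bigmax_lt => // -[i j] _ /=; rewrite ord1.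
Qed.

Section InjectiveLinear.
Variables (n : nat) (A : {linear 'rV[R]_n -> 'rV[R]_n}).
Hypothesis A_inj : injective A.

Let M_unit : lin1_mx A \in unitmx.
Proof.
rewrite -row_free_unit -kermx_eq0; apply/eqP/row_matrixP => i.
apply: A_inj; rewrite row0 linear0 -mul_rV_lin1.
by rewrite -row_mul mulmx_ker row0.
Qed.

Lemma inj_linear_surj z : exists w, A w = z.
Proof. by exists (z *m invmx (lin1_mx A)); rewrite -mul_rV_lin1 mulmxKV. Qed.

(** The inverse matrix bounds w by A w; one is added to the sum of its entries so
    that the constant is positive even in dimension 0. *)
Lemma inj_linear_lower_bound : exists2 k : R, 0 < k & forall w, `|w| <= k * `|A w|.
Proof.
pose N := invmx (lin1_mx A).
have S0 : 0 <= \sum_i \sum_j `|N i j|.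
  by apply: sumr_ge0 => i _; apply: sumr_ge0.
exists (\sum_i \sum_j `|N i j| + 1); first exact: ltr_wpDl.
move=> w; have Ew : w = A w *m N by rewrite -mul_rV_lin1 mulmxK.
rewrite {1}Ew; move: (A w) => v.
apply: normr_row_le => [|j]; first by rewrite mulr_ge0 // addr_ge0.
rewrite mxE; apply: le_trans (ler_norm_sum _ _ _) _.
rewrite mulrDl mul1r; apply: ler_wpDr => //.
rewrite mulr_suml; apply: ler_sum => i _; rewrite normrM mulrC ler_pM //.
  by rewrite (bigD1 j) //= lerDl sumr_ge0.
exact: normr_entry_le.
Qed.

End InjectiveLinear.

Lemma derive_row_basis n (f : 'rV[R]_n -> R) x u : differentiable f x ->
  'D_u f x = \sum_i u 0 i * 'D_(delta_mx 0 i) f x.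
Proof.
move=> df; rewrite (deriveE _ df) {1}(row_sum_delta u) linear_sum /=.
by apply: eq_bigr => i _; rewrite linearZ /= (deriveE _ df).
Qed.

(** Near x0 the partial derivatives of y differ little from those at x0, so by the
    mean value theorem y differs from its differential at x0 by a map with small
    Lipschitz constant, while that differential expands distances by a fixed
    factor. *)
Lemma local_lower_bound n (y : 'rV[R]_n -> 'rV[R]_n) (U : set 'rV[R]_n) x0 :
  open U -> smooth_on U y -> U x0 -> injective ('d y x0) ->
  exists r m : R, [/\ 0 < r, 0 < m, ball x0 r `<=` U &
    forall x x', ball x0 r x -> ball x0 r x' -> m * `|x - x'| <= `|y x - y x'|].
Proof.
move=> oU sy Ux0 dinj.
have dy x : U x -> differentiable y x by exact: smooth_on_differentiable.
have [k k0 kP] := inj_linear_lower_bound dinj.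
(* Each row of partial derivatives has n entries; e makes n e at most half of 1/k. *)
pose e := (2 * k * (n%:R + 1))^-1.
have n0 : (0 : R) < n%:R + 1 by rewrite ltr_wpDl.
have e0 : 0 < e by rewrite invr_gt0 !mulr_gt0.
pose g j z := y z 0 j.
have sg j : smooth_on U (g j) by exact: smooth_entry.
have dg j z : U z -> differentiable (g j) z by exact: smooth_on_differentiable.
pose d i j := 'D_(delta_mx 0 i) (g j).
have near_d : \forall z \near x0, forall i j, `|d i j x0 - d i j z| < e.
  apply: (@filter_forall _ _ _ _ (nbhs_filter x0)) => i.
  apply: (@filter_forall _ _ _ _ (nbhs_filter x0)) => j.
  have cd : {for x0, continuous (d i j)}.
    apply: differentiable_continuous; apply: smooth_on_differentiable Ux0.
    exact: smooth_on_derive.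
  by have /cvgrPdist_lt/(_ _ e0) := cd.
have near_all : nbhs x0 [set z | U z /\ forall i j, `|d i j x0 - d i j z| < e].
  by apply: filterI => //; exact: open_nbhs_nbhs.
have /nbhs_ballP[r /= r0 rP] := near_all.
exists r, ((2 * k)^-1); split=> //; first by rewrite invr_gt0 mulr_gt0.
  by move=> z /rP[].
move=> x x' Bx Bx'.
set u := x - x'.
have key : `|y x - y x' - 'd y x0 u| <= (2 * k)^-1 * `|u|.
  apply: normr_row_le => [|j]; first by rewrite mulr_ge0 // invr_ge0 ltW // mulr_gt0.
  have [z Bz E] := mean_value_ball (fun z Bz => dg j z (rP z Bz).1) Bx' Bx.
  rewrite !mxE -/(g j x) -/(g j x') E -(deriveE _ (dy _ Ux0)).
  rewrite -(derive_entry _ _ _ (dy _ Ux0)) -/(g j).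
  rewrite !derive_row_basis; [|exact: dg|exact: dg (rP z Bz).1].
  rewrite -sumrB; apply: le_trans (ler_norm_sum _ _ _) _.
  apply: (@le_trans _ _ (\sum_(i < n) `|u| * e)).
    apply: ler_sum => i _; rewrite -mulrBr normrM ler_pM ?normr_entry_le //.
    by rewrite distrC ltW // (rP z Bz).2.
  rewrite sumr_const card_ord -[leLHS]mulr_natl mulrCA [leRHS]mulrC ler_wpM2l //.
  rewrite /e invfM mulrCA ler_piMr ?invr_ge0 ?ltW ?mulr_gt0 //.
  by rewrite ltr_pdivrMr // mul1r ltrDl.
have := kP u; rewrite -ler_pdivrMl // => ku.
have : `|'d y x0 u| <= `|y x - y x'| + (2 * k)^-1 * `|u|.
  rewrite -[X in `|X| <= _](subKr (y x - y x')).
  by apply: le_trans (ler_normB _ _) _; rewrite lerD2l.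
rewrite -lerBlDr; apply: le_trans; rewrite lerBrDr.
apply: le_trans ku.
by rewrite -mulrDl invfM -mulrDl -[2^-1]mul1r -splitr mul1r mulrC.
Qed.

(** For z close to y x0, a point x of a small closed ball minimising the squared
    Euclidean distance from y x to z is an interior point: the lower bound makes
    y x far from z on the boundary sphere. At an interior minimum the derivative
    of the distance in the direction w with 'd y x w = y x - z vanishes, and that
    derivative is twice the squared distance. *)
Lemma local_open_map n (y : 'rV[R]_n -> 'rV[R]_n) x0 (r m : R) :
  0 < r -> 0 < m ->
  (forall x, ball x0 r x -> differentiable y x) ->
  (forall x, ball x0 r x -> injective ('d y x)) ->
  (forall x x', ball x0 r x -> ball x0 r x' -> m * `|x - x'| <= `|y x - y x'|) ->
  exists2 e : R, 0 < e & forall z, ball (y x0) e z -> exists2 x, ball x0 r x & y x = z.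
Proof.
move=> r0 m0 dy dinj low.
pose s := r / 2; have s0 : 0 < s by rewrite divr_gt0.
have sr : s < r by rewrite ltr_pdivrMr // ltr_pMr // ltr1n.
(* On the sphere of radius s the distance to y x0 is at least m s, whereas a
   minimiser is within (n + 1) e of z, and z within e of y x0. *)
have [e e0 eE] : exists2 e : R, 0 < e & (n%:R + 1) * e + e = m * s.
  have n0 : (0 : R) < n%:R + 2 by rewrite ltr_wpDl.
  exists (m * s / (n%:R + 2)); first by rewrite divr_gt0 // mulr_gt0.
  by rewrite -[X in _ + X]mul1r -mulrDl -addrA mulrC divfK // gt_eqF.
exists e => // z Bz.
pose K := [set x : 'rV[R]_n | `|x - x0| <= s].
have KB x : K x -> ball x0 r x.
  by rewrite -ball_normE /ball_ /K /= distrC => /le_lt_trans; apply.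
pose N x := \sum_j (y x 0 j - z 0 j) ^+ 2.
pose c j x := y x 0 j - z 0 j.
have NE : N = \sum_j (fun x => c j x *: c j x).
  by apply/funext => x; rewrite fct_sumE.
have dyj j x : ball x0 r x -> differentiable (fun x => y x 0 j) x.
  by move=> Bx; exact/differentiable_entry/dy.
have dc j x : ball x0 r x -> differentiable (c j) x.
  by move=> Bx; apply: differentiableB; [exact: dyj|exact: differentiable_cst].
have dN x : ball x0 r x -> differentiable N x.
  move=> Bx; rewrite NE; apply: differentiable_sum => j.
  exact: (differentiable_scale (dc j x Bx) (dc j x Bx)).1.
have Kc : compact K.
  apply: bounded_closed_compact.
    exists (`|x0| + s); split; first exact: num_real.
    move=> M ltM x Kx; apply: le_trans (ltW ltM).
    by rewrite -(subrK x0 x) addrC (le_trans (ler_normD _ _)) // lerD2l.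
  have -> : K = closed_ball_ (fun x => `|x|) x0 s.
    by apply/seteqP; split => x; rewrite /K /closed_ball_ /= distrC.
  exact: closed_closed_ball_.
have K0 : K x0 by rewrite /K /= subrr normr0 ltW.
have cN : {within K, continuous N}.
  apply: continuous_in_subspaceT => x; rewrite inE => Kx.
  exact/differentiable_continuous/dN/KB.
have [x] := EVT_min_rV (ex_intro _ x0 K0) Kc cN.
rewrite inE => Kx xmin.
have Nx0 : N x <= n%:R * e ^+ 2.
  apply: le_trans (xmin x0 _) _; first by rewrite inE.
  rewrite /N; apply: (@le_trans _ _ (\sum_(j < n) e ^+ 2)).
    apply: ler_sum => j _; rewrite -[X in X <= _](real_normK (num_real _)) ler_pXn2r ?nnegrE ?(ltW e0) //; apply: ltW.
    move: Bz; rewrite -ball_normE /ball_ /= => Bz.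
    apply: le_lt_trans Bz; have := normr_entry_le (y x0 - z) j.
    by rewrite !mxE.
  by rewrite sumr_const card_ord mulr_natl.
have xs : `|x - x0| < s.
  rewrite lt_neqAle Kx andbT; apply/eqP => xs.
  have nyz : `|y x - z| <= (n%:R + 1) * e.
    apply: normr_row_le => [|j]; first by rewrite mulr_ge0 // ltW // ltr_wpDl.
    have ne0 : 0 <= (n%:R + 1) * e by rewrite mulr_ge0 // ltW // ltr_wpDl.
    rewrite -ler_sqr ?nnegrE // real_normK ?num_real // !mxE.
    apply: (@le_trans _ _ (N x)).
      by rewrite /N (bigD1 j) //= lerDl sumr_ge0 // => i _; rewrite sqr_ge0.
    apply: le_trans Nx0 _; rewrite exprMn ler_wpM2r ?sqr_ge0 //.
    by rewrite sqrrD1 -addrA ler_wpDl ?sqr_ge0 // mulr2n -addrA lerDl addr_ge0.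
  have := low x x0 (KB _ Kx) (KB _ K0); rewrite xs => lows.
  move: Bz; rewrite -ball_normE /ball_ /= => Bz.
  have : m * s < (n%:R + 1) * e + e.
    apply: le_lt_trans lows _; rewrite -(subrKA z).
    apply: le_lt_trans (ler_normD _ _) _.
    by rewrite ler_ltD // distrC.
  by rewrite eE ltxx.
exists x; first exact: KB.
have Bx := KB _ Kx.
have [w Ew] := inj_linear_surj (dinj x Bx) (y x - z).
(* Fermat's rule along the line through x with direction w. *)
have crit : 'D_w N x = 0.
  have [d d0 dP] : exists2 d : R, 0 < d & forall t, `|t| < d -> K (x + t *: w).
    have w1 : 0 < `|w| + 1 by rewrite ltr_wpDl.
    exists ((s - `|x - x0|) / (`|w| + 1)); first by rewrite divr_gt0 ?subr_gt0.
    move=> t; rewrite ltr_pdivlMr // => tw; rewrite /K /= addrAC.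
    have tw' : `|t| * `|w| <= s - `|x - x0|.
      by apply: le_trans (ltW tw); rewrite ler_wpM2l // lerDl.
    by apply: le_trans (ler_normD _ _) _; rewrite normrZ -lerBrDl.
  have Bt (t : R) : t \in `]-d, d[ -> K (x + t *: w).
    by rewrite in_itv /= -ltr_norml; exact: dP.
  have := @derive1_at_min R (fun t => N (x + t *: w)) (- d) d 0.
  case; first by rewrite ltW // gtrN.
  - move=> t /Bt Kt; have [] := is_derive_line (dN _ (KB _ Kt)); exact.
  - by rewrite in_itv /= oppr_lt0 d0.
  - by move=> t /Bt Kt; rewrite scale0r addr0; apply: xmin; rewrite inE.
  move=> _; have /is_derive_line[_ ->] : differentiable N (x + 0 *: w).
    by rewrite scale0r addr0; exact: dN.
  by rewrite scale0r addr0.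
have DN : 'D_w N x = \sum_j 2 * (y x 0 j - z 0 j) ^+ 2.
  rewrite NE derive_sum => [|j]; last first.
    exact/diff_derivable/(differentiable_scale (dc j x Bx) (dc j x Bx)).1.
  apply: eq_bigr => j _; rewrite (differentiable_scale (dc j x Bx) (dc j x Bx)).2.
  have -> : 'D_w (c j) x = c j x.
    rewrite /c deriveB; [|by apply: diff_derivable; exact: dyj|exact: derivable_cst].
    rewrite derive_cst subr0 derive_entry; last exact: dy.
    by rewrite (deriveE _ (dy _ Bx)) Ew !mxE.
  change (c j x * c j x + c j x * c j x = 2 * c j x ^+ 2).
  by move: (c j x) => a; ring.
move: crit; rewrite DN -mulr_sumr => /eqP; rewrite mulf_eq0 pnatr_eq0 /=.
rewrite psumr_eq0 => [|j _]; last exact: sqr_ge0.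
move=> /allP sum0; apply/rowP => j; apply/eqP; rewrite -subr_eq0 -sqrf_eq0.
by apply: sum0; rewrite mem_index_enum.
Qed.

End LocalInversion.

(** * Bilinear maps and Lorentz algebra *)

Lemma entry_neq0 (R : nmodType) n (a : 'rV[R]_n) : a != 0 -> exists i, a 0 i != 0.
Proof.
move=> nz; apply: contrapT => h; case/eqP: nz; apply/rowP => i; rewrite mxE.
by apply: contrapT => /eqP hi; apply: h; exists i.
Qed.

Section Rows.
Context {R : realType} {V : normedModType R} (n : nat).
Implicit Types f : V -> 'rV[R]_n.

Lemma row_funE f : f = \sum_i (fun y => f y 0 i *: delta_mx 0 i).
Proof. by apply/funext => y; rewrite fct_sumE -row_sum_delta. Qed.

Lemma differentiable_row f x :
  (forall i, differentiable (fun y => f y 0 i) x) -> differentiable f x.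
Proof.
move=> df; rewrite (row_funE f); apply: differentiable_sum => i.
exact: differentiableZl (df i).
Qed.

Lemma smooth_row (U : set V) f : open U ->
  (forall i, smooth_on U (fun y => f y 0 i)) -> smooth_on U f.
Proof.
move=> oU sf; apply/smooth_onP => k.
pose F (i : 'I_n) (y : V) : 'rV[R]_n := f y 0 i *: delta_mx 0 i.
have CF i : Cn k U (F i).
  by apply: CnZ => //; [exact: (smooth_onP _ _).1 (sf i) k|exact: Cn_cst].
have C : Cn k U (fun y => \sum_(i < n) F i y) by exact: (Cn_sum oU CF).
by apply: eq_Cn C => // y _; rewrite -row_sum_delta.
Qed.

End Rows.

Lemma linear_row_continuous (R : realType) m n (L : {linear 'rV[R]_m -> 'rV[R]_n}) :
  continuous L.
Proof.
move=> x; apply: differentiable_continuous.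
have -> : (L : _ -> _) = \sum_i (fun y : 'rV[R]_m => y 0 i *: L (delta_mx 0 i)).
  apply/funext => y; rewrite fct_sumE {1}(row_sum_delta y) linear_sum.
  by apply: eq_bigr => i _; rewrite linearZ.
by apply: differentiable_sum => i; exact: differentiableZl (differentiable_coord _ _ _).
Qed.

Section BilinearDerivative.
Context {R : realType} {V U1 U2 W : normedModType R}.
Variable B : {bilinear U1 -> U2 -> W}.
Hypothesis cB : continuous (fun p : U1 * U2 => B p.1 p.2).

Lemma differentiable_bilinear_comp (f : V -> U1) (g : V -> U2) x :
  differentiable f x -> differentiable g x ->
  differentiable (fun y => B (f y) (g y)) x.
Proof.
move=> df dg.
exact: (differentiable_comp (differentiable_pair df dg) (differentiable_bilin (f x, g x) cB)).
Qed.

Lemma derive_bilinear_comp (f : V -> U1) (g : V -> U2) x v :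
  differentiable f x -> differentiable g x ->
  'D_v (fun y => B (f y) (g y)) x = B ('D_v f x) (g x) + B (f x) ('D_v g x).
Proof.
move=> df dg.
have dp := differentiable_pair df dg.
have dB : differentiable (fun p : U1 * U2 => B p.1 p.2) (f x, g x).
  exact: differentiable_bilin.
have E : 'd (fun p : U1 * U2 => B p.1 p.2) (f x, g x) =
  (fun q : U1 * U2 => B (f x) q.2 + B q.1 (g x)) :> (_ -> _) := diff_bilin _ cB.
have dc := differentiable_comp dp dB.
rewrite (deriveE _ dc) (deriveE _ df) (deriveE _ dg) (diff_comp dp dB) [LHS]/= E.
by rewrite diff_pair //= addrC.
Qed.

End BilinearDerivative.

Section LorentzAlgebra.
Context {R : realType}.
Implicit Types (a b c d p x : 'rV[R]_3).

Lemma ord3P (P : 'I_3 -> Prop) : P 0 -> P 1 -> P 2%:R -> forall i, P i.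
Proof.
move=> P0 P1 P2 [[|[|[|//]]] h].
- by rewrite (_ : Ordinal h = 0) //; exact: val_inj.
- by rewrite (_ : Ordinal h = 1) //; exact: val_inj.
- by rewrite (_ : Ordinal h = 2%:R) //; exact: val_inj.
Qed.

Lemma rowP3 a b : a 0 0 = b 0 0 -> a 0 1 = b 0 1 -> a 0 2%:R = b 0 2%:R -> a = b.
Proof. by move=> e0 e1 e2; apply/rowP; exact: ord3P. Qed.

Lemma lcross0 a b : lcross a b 0 0 = a 0 2%:R * b 0 1 - a 0 1 * b 0 2%:R.
Proof. by rewrite mxE. Qed.
Lemma lcross1 a b : lcross a b 0 1 = a 0 2%:R * b 0 0 - a 0 0 * b 0 2%:R.
Proof. by rewrite mxE. Qed.
Lemma lcross2 a b : lcross a b 0 2%:R = a 0 0 * b 0 1 - a 0 1 * b 0 0.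
Proof. by rewrite mxE. Qed.
Definition lcrossE := (lcross0, lcross1, lcross2).

Fact lor_bilinear : bilinear_for
    (GRing.Scale.Law.clone _ _ *:%R _) (GRing.Scale.Law.clone _ _ *:%R _)
    (@lor R : 'rV[R]_3 -> 'rV[R]_3 -> R).
Proof.
split=> [u'|u] a x y; rewrite /lor !mxE /GRing.scale /=; ring.
Qed.

HB.instance Definition _ := bilinear_isBilinear.Build R 'rV[R]_3 'rV[R]_3 R _ _
  (@lor R : 'rV[R]_3 -> 'rV[R]_3 -> R) lor_bilinear.

Fact lcross_bilinear : bilinear_for
    (GRing.Scale.Law.clone _ _ *:%R _) (GRing.Scale.Law.clone _ _ *:%R _)
    (@lcross R : 'rV[R]_3 -> 'rV[R]_3 -> 'rV[R]_3).
Proof.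
by split=> [u'|u] a x y; apply: rowP3; rewrite !(lcrossE, mxE) /=; ring.
Qed.

HB.instance Definition _ := bilinear_isBilinear.Build R 'rV[R]_3 'rV[R]_3 'rV[R]_3 _ _
  (@lcross R : 'rV[R]_3 -> 'rV[R]_3 -> 'rV[R]_3) lcross_bilinear.

Lemma lorC a b : lor a b = lor b a.
Proof. by rewrite /lor; ring. Qed.

Lemma lorDl a b c : lor (a + b) c = lor a c + lor b c. Proof. exact: linearDl. Qed.
Lemma lorDr a b c : lor c (a + b) = lor c a + lor c b. Proof. exact: linearDr. Qed.
Lemma lorNl a b : lor (- a) b = - lor a b. Proof. exact: linearNl. Qed.
Lemma lorNr a b : lor a (- b) = - lor a b. Proof. exact: linearNr. Qed.
Lemma lorZl k a b : lor (k *: a) b = k * lor a b. Proof. exact: linearZl_LR. Qed.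
Lemma lorZr k a b : lor a (k *: b) = k * lor a b. Proof. exact: linearZr_LR. Qed.
Lemma lor0l a : lor 0 a = 0. Proof. exact: linear0l. Qed.
Lemma lor0r a : lor a 0 = 0. Proof. exact: linear0r. Qed.

Lemma lcrossC a b : lcross a b = - lcross b a.
Proof. by apply: rowP3; rewrite !(lcrossE, mxE) /=; ring. Qed.

Lemma lor_lcross_l a b : lor (lcross a b) a = 0.
Proof. by rewrite /lor !lcrossE; ring. Qed.

Lemma lor_lcross_r a b : lor (lcross a b) b = 0.
Proof. by rewrite /lor !lcrossE; ring. Qed.

Lemma lor_lcross_cycle a b c : lor (lcross a b) c = lor (lcross b c) a.
Proof. by rewrite /lor !lcrossE; ring. Qed.

(** The Lorentzian form of the identity of Binet and Cauchy; the sign differs from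
    the Euclidean one. *)
Lemma lor_lcross2 a b c d :
  lor (lcross a b) (lcross c d) = lor a d * lor b c - lor a c * lor b d.
Proof. by rewrite /lor !lcrossE; ring. Qed.

Lemma lcross_lcross a b c : lcross a (lcross b c) = lor a b *: c - lor a c *: b.
Proof. by apply: rowP3; rewrite /lor !(lcrossE, mxE) /=; ring. Qed.

Lemma lor_nondeg a : (forall b, lor a b = 0) -> a = 0.
Proof.
move=> h; apply: rowP3; rewrite !mxE.
- by have := h (delta_mx 0 0); rewrite /lor !mxE /=; lra.
- by have := h (delta_mx 0 1); rewrite /lor !mxE /=; lra.
- by have := h (delta_mx 0 2%:R); rewrite /lor !mxE /=; lra.
Qed.

Lemma differentiable_fst_entry i (q : 'rV[R]_3 * 'rV[R]_3) :
  differentiable (fun q : 'rV[R]_3 * 'rV[R]_3 => q.1 0 i) q.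
Proof. by apply: differentiable_entry; apply: linear_differentiable; exact: fst_continuous. Qed.

Lemma differentiable_snd_entry i (q : 'rV[R]_3 * 'rV[R]_3) :
  differentiable (fun q : 'rV[R]_3 * 'rV[R]_3 => q.2 0 i) q.
Proof. by apply: differentiable_entry; apply: linear_differentiable; exact: snd_continuous. Qed.

Lemma lor_continuous : continuous (fun q : 'rV[R]_3 * 'rV[R]_3 => lor q.1 q.2).
Proof.
have d1 := differentiable_fst_entry; have d2 := differentiable_snd_entry.
move=> q; apply: differentiable_continuous; rewrite /lor.
by do !apply: differentiableD; try apply: differentiableN; apply: differentiableM.
Qed.

Lemma lcross_continuous : continuous (fun q : 'rV[R]_3 * 'rV[R]_3 => lcross q.1 q.2).
Proof.
have d1 := differentiable_fst_entry; have d2 := differentiable_snd_entry.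
move=> q; apply: differentiable_continuous; apply: differentiable_row.
apply: ord3P.
- under eq_fun do rewrite lcross0.
  by apply: differentiableB; apply: differentiableM.
- under eq_fun do rewrite lcross1.
  by apply: differentiableB; apply: differentiableM.
- under eq_fun do rewrite lcross2.
  by apply: differentiableB; apply: differentiableM.
Qed.

Section Derivatives.
Context {V : normedModType R}.
Implicit Types f g : V -> 'rV[R]_3.

Lemma differentiable_lor f g (x : V) : differentiable f x -> differentiable g x ->
  differentiable (fun y => lor (f y) (g y)) x.
Proof. exact: (differentiable_bilinear_comp lor_continuous). Qed.

Lemma derive_lor f g (x v : V) : differentiable f x -> differentiable g x ->
  'D_v (fun y => lor (f y) (g y)) x = lor ('D_v f x) (g x) + lor (f x) ('D_v g x).
Proof. exact: (derive_bilinear_comp lor_continuous). Qed.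

Lemma differentiable_lcross f g (x : V) : differentiable f x -> differentiable g x ->
  differentiable (fun y => lcross (f y) (g y)) x.
Proof. exact: (differentiable_bilinear_comp lcross_continuous). Qed.

Lemma smooth_lor (U : set V) f g : open U -> smooth_on U f -> smooth_on U g ->
  smooth_on U (fun y => lor (f y) (g y)).
Proof.
move=> oU sf sg; have sm i : smooth_on U (fun y => f y 0 i * g y 0 i).
  by apply: smoothM => //; exact: smooth_entry.
have s0 : smooth_on U (fun y => (-1) *: (f y 0 0 * g y 0 0)).
  exact: (smoothZ oU (smooth_cst (U := U) (-1 : R)) (sm 0)).
apply: eq_smooth (smoothD oU (smoothD oU s0 (sm 1)) (sm 2%:R)) => // y _.
by rewrite /lor scaleN1r.
Qed.

End Derivatives.

End LorentzAlgebra.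

(** * Tangent planes of the hyperbolic plane *)

Section HyperbolicPlane.
Context {R : realType}.
Implicit Types (a b p x : 'rV[R]_3).

Lemma hypN1P x : hyp (-1) x <-> lor x x = -1 /\ 0 < x 0 0.
Proof. by rewrite /hyp /= invrN1. Qed.

Lemma kahlerN1 x a b : kahler (-1) x a b = lor (lcross x a) b.
Proof. by rewrite /kahler /hypJ opprK sqrtr1 scale1r. Qed.

Lemma hypJN1 x a : hypJ (-1) x a = lcross x a.
Proof. by rewrite /hypJ opprK sqrtr1 scale1r. Qed.

(** Multiplying by the square of the time coordinate of p turns the Lorentzian
    length of a tangent vector into a sum of squares: this is why the induced
    metric is positive definite. *)
Lemma tangent_norm p a : lor p p = -1 -> lor p a = 0 ->
  p 0 0 ^+ 2 * lor a a =
    a 0 1 ^+ 2 + a 0 2%:R ^+ 2 + (p 0 1 * a 0 2%:R - p 0 2%:R * a 0 1) ^+ 2.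
Proof.
rewrite /lor => hp hpa.
have e1 : p 0 0 * a 0 0 = p 0 1 * a 0 1 + p 0 2%:R * a 0 2%:R by lra.
have e2 : p 0 0 ^+ 2 = 1 + p 0 1 ^+ 2 + p 0 2%:R ^+ 2.
  by apply/eqP; rewrite -subr_eq0 -oppr_eq0; apply/eqP; rewrite -[RHS](subrr (-1)) -{1}hp; ring.
transitivity (- (p 0 0 * a 0 0) ^+ 2 + p 0 0 ^+ 2 * (a 0 1 ^+ 2 + a 0 2%:R ^+ 2)); first by ring.
by rewrite e1 e2; ring.
Qed.

Lemma hyp_coord0_sq p : lor p p = -1 -> 0 < p 0 0 ^+ 2.
Proof.
rewrite /lor => hp.
have := sqr_ge0 (p 0 1); have := sqr_ge0 (p 0 2%:R).
have := expr2 (p 0 0); have := expr2 (p 0 1); have := expr2 (p 0 2%:R); lra.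
Qed.

Lemma tangent_ge0 p a : lor p p = -1 -> lor p a = 0 -> 0 <= lor a a.
Proof.
move=> hp ha; rewrite -(pmulr_rge0 _ (hyp_coord0_sq hp)) tangent_norm //.
by rewrite !addr_ge0 // sqr_ge0.
Qed.

Lemma tangent_eq0 p a : lor p p = -1 -> lor p a = 0 -> lor a a = 0 -> a = 0.
Proof.
move=> hp ha aa; have p0 := hyp_coord0_sq hp.
have := tangent_norm hp ha; rewrite aa mulr0 => /esym/eqP.
rewrite !paddr_eq0 ?addr_ge0 ?sqr_ge0 // !sqrf_eq0 => /andP[/andP[/eqP a1 /eqP a2] _].
have p0' : p 0 0 != 0 by rewrite -sqrf_eq0 gt_eqF.
apply: rowP3; rewrite !mxE //; apply: (mulfI p0').
by move: ha; rewrite /lor a1 a2; lra.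
Qed.

(** The square of a triple product is, up to sign, the Gram determinant of its
    three vectors, and p is a unit timelike vector orthogonal to the other
    two. *)
Lemma kahler_sq p a b : lor p p = -1 -> lor p a = 0 -> lor p b = 0 ->
  lor (lcross p a) b ^+ 2 = lor a a * lor b b - lor a b ^+ 2.
Proof.
move=> hp ha hb.
have -> : lor (lcross p a) b ^+ 2 =
   - (lor p p * (lor a a * lor b b - lor a b ^+ 2)
      - lor p a * (lor p a * lor b b - lor a b * lor p b)
      + lor p b * (lor p a * lor a b - lor a a * lor p b)).
  by rewrite /lor !lcrossE; ring.
by rewrite hp ha hb; ring.
Qed.

(** Subtracting the component of a along p leaves a tangent vector orthogonal to
    every tangent vector, in particular to itself. *)
Lemma normal_vector p a : lor p p = -1 -> (forall b, lor p b = 0 -> lor a b = 0) ->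
  a = - lor p a *: p.
Proof.
move=> hp h; apply/eqP; rewrite scaleNr -subr_eq0 opprK; apply/eqP.
have t : lor p (a + lor p a *: p) = 0 by rewrite lorDr lorZr hp; ring.
apply: (tangent_eq0 hp t).
by rewrite lorDl lorZl t mulr0 addr0; exact: h.
Qed.

(** The reversed Cauchy-Schwarz inequality. Together with [hyp_of_lor_lt0] it
    characterises the upper sheet of the hyperboloid by the sign of the Lorentz
    product with one of its points. *)
Lemma hyp_lor_lt0 p x : hyp (-1) p -> hyp (-1) x -> lor p x < 0.
Proof.
move=> /hypN1P[hp p0] /hypN1P[hx x0].
have hp' : p 0 0 ^+ 2 = 1 + p 0 1 ^+ 2 + p 0 2%:R ^+ 2.
  by move: hp; rewrite /lor !expr2; lra.
have hx' : x 0 0 ^+ 2 = 1 + x 0 1 ^+ 2 + x 0 2%:R ^+ 2.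
  by move: hx; rewrite /lor !expr2; lra.
suff : p 0 1 * x 0 1 + p 0 2%:R * x 0 2%:R < p 0 0 * x 0 0 by rewrite /lor; lra.
apply: le_lt_trans (ler_norm _) _.
rewrite -[ltRHS]gtr0_norm ?mulr_gt0 // -ltr_sqr ?nnegrE // !real_normK ?num_real //.
rewrite exprMn hp' hx' -subr_gt0.
have -> : (1 + p 0 1 ^+ 2 + p 0 2%:R ^+ 2) * (1 + x 0 1 ^+ 2 + x 0 2%:R ^+ 2) -
  (p 0 1 * x 0 1 + p 0 2%:R * x 0 2%:R) ^+ 2 =
  1 + (p 0 1 ^+ 2 + p 0 2%:R ^+ 2 + x 0 1 ^+ 2 + x 0 2%:R ^+ 2 +
   (p 0 1 * x 0 2%:R - p 0 2%:R * x 0 1) ^+ 2) by ring.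
by rewrite ltr_wpDr // !addr_ge0 // sqr_ge0.
Qed.

Lemma hyp_of_lor_lt0 p x : hyp (-1) p -> lor x x = -1 -> lor p x < 0 -> hyp (-1) x.
Proof.
move=> hp hx px; apply/hypN1P; split=> //.
have x0 : x 0 0 != 0 by rewrite -sqrf_eq0 gt_eqF // hyp_coord0_sq.
have [//|x0' ] := ltP 0 (x 0 0).
have hNx : hyp (-1) (- x).
  apply/hypN1P; split; first by rewrite lorNl lorNr opprK.
  by rewrite mxE oppr_gt0 lt_neqAle x0.
by have := hyp_lor_lt0 hp hNx; rewrite lorNr oppr_lt0 ltNge (ltW px).
Qed.

Lemma hyp_fst_eq p x : hyp (-1) p -> hyp (-1) x ->
  p 0 1 = x 0 1 -> p 0 2%:R = x 0 2%:R -> p = x.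
Proof.
move=> /hypN1P[hp p0] /hypN1P[hx x0] e1 e2; apply: rowP3 => //.
apply/eqP; rewrite -(eqrXn2 (n := 2)) // ?ltW //; apply/eqP.
by move: hp hx; rewrite /lor !expr2 e1 e2; lra.
Qed.

End HyperbolicPlane.

(** * The equations of Koszul and Gauss *)

(** The permutation of indices behind the formula of Koszul: fa stands for the
    derivative of f along a, fca for that of fa along c, and g1, g2, g3 for
    derivatives of the first fundamental form. *)
Lemma koszul_alg (R : realType) (fa fb fc fca fac fcb fbc fab fba : 'rV[R]_3)
    (g1 g2 g3 : R) :
  fca = fac -> fcb = fbc -> fab = fba ->
  g1 = lor fca fb + lor fa fcb -> g2 = lor fac fb + lor fc fab ->
  g3 = lor fbc fa + lor fc fba -> lor fca fb = 2^-1 * (g1 + g2 - g3).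
Proof. by move=> -> -> -> -> -> ->; rewrite (lorC fa); field. Qed.

Lemma gauss_alg (R : realType) (fa fb faa fbb fab fba faba fbaa fbba fabb : 'rV[R]_3)
    (g1 g2 g3 : R) :
  fab = fba -> faba = fbaa -> fbba = fabb ->
  g1 = lor faba fb + lor fab fba + (lor faa fbb + lor fa fbba) ->
  g2 = lor fbaa fb + lor fba fba + (lor fba fba + lor fb fbaa) ->
  g3 = lor fabb fa + lor fab fab + (lor fab fab + lor fa fabb) ->
  lor faa fbb - lor fba fba = g1 - 2^-1 * g2 - 2^-1 * g3.
Proof.
move=> -> -> -> -> -> ->.
by rewrite (lorC fabb) (lorC fb); field.
Qed.

Section Egregium.
Context {R : realType} {V : normedModType R} (U : set V) (oU : open U).

Lemma derive_eq_in (W : normedModType R) (f g : V -> W) x v :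
  U x -> {in U, f =1 g} -> 'D_v f x = 'D_v g x.
Proof. by move=> Ux fg; exact: near_eq_derive (open_eq_near oU Ux fg). Qed.

Lemma schwarz_row n (f : V -> 'rV[R]_n) x u v : smooth_on U f -> U x ->
  'D_v ('D_u f) x = 'D_u ('D_v f) x.
Proof.
move=> sf Ux; apply/rowP => i.
have d1 y : U y -> differentiable f y by exact: smooth_on_differentiable.
have d2 w y : U y -> differentiable ('D_w f) y.
  exact: smooth_on_differentiable (smooth_on_derive w sf).
apply: etrans (esym (derive_entry v 0 i (d2 u x Ux))) _.
apply: etrans _ (derive_entry u 0 i (d2 v x Ux)).
have E w : {in U, (fun y => 'D_w f y 0 i) =1 'D_w (fun y => f y 0 i)}.
  by move=> y; rewrite inE => Uy; rewrite derive_entry //; exact: d1.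
apply: etrans (derive_eq_in v Ux (E u)) _.
apply: etrans _ (esym (derive_eq_in u Ux (E v))).
apply: (schwarz oU) => //; apply: (smooth_onP _ _).1; exact: smooth_entry.
Qed.

Definition first_form (f : V -> 'rV[R]_3) (a b : V) (x : V) : R :=
  lor ('D_a f x) ('D_b f x).

Section OneMap.
Context (f : V -> 'rV[R]_3) (sf : smooth_on U f).

Let d2 a x : U x -> differentiable ('D_a f) x.
Proof. exact: smooth_on_differentiable (smooth_on_derive a sf). Qed.

Let d3 a b x : U x -> differentiable ('D_b ('D_a f)) x.
Proof.
exact: smooth_on_differentiable (smooth_on_derive b (smooth_on_derive a sf)).
Qed.

Lemma smooth_first_form a b : smooth_on U (first_form f a b).
Proof. by apply: smooth_lor => //; exact: smooth_on_derive. Qed.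

Lemma derive_first_form a b c x : U x -> 'D_c (first_form f a b) x =
  lor ('D_c ('D_a f) x) ('D_b f x) + lor ('D_a f x) ('D_c ('D_b f) x).
Proof. by move=> Ux; apply: derive_lor; exact: d2. Qed.

Lemma koszul a b c x : U x -> lor ('D_c ('D_a f) x) ('D_b f x) =
  2^-1 * ('D_c (first_form f a b) x + 'D_a (first_form f c b) x
          - 'D_b (first_form f c a) x).
Proof.
move=> Ux.
exact: (koszul_alg (schwarz_row a c sf Ux) (schwarz_row b c sf Ux) (schwarz_row b a sf Ux)
  (derive_first_form a b c Ux) (derive_first_form c b a Ux) (derive_first_form c a b Ux)).
Qed.

Lemma derive2_first_form a b c d x : U x ->
  'D_d ('D_c (first_form f a b)) x =
    lor ('D_d ('D_c ('D_a f)) x) ('D_b f x) + lor ('D_c ('D_a f) x) ('D_d ('D_b f) x) +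
    (lor ('D_d ('D_a f) x) ('D_c ('D_b f) x) + lor ('D_a f x) ('D_d ('D_c ('D_b f)) x)).
Proof.
move=> Ux.
have E : {in U, 'D_c (first_form f a b) =1
    (fun y => lor ('D_c ('D_a f) y) ('D_b f y)) +
    (fun y => lor ('D_a f y) ('D_c ('D_b f) y))}.
  by move=> y; rewrite inE => Uy; rewrite derive_first_form.
apply: etrans (derive_eq_in d Ux E) _.
have da := d2 a Ux; have db := d2 b Ux; have dca := d3 a c Ux; have dcb := d3 b c Ux.
have dF : derivable (fun y => lor ('D_c ('D_a f) y) ('D_b f y)) x d.
  exact: diff_derivable (differentiable_lor dca db).
have dG : derivable (fun y => lor ('D_a f y) ('D_c ('D_b f) y)) x d.
  exact: diff_derivable (differentiable_lor da dcb).
apply: etrans (deriveD dF dG) _.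
exact: (congr2 +%R (derive_lor d dca db) (derive_lor d da dcb)).
Qed.

(** Gauss's equation for a map into a flat space: differentiating the first
    fundamental form twice, the third derivatives of f cancel by the symmetry of
    derivatives, so this quadratic expression in the second derivatives depends
    only on the metric. *)
Lemma gauss a b x : U x ->
  lor ('D_a ('D_a f) x) ('D_b ('D_b f) x) - lor ('D_a ('D_b f) x) ('D_a ('D_b f) x) =
  'D_a ('D_b (first_form f a b)) x - 2^-1 * 'D_a ('D_a (first_form f b b)) x
   - 2^-1 * 'D_b ('D_b (first_form f a a)) x.
Proof.
move=> Ux.
have ab : 'D_b ('D_a f) x = 'D_a ('D_b f) x by exact: schwarz_row.
have abU : {in U, 'D_b ('D_a f) =1 'D_a ('D_b f)}.
  by move=> y; rewrite inE => Uy; exact: schwarz_row.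
have aba : 'D_a ('D_b ('D_a f)) x = 'D_a ('D_a ('D_b f)) x.
  exact: derive_eq_in abU.
have bba : 'D_a ('D_b ('D_b f)) x = 'D_b ('D_b ('D_a f)) x.
  apply: etrans (schwarz_row b a (smooth_on_derive b sf) Ux) _.
  exact: esym (derive_eq_in b Ux abU).
exact: (gauss_alg ab aba bba (derive2_first_form a b b a Ux)
  (derive2_first_form b b a a Ux) (derive2_first_form a a b b Ux)).
Qed.

End OneMap.
End Egregium.

Section Pairs.
Context {R : realType} {V W1 W2 : normedModType R} (U : set V) (oU : open U).

Lemma derive_pair (f : V -> W1) (g : V -> W2) x v :
  differentiable f x -> differentiable g x ->
  'D_v (fun y => (f y, g y)) x = ('D_v f x, 'D_v g x).
Proof.
move=> df dg; rewrite (deriveE _ (differentiable_pair df dg)) diff_pair //.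
by rewrite (deriveE _ df) (deriveE _ dg).
Qed.

Lemma smooth_pair (f : V -> W1) (g : V -> W2) : smooth_on U f -> smooth_on U g ->
  smooth_on U (fun x => (f x, g x)).
Proof.
move=> /smooth_onP cf /smooth_onP cg; apply/smooth_onP => n.
elim: n f g {cf cg}(cf n) (cg n) => //= n IH f g [df Df] [dg Dg].
split=> [x Ux|v]; first exact: differentiable_pair (df _ Ux) (dg _ Ux).
apply: eq_Cn (IH _ _ (Df v) (Dg v)) => // x; rewrite inE => Ux.
exact: esym (derive_pair v (df _ Ux) (dg _ Ux)).
Qed.

End Pairs.

Lemma koszul_same_alg (R : realType) (p1 p2 p3 p4 x1 x2 x3 x4 y1 y2 y3 y4 z1 z2 z3 z4 : R) :
  p1 = 2^-1 * (x1 + y1 - z1) -> p2 = 2^-1 * (x2 + y2 - z2) ->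
  p3 = 2^-1 * (x3 + y3 - z3) -> p4 = 2^-1 * (x4 + y4 - z4) ->
  x1 + x2 = x3 + x4 -> y1 + y2 = y3 + y4 -> z1 + z2 = z3 + z4 ->
  p1 + p2 = p3 + p4.
Proof. lra. Qed.

Lemma gauss_same_alg (R : realType) (p1 p2 p3 p4 x1 x2 x3 x4 y1 y2 y3 y4 z1 z2 z3 z4 : R) :
  p1 = x1 - 2^-1 * y1 - 2^-1 * z1 -> p2 = x2 - 2^-1 * y2 - 2^-1 * z2 ->
  p3 = x3 - 2^-1 * y3 - 2^-1 * z3 -> p4 = x4 - 2^-1 * y4 - 2^-1 * z4 ->
  x1 + x2 = x3 + x4 -> y1 + y2 = y3 + y4 -> z1 + z2 = z3 + z4 ->
  p1 + p2 = p3 + p4.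
Proof. lra. Qed.

Section PairForms.
Context {R : realType} {V : normedModType R} (U : set V) (oU : open U).
Variables (f1 f2 k1 k2 : V -> 'rV[R]_3).
Hypotheses (sf1 : smooth_on U f1) (sf2 : smooth_on U f2).
Hypotheses (sk1 : smooth_on U k1) (sk2 : smooth_on U k2).
Hypothesis same : forall a b x, U x ->
  first_form f1 a b x + first_form f2 a b x = first_form k1 a b x + first_form k2 a b x.

Let derive_same_aux (g1 g2 g3 g4 : V -> R) c x :
  smooth_on U g1 -> smooth_on U g2 -> smooth_on U g3 -> smooth_on U g4 ->
  (forall y, U y -> g1 y + g2 y = g3 y + g4 y) -> U x ->
  'D_c g1 x + 'D_c g2 x = 'D_c g3 x + 'D_c g4 x.
Proof.
move=> s1 s2 s3 s4 e Ux.
have d (g : V -> R) : smooth_on U g -> derivable g x c.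
  by move=> sg; apply: diff_derivable; exact: smooth_on_differentiable sg Ux.
apply: etrans (esym (deriveD (d g1 s1) (d g2 s2))) _.
apply: etrans _ (deriveD (d g3 s3) (d g4 s4)).
by apply: (derive_eq_in oU) => // y; rewrite inE => Uy; exact: e.
Qed.

(** For a pair of maps only the sum of the two first fundamental forms is a
    metric datum; since the formulas of Koszul and Gauss are linear in the first
    fundamental form, they pass to the sum. *)
Lemma koszul_same a b c x : U x ->
  lor ('D_c ('D_a f1) x) ('D_b f1 x) + lor ('D_c ('D_a f2) x) ('D_b f2 x) =
  lor ('D_c ('D_a k1) x) ('D_b k1 x) + lor ('D_c ('D_a k2) x) ('D_b k2 x).
Proof.
move=> Ux.
have d a' b' c' : 'D_c' (first_form f1 a' b') x + 'D_c' (first_form f2 a' b') x =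
  'D_c' (first_form k1 a' b') x + 'D_c' (first_form k2 a' b') x.
  have s f : smooth_on U f -> smooth_on U (first_form f a' b').
    by move=> sf; exact: smooth_first_form.
  exact: (derive_same_aux c' (s _ sf1) (s _ sf2) (s _ sk1) (s _ sk2) (same a' b') Ux).
exact: (koszul_same_alg (koszul oU sf1 a b c Ux) (koszul oU sf2 a b c Ux)
  (koszul oU sk1 a b c Ux) (koszul oU sk2 a b c Ux) (d a b c) (d c b a) (d c a b)).
Qed.

(** By the equation of Gauss this is, up to sign and normalisation, the curvature
    in the plane of a and b. *)
Definition gauss_term (f : V -> 'rV[R]_3) a b x : R :=
  lor ('D_a ('D_a f) x) ('D_b ('D_b f) x) - lor ('D_a ('D_b f) x) ('D_a ('D_b f) x).

Lemma gauss_same a b x : U x ->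
  gauss_term f1 a b x + gauss_term f2 a b x = gauss_term k1 a b x + gauss_term k2 a b x.
Proof.
move=> Ux.
have d a' b' c' d' : 'D_d' ('D_c' (first_form f1 a' b')) x + 'D_d' ('D_c' (first_form f2 a' b')) x =
  'D_d' ('D_c' (first_form k1 a' b')) x + 'D_d' ('D_c' (first_form k2 a' b')) x.
  have s f : smooth_on U f -> smooth_on U (first_form f a' b').
    by move=> sf; exact: smooth_first_form.
  have s' f : smooth_on U f -> smooth_on U ('D_c' (first_form f a' b')).
    by move=> sf; exact: smooth_on_derive (s f sf).
  have e y : U y -> 'D_c' (first_form f1 a' b') y + 'D_c' (first_form f2 a' b') y =
      'D_c' (first_form k1 a' b') y + 'D_c' (first_form k2 a' b') y.
    exact: (derive_same_aux c' (s _ sf1) (s _ sf2) (s _ sk1) (s _ sk2) (same a' b')).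
  exact: (derive_same_aux d' (s' _ sf1) (s' _ sf2) (s' _ sk1) (s' _ sk2) e Ux).
exact: (gauss_same_alg (gauss oU sf1 a b Ux) (gauss oU sf2 a b Ux)
  (gauss oU sk1 a b Ux) (gauss oU sk2 a b Ux) (d a b b a) (d b b a a) (d a a b b)).
Qed.

End PairForms.

(** * Retraction onto the product of hyperbolic planes *)

Section Normalisation.
Context {R : realType} {V : normedModType R}.
Variables (P : {linear V -> 'rV[R]_3}) (cP : continuous P).

Definition timelike : set V := [set x | lor (P x) (P x) < 0].

Definition invlen (x : V) : R := (Num.sqrt (- lor (P x) (P x)))^-1.

(** Radial projection of the timelike vectors P x to the hyperboloid; P is one of
    the two projections of the product. *)
Definition normalise (x : V) : 'rV[R]_3 := invlen x *: P x.

Let dP x : differentiable P x. Proof. exact: linear_differentiable. Qed.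

Let DP a x : 'D_a P x = P a.
Proof. by rewrite (deriveE _ (dP x)) diff_lin. Qed.

Lemma open_timelike : open timelike.
Proof.
have c : continuous (fun x => lor (P x) (P x)).
  by move=> x; apply: differentiable_continuous; exact: differentiable_lor.
have -> : timelike = (fun x => lor (P x) (P x)) @^-1` [set r | r < 0] by [].
by apply: open_comp; [move=> x _; exact: c|exact: open_lt].
Qed.

Let L x := - lor (P x) (P x).

Let dL x : differentiable L x.
Proof. by apply: (@differentiableN _ _ _ (fun y => lor (P y) (P y))); exact: differentiable_lor. Qed.

Let DL a x : 'D_a L x = - 2 * lor (P x) (P a).
Proof.
rewrite (@deriveN _ _ _ (fun y => lor (P y) (P y))); last first.
  exact: diff_derivable (differentiable_lor (dP x) (dP x)).
rewrite (derive_lor a (dP x) (dP x)) !DP (lorC (P a)).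
by ring.
Qed.

Lemma smooth_invlen : smooth_on timelike invlen.
Proof.
have sP : smooth_on timelike P by exact: smooth_lin.
apply: smooth_rsqrt; first exact: open_timelike.
- have sl := smooth_lor open_timelike sP sP.
  apply: (eq_smooth open_timelike _ (smoothZ open_timelike (smooth_cst (U := timelike) (-1 : R)) sl)).
  by move=> x _; rewrite /= scaleN1r.
- by move=> x; rewrite /timelike /= oppr_gt0.
Qed.

Lemma smooth_normalise : smooth_on timelike normalise.
Proof.
apply: smoothZ; [exact: open_timelike|exact: smooth_invlen|exact: smooth_lin].
Qed.

Lemma invlen_sq x : timelike x -> invlen x ^+ 2 * lor (P x) (P x) = -1.
Proof.
rewrite /timelike /= /invlen => h.
have h' : 0 <= - lor (P x) (P x) by rewrite oppr_ge0 ltW.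
by rewrite exprVn sqr_sqrtr // invrN mulNr mulVf // lt_eqF.
Qed.

Lemma lor_normalise x : timelike x -> lor (normalise x) (normalise x) = -1.
Proof.
by move=> h; rewrite /normalise lorZl lorZr mulrA -expr2 invlen_sq.
Qed.

Lemma normalise_fix x : lor (P x) (P x) = -1 -> normalise x = P x.
Proof. by move=> h; rewrite /normalise /invlen h opprK sqrtr1 invr1 scale1r. Qed.

Let Dr a x : timelike x ->
  'D_a invlen x = invlen x * (invlen x * invlen x) * lor (P x) (P a).
Proof.
move=> h; have L0 : 0 < L x by rewrite oppr_gt0.
rewrite (derive_rsqrt a (dL x) L0).2 DL -/(invlen x).
by move: (invlen x) (lor _ _) => r l; field.
Qed.

Let dr x : timelike x -> differentiable invlen x.
Proof. exact: smooth_on_differentiable smooth_invlen. Qed.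

Lemma derive_normalise a x : timelike x -> 'D_a normalise x =
  (invlen x * (invlen x * invlen x) * lor (P x) (P a)) *: P x + invlen x *: P a.
Proof.
by move=> h; rewrite (differentiable_scale (dr h) (dP x)).2 Dr // DP.
Qed.

Section AtPoint.
Variables (p : V) (Pp : lor (P p) (P p) = -1).

Let tp : timelike p. Proof. by rewrite /timelike /= Pp ltrN10. Qed.

Let rp : invlen p = 1. Proof. by rewrite /invlen Pp opprK sqrtr1 invr1. Qed.

Lemma derive_normalise_tangent a : lor (P p) (P a) = 0 -> 'D_a normalise p = P a.
Proof. by move=> h; rewrite derive_normalise // rp h mulr0 scale0r add0r scale1r. Qed.

(** At points of the hyperboloid the second derivative of the projection along
    tangent vectors is purely normal, so the retraction behaves like a geodesic
    chart to second order. *)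
Lemma derive2_normalise_tangent a c : lor (P p) (P a) = 0 -> lor (P p) (P c) = 0 ->
  'D_c ('D_a normalise) p = lor (P c) (P a) *: P p.
Proof.
move=> ha hc.
have E : {in timelike, 'D_a normalise =1
   (fun x => (invlen x *: (invlen x *: (invlen x *: lor (P x) (P a)))) *: P x)
   + (fun x => invlen x *: P a)}.
  move=> x; rewrite inE => h; rewrite derive_normalise //.
  change ((invlen x * (invlen x * invlen x) * lor (P x) (P a)) *: P x + invlen x *: P a =
    (invlen x * (invlen x * (invlen x * lor (P x) (P a)))) *: P x + invlen x *: P a).
  by rewrite !mulrA.
apply: etrans (derive_eq_in open_timelike c tp E) _.
have drp := dr tp; have dPa : differentiable (cst (P a) : V -> _) p by exact: differentiable_cst.
have dl := differentiable_lor (dP p) dPa.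
have [d1 D1] := differentiable_scale drp dl.
have [d2 D2] := differentiable_scale drp d1.
have [d3 D3] := differentiable_scale drp d2.
have [d4 D4] := differentiable_scale d3 (dP p).
have [d5 D5] := differentiable_scale drp dPa.
apply: etrans (deriveD (diff_derivable (v := c) d4) (diff_derivable (v := c) d5)) _.
rewrite D4 D5 D3 D2 D1 (derive_lor c (dP p) dPa) !DP derive_cst Dr // rp ha hc.
rewrite lor0r !(mulr0, scaler0, scale0r, addr0, add0r, scale1r).
by [].
Qed.

End AtPoint.

End Normalisation.

Definition fstL (R : realType) : {linear ('rV[R]_3 * 'rV[R]_3)%type -> 'rV[R]_3} :=
  [the {linear ('rV[R]_3 * 'rV[R]_3)%type -> 'rV[R]_3} of fst].
Definition sndL (R : realType) : {linear ('rV[R]_3 * 'rV[R]_3)%type -> 'rV[R]_3} :=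
  [the {linear ('rV[R]_3 * 'rV[R]_3)%type -> 'rV[R]_3} of snd].
Arguments fstL {R}.
Arguments sndL {R}.

Section Isometries.
Context {R : realType}.
Local Notation E := ('rV[R]_3 * 'rV[R]_3)%type.
Implicit Types (p q u v w x : E).

Let cfst : continuous (@fstL R). Proof. exact: fst_continuous. Qed.
Let csnd : continuous (@sndL R). Proof. exact: snd_continuous. Qed.

Definition retract_dom : set E :=
  [set x : E | timelike fstL x /\ timelike sndL x] `&` [set x : E | 0 < x.1 0 0 /\ 0 < x.2 0 0].

(** An isometry of the product is only given together with some extension to a
    neighbourhood. Composing with a retraction makes its second derivatives
    along tangent vectors intrinsic, and provides constant directions in which
    the formulas of Koszul and Gauss can be used. *)
Definition retract (x : E) : E := (normalise fstL x, normalise sndL x).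

Lemma open_retract_dom : open retract_dom.
Proof.
apply: openI.
  exact: openI (open_timelike cfst) (open_timelike csnd).
have c1 : continuous (fun x : E => x.1 0 0).
  by move=> x; apply: differentiable_continuous; exact: differentiable_fst_entry.
have c2 : continuous (fun x : E => x.2 0 0).
  by move=> x; apply: differentiable_continuous; exact: differentiable_snd_entry.
apply: openI.
  change (open ((fun x : E => x.1 0 0) @^-1` [set r | 0 < r])).
  by apply: open_comp; [move=> x _; exact: c1|exact: open_gt].
change (open ((fun x : E => x.2 0 0) @^-1` [set r | 0 < r])).
by apply: open_comp; [move=> x _; exact: c2|exact: open_gt].
Qed.

Let sub1 : retract_dom `<=` timelike fstL. Proof. by move=> x [[]]. Qed.
Let sub2 : retract_dom `<=` timelike sndL. Proof. by move=> x [[]]. Qed.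

Lemma smooth_retract1 : smooth_on retract_dom (normalise fstL).
Proof. exact: sub_smooth sub1 (smooth_normalise cfst). Qed.

Lemma smooth_retract2 : smooth_on retract_dom (normalise sndL).
Proof. exact: sub_smooth sub2 (smooth_normalise csnd). Qed.

Lemma smooth_retract : smooth_on retract_dom retract.
Proof. exact: (smooth_pair open_retract_dom smooth_retract1 smooth_retract2). Qed.

Lemma invlen_gt0 (P : {linear E -> 'rV[R]_3}) x : timelike P x -> 0 < invlen P x.
Proof. by rewrite /timelike /= /invlen => h; rewrite invr_gt0 sqrtr_gt0 oppr_gt0. Qed.

Lemma retract_HH x : retract_dom x -> HH (retract x).
Proof.
move=> [[t1 t2] [x1 x2]]; split; apply/hypN1P; split.
- exact: lor_normalise.
- by rewrite mxE mulr_gt0 // invlen_gt0.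
- exact: lor_normalise.
- by rewrite mxE mulr_gt0 // invlen_gt0.
Qed.

Lemma HH_retract_dom x : HH x -> retract_dom x.
Proof.
by move=> [/hypN1P[h1 p1] /hypN1P[h2 p2]]; split; split=> //;
  rewrite /timelike /= ?h1 ?h2 ltrN10.
Qed.

Lemma retract_fix x : HH x -> retract x = x.
Proof.
move=> [/hypN1P[h1 p1] /hypN1P[h2 p2]].
by rewrite /retract !normalise_fix //; case: x {h1 p1 h2 p2}.
Qed.

Lemma derive_retract_tangent p u : HH p -> tangentHH p u -> 'D_u retract p = u.
Proof.
move=> Hp [t1 t2]; have Dp := HH_retract_dom Hp.
have [/hypN1P[h1 _] /hypN1P[h2 _]] := Hp.
have d1 := smooth_on_differentiable smooth_retract1 Dp.
have d2 := smooth_on_differentiable smooth_retract2 Dp.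
apply: etrans (derive_pair u d1 d2) _.
by rewrite (derive_normalise_tangent cfst) ?(derive_normalise_tangent csnd) //; case: u {t1 t2}.
Qed.

Section SelfMap.
Variables (F : E -> E) (sF : smooth_selfmap F).

Definition pulled1 x : 'rV[R]_3 := (F (retract x)).1.
Definition pulled2 x : 'rV[R]_3 := (F (retract x)).2.

Let smooth_pulled : smooth_on retract_dom (F \o retract).
Proof.
have [[U [oU HU sU]] _] := sF.
apply: smooth_comp_pair smooth_retract sU; first exact: open_retract_dom.
by move=> x /retract_HH/HU.
Qed.

Lemma smooth_pulled1 : smooth_on retract_dom pulled1.
Proof. exact: (smooth_lin_comp open_retract_dom cfst smooth_pulled). Qed.

Lemma smooth_pulled2 : smooth_on retract_dom pulled2.
Proof. exact: (smooth_lin_comp open_retract_dom csnd smooth_pulled). Qed.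

Lemma differentiable_selfmap p : HH p -> differentiable F p.
Proof.
by move=> Hp; have [[U [oU HU sU]] _] := sF; apply: smooth_on_differentiable sU (HU _ Hp).
Qed.

Lemma derive_pulled x u : retract_dom x ->
  ('D_u pulled1 x, 'D_u pulled2 x) = 'd F (retract x) ('D_u retract x).
Proof.
move=> Dx; have dr := smooth_on_differentiable smooth_retract Dx.
have dF := differentiable_selfmap (retract_HH Dx).
rewrite -(deriveE _ dF) -(derive_comp_dir u dr dF).
have dc := smooth_on_differentiable smooth_pulled Dx.
rewrite (derive_lin_comp cfst u dc : 'D_u pulled1 x = _).
rewrite (derive_lin_comp csnd u dc : 'D_u pulled2 x = _).
by rewrite /=; case: (derive _ _ _).
Qed.

Lemma pulled_HH x : retract_dom x ->
  lor (pulled1 x) (pulled1 x) = -1 /\ lor (pulled2 x) (pulled2 x) = -1.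
Proof.
move=> Dx; have [_ HF] := sF.
by have [/hypN1P[h1 _] /hypN1P[h2 _]] := HF _ (retract_HH Dx).
Qed.

End SelfMap.

End Isometries.

(** * Isometries preserve the curvature of the product *)

Lemma lor_const_derive (R : realType) (V : normedModType R) (U : set V) (k : R)
    (g h : V -> 'rV[R]_3) (x c : V) : open U ->
  (forall y, U y -> lor (g y) (h y) = k) -> U x ->
  differentiable g x -> differentiable h x ->
  lor ('D_c g x) (h x) + lor (g x) ('D_c h x) = 0.
Proof.
move=> oU gh Ux dg dh; apply: etrans (esym (derive_lor c dg dh)) _.
have E : {in U, (fun y => lor (g y) (h y)) =1 cst k}.
  by move=> y; rewrite inE; exact: gh.
by apply: etrans (derive_eq_in oU c Ux E) _; exact: derive_cst.
Qed.

Lemma lor_half (R : realType) (d g : 'rV[R]_3) : lor d g + lor g d = 0 -> lor d g = 0.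
Proof. by rewrite (lorC g); lra. Qed.

Section UnitMaps.
Context {R : realType} {V : normedModType R} (U : set V) (oU : open U).
Variables (f : V -> 'rV[R]_3) (sf : smooth_on U f).
Hypothesis f1 : forall x, U x -> lor (f x) (f x) = -1.

Lemma unit_derive x u : U x -> lor (f x) ('D_u f x) = 0.
Proof.
move=> Ux; have df := smooth_on_differentiable sf Ux.
by rewrite lorC; exact: lor_half (lor_const_derive u oU f1 Ux df df).
Qed.

Lemma unit_derive2 x u v : U x ->
  lor (f x) ('D_v ('D_u f) x) = - lor ('D_v f x) ('D_u f x).
Proof.
move=> Ux; have df := smooth_on_differentiable sf Ux.
have ddf := smooth_on_differentiable (smooth_on_derive u sf) Ux.
have := lor_const_derive v oU (fun y => @unit_derive y u) Ux df ddf.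
by rewrite addrC => /eqP; rewrite addr_eq0 => /eqP.
Qed.

Lemma normal_derive2 x u v : U x ->
  (forall b, lor (f x) b = 0 -> lor ('D_v ('D_u f) x) b = 0) ->
  'D_v ('D_u f) x = lor ('D_v f x) ('D_u f x) *: f x.
Proof.
move=> Ux h; apply: etrans (normal_vector (f1 Ux) h) _.
by congr (_ *: _); apply: etrans (congr1 -%R (unit_derive2 u v Ux)) (opprK _).
Qed.

End UnitMaps.

Section Curvature.
Context {R : realType}.
Local Notation E := ('rV[R]_3 * 'rV[R]_3)%type.
Implicit Types (p q u v w x : E).

Definition gram (a b : 'rV[R]_3) : R := lor a a * lor b b - lor a b ^+ 2.

(** F o retract takes values in the product of hyperboloids, so its derivatives are
    tangent by [unit_derive]; along tangent vectors at p it has the same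
    differential as F. *)
Lemma selfmap_tangent (F : E -> E) p u : smooth_selfmap F -> HH p ->
  tangentHH p u -> tangentHH (F p) ('d F p u).
Proof.
move=> sF Hp tu; have Dp := HH_retract_dom Hp.
have := derive_pulled sF u Dp.
rewrite derive_retract_tangent // retract_fix // => <-.
split=> /=.
  have := unit_derive open_retract_dom (smooth_pulled1 sF) (fun x Dx => (pulled_HH sF Dx).1) u Dp.
  by rewrite /pulled1 retract_fix.
have := unit_derive open_retract_dom (smooth_pulled2 sF) (fun x Dx => (pulled_HH sF Dx).2) u Dp.
by rewrite /pulled2 retract_fix.
Qed.

(** The differential of the inverse isometry, transported by the retraction,
    provides the preimage. *)
Lemma isometry_tangent_surj (F : E -> E) p w : isometryHH F -> HH p ->
  tangentHH (F p) w -> exists2 u, tangentHH p u & 'd F p u = w.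
Proof.
move=> [sF [G [sG GF FG]] _] Hp tw.
have HFp : HH (F p) by exact: sF.2.
exists ('d G (F p) w).
  by rewrite -{1}(GF p Hp); exact: selfmap_tangent.
have dG := differentiable_selfmap sG HFp.
have dF : differentiable F (G (F p)) by rewrite GF //; exact: differentiable_selfmap.
have Dq := HH_retract_dom HFp.
have dr := smooth_on_differentiable smooth_retract Dq.
have E : {in retract_dom, (F \o (G \o retract)) =1 retract}.
  by move=> x; rewrite inE => Dx /=; apply: FG; exact: retract_HH.
have := derive_eq_in open_retract_dom w Dq E.
have dG' : differentiable G (retract (F p)) by rewrite retract_fix.
have dGr := differentiable_comp dr dG'.
have dF' : differentiable F ((G \o retract) (F p)) by rewrite /= retract_fix.
rewrite (derive_comp_dir w dGr dF') (derive_comp_dir w dr dG').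
rewrite derive_retract_tangent // (deriveE _ dF') (deriveE _ dG') /=.
by rewrite (retract_fix HFp) (GF p Hp); apply.
Qed.

Lemma gauss_term_normal (V : normedModType R) (f : V -> 'rV[R]_3) (u v x : V)
    (n a b : 'rV[R]_3) : lor n n = -1 ->
  'D_u ('D_u f) x = lor a a *: n -> 'D_v ('D_v f) x = lor b b *: n ->
  'D_u ('D_v f) x = lor a b *: n -> gauss_term f u v x = - gram a b.
Proof.
move=> nn Ea Eb Eab.
apply: etrans (congr2 (fun s t : R => s - t) (congr2 (@lor R) Ea Eb) (congr2 (@lor R) Eab Eab)) _.
by rewrite /gram !lorZl !lorZr nn; ring.
Qed.

Lemma opp_sum_alg (a b c d x y z w : R) : x = - a -> y = - b -> z = - c -> w = - d ->
  x + y = z + w -> a + b = c + d.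
Proof. lra. Qed.

(** Let h = F o retract, with components h1 and h2, and compare it with the
    retraction itself: both have the same sum of first fundamental forms. At p
    the second derivatives of the retraction along tangent vectors are normal, so
    by the formula of Koszul those of h1 and h2 are together orthogonal to the
    image of the differential of F, which is the whole tangent plane of the
    product; hence each is normal, and equals a multiple of the point with the
    inner product of the first derivatives as coefficient. The Gauss term of each
    component is then minus the Gram determinant of its first derivatives, and
    the equation of Gauss identifies the two sums. *)
Lemma isometry_gram (F : E -> E) p u v : isometryHH F -> HH p ->
  tangentHH p u -> tangentHH p v ->
  gram ('d F p u).1 ('d F p v).1 + gram ('d F p u).2 ('d F p v).2 =
  gram u.1 v.1 + gram u.2 v.2.
Proof.
move=> iF Hp tu tv; have [sF _ mF] := iF.
have Dp := HH_retract_dom Hp; have oD := @open_retract_dom R.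
have Hq : HH (F p) by exact: sF.2.
have [/hypN1P[pp1 _] /hypN1P[pp2 _]] := Hp.
have [/hypN1P[qq1 _] /hypN1P[qq2 _]] := Hq.
have sh1 := smooth_pulled1 sF; have sh2 := smooth_pulled2 sF.
have sk1 := @smooth_retract1 R; have sk2 := @smooth_retract2 R.
have uh1 x : retract_dom x -> lor (pulled1 F x) (pulled1 F x) = -1.
  by move=> /(pulled_HH sF)[].
have uh2 x : retract_dom x -> lor (pulled2 F x) (pulled2 F x) = -1.
  by move=> /(pulled_HH sF)[].
have uk1 x : retract_dom x -> lor (normalise fstL x) (normalise fstL x) = -1.
  by move=> /retract_HH[/hypN1P[]].
have uk2 x : retract_dom x -> lor (normalise sndL x) (normalise sndL x) = -1.
  by move=> /retract_HH[_ /hypN1P[]].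
have dret x a : retract_dom x ->
    'D_a retract x = ('D_a (normalise fstL) x, 'D_a (normalise sndL) x).
  move=> Dx; exact: (derive_pair a (smooth_on_differentiable sk1 Dx) (smooth_on_differentiable sk2 Dx)).
have tret x a : retract_dom x -> tangentHH (retract x) ('D_a retract x).
  move=> Dx; rewrite (dret x a Dx); split; rewrite /=.
    exact: (unit_derive oD sk1 uk1 a Dx).
  exact: (unit_derive oD sk2 uk2 a Dx).
have same a b x : retract_dom x ->
    first_form (pulled1 F) a b x + first_form (pulled2 F) a b x =
    first_form (normalise fstL) a b x + first_form (normalise sndL) a b x.
  move=> Dx; have mD := mF _ _ _ (retract_HH Dx) (tret _ a Dx) (tret _ b Dx).
  exact: (etrans (congr2 (@metricHH R) (derive_pulled sF a Dx) (derive_pulled sF b Dx))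
    (etrans mD (congr2 (@metricHH R) (dret x a Dx) (dret x b Dx)))).
have h1p : pulled1 F p = (F p).1 by rewrite /pulled1 (retract_fix Hp).
have h2p : pulled2 F p = (F p).2 by rewrite /pulled2 (retract_fix Hp).
have dh a : tangentHH p a -> ('D_a (pulled1 F) p, 'D_a (pulled2 F) p) = 'd F p a.
  move=> ta; apply: etrans (derive_pulled sF a Dp) _.
  by rewrite (derive_retract_tangent Hp ta) (retract_fix Hp).
have dk a : tangentHH p a ->
    'D_a (normalise fstL) p = a.1 /\ 'D_a (normalise sndL) p = a.2.
  move=> ta; have e := etrans (esym (dret p a Dp)) (derive_retract_tangent Hp ta).
  by split; [exact: (congr1 fst e)|exact: (congr1 snd e)].
have ddk a c : tangentHH p a -> tangentHH p c ->
    'D_c ('D_a (normalise fstL)) p = lor c.1 a.1 *: p.1 /\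
    'D_c ('D_a (normalise sndL)) p = lor c.2 a.2 *: p.2.
  move=> [a1 a2] [c1 c2]; split.
    exact: (derive2_normalise_tangent (@fst_continuous R _ _) pp1 a1 c1).
  exact: (derive2_normalise_tangent (@snd_continuous R _ _) pp2 a2 c2).
(* The second derivatives of F o retract have no tangential part: by the formula
   of Koszul it is the same as that of the retraction. *)
have kz0 a b c : tangentHH p a -> tangentHH p b -> tangentHH p c ->
    lor ('D_c ('D_a (pulled1 F)) p) ('d F p b).1 +
    lor ('D_c ('D_a (pulled2 F)) p) ('d F p b).2 = 0.
  move=> ta tb tc; rewrite -(dh b tb).
  have [k1b k2b] := dk b tb; have [kk1 kk2] := ddk a c ta tc.
  apply: etrans (koszul_same oD sh1 sh2 sk1 sk2 same a b c Dp) _.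
  apply: etrans (congr2 +%R (congr2 (@lor R) kk1 k1b) (congr2 (@lor R) kk2 k2b)) _.
  by have [b1 b2] := tb; rewrite !lorZl b1 b2 !mulr0 addr0.
have n1 a c : tangentHH p a -> tangentHH p c ->
    'D_c ('D_a (pulled1 F)) p = lor ('d F p c).1 ('d F p a).1 *: (F p).1.
  move=> ta tc; rewrite -(dh c tc) -(dh a ta) -h1p.
  apply: (normal_derive2 oD sh1 uh1 Dp) => b; rewrite h1p => b0.
  have tw : tangentHH (F p) (b, 0) by split; rewrite /= ?lor0r.
  have [w tw' e] := isometry_tangent_surj iF Hp tw.
  have red X Y : lor X ('d F p w).1 + lor Y ('d F p w).2 = 0 -> lor X b = 0.
    by rewrite e /= lor0r addr0.
  exact: red (kz0 a w c ta tw' tc).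
have n2 a c : tangentHH p a -> tangentHH p c ->
    'D_c ('D_a (pulled2 F)) p = lor ('d F p c).2 ('d F p a).2 *: (F p).2.
  move=> ta tc; rewrite -(dh c tc) -(dh a ta) -h2p.
  apply: (normal_derive2 oD sh2 uh2 Dp) => b; rewrite h2p => b0.
  have tw : tangentHH (F p) (0, b) by split; rewrite /= ?lor0r.
  have [w tw' e] := isometry_tangent_surj iF Hp tw.
  have red X Y : lor X ('d F p w).1 + lor Y ('d F p w).2 = 0 -> lor Y b = 0.
    by rewrite e /= lor0r add0r.
  exact: red (kz0 a w c ta tw' tc).
have G := gauss_same oD sh1 sh2 sk1 sk2 same u v Dp.
have g1 := gauss_term_normal qq1 (n1 u u tu tu) (n1 v v tv tv) (n1 v u tv tu).
have g2 := gauss_term_normal qq2 (n2 u u tu tu) (n2 v v tv tv) (n2 v u tv tu).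
have g3 := gauss_term_normal pp1 (ddk u u tu tu).1 (ddk v v tv tv).1 (ddk v u tv tu).1.
have g4 := gauss_term_normal pp2 (ddk u u tu tu).2 (ddk v v tv tv).2 (ddk v u tv tu).2.
exact: (opp_sum_alg g1 g2 g3 g4 G).
Qed.

End Curvature.

(** * Lagrangian planes and the values of the associated function *)

Section OrthonormalBasis.
Context {R : realType} (g : 'rV[R]_2 -> 'rV[R]_2 -> R).
Hypothesis g_lin : forall a u u' v, g (a *: u + u') v = a * g u v + g u' v.
Hypothesis g_sym : forall u v, g u v = g v u.
Hypothesis g_pos : forall u, u != 0 -> 0 < g u u.

Let gZl a u v : g (a *: u) v = a * g u v.
Proof.
have g0 : g 0 v = 0.
  by have := g_lin 1 0 0 v; rewrite scale1r addr0 mul1r => /eqP; rewrite -subr_eq0 opprD addNKr oppr_eq0 => /eqP.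
by rewrite -[a *: u]addr0 g_lin g0 addr0.
Qed.

Let gZr a u v : g u (a *: v) = a * g u v.
Proof. by rewrite g_sym gZl g_sym. Qed.

Let normalised u : u != 0 ->
  g ((Num.sqrt (g u u))^-1 *: u) ((Num.sqrt (g u u))^-1 *: u) = 1.
Proof.
move=> /g_pos g0; rewrite gZl gZr mulrA -expr2 exprVn sqr_sqrtr ?ltW // mulVf //.
by rewrite gt_eqF.
Qed.

Lemma orthonormal_basis : exists u v, [/\ g u u = 1, g v v = 1, g u v = 0 &
  forall w, exists a b, w = a *: u + b *: v].
Proof.
pose e0 : 'rV[R]_2 := delta_mx 0 0; pose e1 : 'rV[R]_2 := delta_mx 0 1.
have e0n : e0 != 0.
  by apply/eqP => /rowP /(_ 0); rewrite !mxE /= => /eqP; rewrite oner_eq0.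
pose s := Num.sqrt (g e0 e0); have s0 : s != 0 by rewrite gt_eqF // sqrtr_gt0 g_pos.
pose u := s^-1 *: e0; have uu : g u u = 1 by exact: normalised.
pose w := - g e1 u *: u + e1.
have wn : w != 0.
  apply/eqP => /rowP /(_ 1); rewrite !mxE /= !mulr0 add0r => /eqP.
  by rewrite oner_eq0.
pose t := Num.sqrt (g w w); have t0 : t != 0 by rewrite gt_eqF // sqrtr_gt0 g_pos.
pose v := t^-1 *: w; have vv : g v v = 1 by exact: normalised.
have uw : g w u = 0 by rewrite g_lin uu mulr1 addNr.
exists u, v; split=> //; first by rewrite g_sym gZl uw mulr0.
move=> z; exists (z 0 0 * s + z 0 1 * g e1 u), (z 0 1 * t).
have -> : (z 0 1 * t) *: v = z 0 1 *: w by rewrite scalerA mulfK.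
have -> : z = z 0 0 *: e0 + z 0 1 *: e1.
  by rewrite {1}(row_sum_delta z) big_ord_recl big_ord1 (_ : lift ord0 ord0 = 1) //; exact: val_inj.
have E0 : e0 = s *: u by rewrite scalerA mulfV // scale1r.
rewrite {1}E0 !mxE /= !(mulr0, mulr1, addr0, add0r).
rewrite /w scalerDr scalerDl !scalerA -addrA; congr (_ + _).
by rewrite mulrN mulNr scaleNr addrA subrr add0r.
Qed.

End OrthonormalBasis.

(** The pair (A1, A2) parametrizes the tangent plane of a Lagrangian surface at the
    point (p1, p2). *)
Record lagrangian_plane (R : realType) (p1 p2 : 'rV[R]_3)
    (A1 A2 : {linear 'rV[R]_2 -> 'rV[R]_3}) : Prop := LagrangianPlane {
  plane_lor1 : lor p1 p1 = -1;
  plane_lor2 : lor p2 p2 = -1;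
  plane_tangent1 : forall u, lor p1 (A1 u) = 0;
  plane_tangent2 : forall u, lor p2 (A2 u) = 0;
  plane_inj : forall u, A1 u = 0 -> A2 u = 0 -> u = 0;
  plane_lag : forall u v, lor (lcross p1 (A1 u)) (A1 v) = lor (lcross p2 (A2 u)) (A2 v) }.

Section LagrangianPlane.
Context {R : realType}.
Variables (p1 p2 : 'rV[R]_3) (A1 A2 : {linear 'rV[R]_2 -> 'rV[R]_3}).
Hypothesis pl : lagrangian_plane p1 p2 A1 A2.

Definition plane_metric u v : R := lor (A1 u) (A1 v) + lor (A2 u) (A2 v).

Lemma plane_metric_basis :
  exists u v, [/\ plane_metric u u = 1, plane_metric v v = 1,
    plane_metric u v = 0 & forall w, exists a b, w = a *: u + b *: v].
Proof.
apply: orthonormal_basis.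
- move=> a u u' v; rewrite /plane_metric !linearP !lorDl !lorZl.
  by ring.
- by move=> u v; rewrite /plane_metric lorC [X in _ + X]lorC.
- move=> u u0.
  have [pp1 pp2 /(_ u) t1 /(_ u) t2 inj _] := pl.
  have g1 := tangent_ge0 pp1 t1; have g2 := tangent_ge0 pp2 t2.
  rewrite lt_neqAle addr_ge0 // andbT eq_sym paddr_eq0 //.
  apply/negP => /andP[/eqP e1 /eqP e2]; case/eqP: u0.
  by apply: inj; [exact: tangent_eq0 t1 e1|exact: tangent_eq0 t2 e2].
Qed.

(** Both Gram determinants are the square of the common value of the two Kaehler
    forms. *)
Lemma plane_gram_eq u v : gram (A1 u) (A1 v) = gram (A2 u) (A2 v).
Proof.
have [pp1 pp2 t1 t2 _ lag] := pl.
by apply: etrans (esym (kahler_sq pp1 (t1 u) (t1 v))) _; rewrite lag; exact: kahler_sq.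
Qed.

Section Orthonormal.
Variables (u v : 'rV[R]_2).
Hypotheses (uu : plane_metric u u = 1) (vv : plane_metric v v = 1).
Hypotheses (uv : plane_metric u v = 0).
Hypothesis span : forall w, exists a b, w = a *: u + b *: v.

Let rel2 : [/\ lor (A2 u) (A2 u) = 1 - lor (A1 u) (A1 u),
  lor (A2 v) (A2 v) = 1 - lor (A1 v) (A1 v) &
  lor (A2 u) (A2 v) = - lor (A1 u) (A1 v)].
Proof. by move: uu vv uv; rewrite /plane_metric => *; split; lra. Qed.

Let sum1 : lor (A1 v) (A1 v) = 1 - lor (A1 u) (A1 u).
Proof.
have := plane_gram_eq u v; rewrite /gram; have [-> -> ->] := rel2.
by rewrite sqrrN; lra.
Qed.

(** With a = g1(u, u) and c = g1(u, v), equality of the Gram determinants of g1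
    and of g2 = identity - g1 gives g1(v, v) = 1 - a; then 4 (a (1 - a) - c^2)
    falls short of 1 by (2 a - 1)^2 + 4 c^2. *)
Lemma gram_orthonormal_le : gram (A1 u) (A1 v) <= 4^-1.
Proof.
rewrite /gram sum1; have := sqr_ge0 (lor (A1 u) (A1 v)).
by have := sqr_ge0 (2 * lor (A1 u) (A1 u) - 1); rewrite !expr2; lra.
Qed.

(** Equality in the preceding bound makes g1 half of the identity matrix. *)
Lemma gram_orthonormal_eq : gram (A1 u) (A1 v) = 4^-1 ->
  forall w z, lor (A1 w) (A1 z) = lor (A2 w) (A2 z).
Proof.
rewrite /gram sum1 => e.
have sq : (lor (A1 u) (A1 u) - 2^-1) ^+ 2 + lor (A1 u) (A1 v) ^+ 2 = 0.
  by move: e; rewrite !expr2; lra.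
have /andP[/eqP al0 /eqP ga0] :
    ((lor (A1 u) (A1 u) - 2^-1) == 0) && (lor (A1 u) (A1 v) == 0).
  by rewrite -(sqrf_eq0 (_ - _)) -(sqrf_eq0 (lor _ _)) -paddr_eq0 ?sqr_ge0 // sq.
have al2 : lor (A1 u) (A1 u) = 2^-1 by apply/eqP; rewrite -subr_eq0 al0.
have be2 : lor (A1 v) (A1 v) = 2^-1 by rewrite sum1 al2; lra.
move=> w z; have [a [b ->]] := span w; have [c [d ->]] := span z.
rewrite !linearD !linearZ !(lorDl, lorDr, lorZl, lorZr).
rewrite (lorC (A1 v) (A1 u)) (lorC (A2 v) (A2 u)).
have [-> -> ->] := rel2; rewrite al2 be2 ga0.
by field.
Qed.

Lemma gram_orthonormal_eq0 : gram (A1 u) (A1 v) = 0 ->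
  forall w z, gram (A1 w) (A1 z) = 0.
Proof.
move=> g0 w z; have [a [b ->]] := span w; have [c [d ->]] := span z.
rewrite !linearD !linearZ.
apply/eqP; rewrite -(mulr0 ((a * d - b * c) ^+ 2)) -g0; apply/eqP.
rewrite /gram !(lorDl, lorDr, lorZl, lorZr) (lorC (A1 v) (A1 u)).
by ring.
Qed.

End Orthonormal.
End LagrangianPlane.

Section Patch.
Context {R : realType}.
Implicit Types (U : set 'rV[R]_2) (f : 'rV[R]_2 -> 'rV[R]_3).

(** The local data of a Lagrangian immersion in coordinates. The area form and
    the function Gamma are absent because f1 and f2 determine them up to sign. *)
Record lagrangian_patch U f1 f2 : Prop := Patch {
  patch_open : open U;
  patch_smooth1 : smooth_on U f1;
  patch_smooth2 : smooth_on U f2;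
  patch_hyp1 : forall x, U x -> hyp (-1) (f1 x);
  patch_hyp2 : forall x, U x -> hyp (-1) (f2 x);
  patch_immersion : forall x u, U x -> 'd f1 x u = 0 -> 'd f2 x u = 0 -> u = 0;
  patch_lagrangian : forall x u v, U x ->
    lor (lcross (f1 x) ('d f1 x u)) ('d f1 x v) =
    lor (lcross (f2 x) ('d f2 x u)) ('d f2 x v) }.

Section OnePatch.
Variables (U : set 'rV[R]_2) (f1 f2 : 'rV[R]_2 -> 'rV[R]_3).
Hypothesis pa : lagrangian_patch U f1 f2.

Lemma patch_diff1 x : U x -> differentiable f1 x.
Proof. exact: smooth_on_differentiable (patch_smooth1 pa). Qed.

Lemma patch_diff2 x : U x -> differentiable f2 x.
Proof. exact: smooth_on_differentiable (patch_smooth2 pa). Qed.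

Lemma patch_lor1 x : U x -> lor (f1 x) (f1 x) = -1.
Proof. by move=> /(patch_hyp1 pa)/hypN1P[]. Qed.

Lemma patch_lor2 x : U x -> lor (f2 x) (f2 x) = -1.
Proof. by move=> /(patch_hyp2 pa)/hypN1P[]. Qed.

Lemma patch_tangent1 x u : U x -> lor (f1 x) ('d f1 x u) = 0.
Proof.
move=> Ux; have df := patch_diff1 Ux; rewrite -(deriveE _ df).
exact: (unit_derive (patch_open pa) (patch_smooth1 pa) patch_lor1).
Qed.

Lemma patch_tangent2 x u : U x -> lor (f2 x) ('d f2 x u) = 0.
Proof.
move=> Ux; have df := patch_diff2 Ux; rewrite -(deriveE _ df).
exact: (unit_derive (patch_open pa) (patch_smooth2 pa) patch_lor2).
Qed.

Lemma patch_plane x : U x -> lagrangian_plane (f1 x) (f2 x) ('d f1 x) ('d f2 x).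
Proof.
move=> Ux; split; first exact: patch_lor1.
- exact: patch_lor2.
- by move=> u; exact: patch_tangent1.
- by move=> u; exact: patch_tangent2.
- by move=> u; exact: (patch_immersion pa Ux).
- by move=> u v; exact: (patch_lagrangian pa u v Ux).
Qed.

End OnePatch.
End Patch.

Lemma diagonal_gram (R : realType) (a a' b b' : 'rV[R]_3) (g1 g2 : R) :
  a = a' -> b = b' -> lor a a + lor a' a' = 1 -> lor b b + lor b' b' = 1 ->
  lor a b + lor a' b' = 0 -> gram a b + gram a' b' = g1 + g2 -> g1 = g2 -> g1 = 4^-1.
Proof.
move=> <- <- aa bb ab g12 e.
have gE : gram a b = 4^-1.
  have -> : gram a b = lor a a * lor b b - lor a b * lor a b by [].
  have -> : lor a a = 2^-1 by lra.
  have -> : lor b b = 2^-1 by lra.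
  have -> : lor a b = 0 by lra.
  by field.
by move: g12; rewrite gE e; lra.
Qed.

Section Charts.
Context {R : realType} {S : surface R}.
Local Notation E := ('rV[R]_3 * 'rV[R]_3)%type.
Variables (Phi : S -> E) (Phi_imm : immersionHH Phi) (Phi_lag : lagrangian Phi).

Definition chart_fst (c : chart R S) : 'rV[R]_2 -> 'rV[R]_3 := (fst \o Phi) \o chart_inv c.
Definition chart_snd (c : chart R S) : 'rV[R]_2 -> 'rV[R]_3 := (snd \o Phi) \o chart_inv c.

Lemma dchart_pair c x u : atlas c -> chart_img c x ->
  dchart Phi c x u = ('d (chart_fst c) x u, 'd (chart_snd c) x u).
Proof.
move=> ac Ux; have [sP _ _] := Phi_imm.
have df := smooth_on_differentiable (sP c ac) Ux.
have e1 := derive_lin_comp (L := fstL) (@fst_continuous R _ _) u df.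
have e2 := derive_lin_comp (L := sndL) (@snd_continuous R _ _) u df.
have d1 := differentiable_lin_comp (L := fstL) (@fst_continuous R _ _) df.
have d2 := differentiable_lin_comp (L := sndL) (@snd_continuous R _ _) df.
rewrite (deriveE _ df) (deriveE _ d1) in e1.
rewrite (deriveE _ df) (deriveE _ d2) in e2.
rewrite /dchart; apply: etrans (surjective_pairing _) _.
by congr pair; [exact: esym e1|exact: esym e2].
Qed.

Lemma chart_patch c : atlas c -> lagrangian_patch (chart_img c) (chart_fst c) (chart_snd c).
Proof.
move=> ac; have [sP hP iP] := Phi_imm.
have oU : open (chart_img c) by exact: chart_img_open.
split.
- exact: oU.
- exact: (smooth_lin_comp (L := fstL) oU (@fst_continuous R _ _) (sP c ac)).
- exact: (smooth_lin_comp (L := sndL) oU (@snd_continuous R _ _) (sP c ac)).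
- by move=> x _; have [] := hP (chart_inv c x).
- by move=> x _; have [] := hP (chart_inv c x).
- move=> x u Ux e1 e2; apply: (iP c x ac Ux).
  apply: etrans (dchart_pair u ac Ux) _.
  apply: etrans (congr2 pair e1 e2) _; apply: esym; exact: linear0.
- move=> x u v Ux; have := Phi_lag u v ac Ux.
  rewrite (dchart_pair u ac Ux) (dchart_pair v ac Ux) /metricHH /JHH /=.
  by rewrite !hypJN1 lorNl; exact: subr0_eq.
Qed.

Lemma surface_point (p : S) : exists c x, [/\ atlas c, chart_img c x & chart_inv c x = p].
Proof.
have [c ac cp] := atlas_cover p; exists c, (chart_map c p); split=> //.
  by exists p.
exact: chart_mapK.
Qed.

Variables (Gam : S -> R) (Gam_Phi : associated_function Phi Gam).

(** On an orthonormal basis the area form is 1 or -1, so Gamma is there the Kaehler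
    form of the first component up to sign. *)
Lemma associated_function_sq c x u v : atlas c -> chart_img c x ->
  plane_metric ('d (chart_fst c) x) ('d (chart_snd c) x) u u = 1 ->
  plane_metric ('d (chart_fst c) x) ('d (chart_snd c) x) v v = 1 ->
  plane_metric ('d (chart_fst c) x) ('d (chart_snd c) x) u v = 0 ->
  Gam (chart_inv c x) ^+ 2 = gram ('d (chart_fst c) x u) ('d (chart_fst c) x v).
Proof.
move=> ac Ux uu vv uv; have pa := chart_patch ac.
have [w [_ _ w1] wE] := Gam_Phi ac Ux.
have gE a b : induced_metric Phi c x a b =
    plane_metric ('d (chart_fst c) x) ('d (chart_snd c) x) a b.
  by rewrite /induced_metric !(dchart_pair _ ac Ux).
have {w1} := w1 u v; rewrite !gE => /(_ uu vv uv) w1.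
have [e _] := wE u v.
apply: etrans _ (kahler_sq (patch_lor1 pa Ux) (patch_tangent1 pa u Ux) (patch_tangent1 pa v Ux)).
rewrite -kahlerN1 (e : kahler _ _ _ _ = _) exprMn.
by rewrite -[w u v ^+ 2]real_normK ?num_real // w1 expr1n mulr1.
Qed.

Lemma plane_at c x : atlas c -> chart_img c x ->
  exists u v, [/\ plane_metric ('d (chart_fst c) x) ('d (chart_snd c) x) u u = 1,
    plane_metric ('d (chart_fst c) x) ('d (chart_snd c) x) v v = 1,
    plane_metric ('d (chart_fst c) x) ('d (chart_snd c) x) u v = 0 &
    forall w, exists a b, w = a *: u + b *: v].
Proof. by move=> ac Ux; exact: (plane_metric_basis (patch_plane (chart_patch ac) Ux)). Qed.

Lemma associated_function_le p : 0 <= Gam p ^+ 2 <= 4^-1.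
Proof.
rewrite sqr_ge0 /=; have [c [x [ac Ux <-]]] := surface_point p.
have [u [v [uu vv uv span]]] := plane_at ac Ux.
rewrite (associated_function_sq ac Ux uu vv uv).
exact: (gram_orthonormal_le (patch_plane (chart_patch ac) Ux) uu vv uv).
Qed.

Lemma associated_function_max c x : atlas c -> chart_img c x ->
  Gam (chart_inv c x) ^+ 2 = 4^-1 ->
  forall w z, lor ('d (chart_fst c) x w) ('d (chart_fst c) x z) =
              lor ('d (chart_snd c) x w) ('d (chart_snd c) x z).
Proof.
move=> ac Ux; have [u [v [uu vv uv span]]] := plane_at ac Ux.
rewrite (associated_function_sq ac Ux uu vv uv) => e.
exact: (gram_orthonormal_eq (patch_plane (chart_patch ac) Ux) uu vv uv span e).
Qed.

Lemma associated_function_eq0 c x : atlas c -> chart_img c x ->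
  Gam (chart_inv c x) ^+ 2 = 0 <->
  forall w z, gram ('d (chart_fst c) x w) ('d (chart_fst c) x z) = 0.
Proof.
move=> ac Ux; have [u [v [uu vv uv span]]] := plane_at ac Ux.
rewrite (associated_function_sq ac Ux uu vv uv); split; last exact.
exact: gram_orthonormal_eq0.
Qed.

(** The images of an orthonormal basis of the tangent plane have equal components,
    each of half the length, so the sum of the Gram determinants is
    1/4 + 1/4 after the isometry. By [isometry_gram] it is the same before, where
    the two determinants are equal to each other and to Gamma^2. *)
Lemma diagonal_associated_function (F : E -> E) : isometryHH F ->
  (forall p, (F (Phi p)).1 = (F (Phi p)).2) -> forall p, Gam p ^+ 2 = 4^-1.
Proof.
move=> iF Fd p; have [c [x [ac Ux <-]]] := surface_point p.
have [u [v [uu vv uv span]]] := plane_at ac Ux.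
rewrite (associated_function_sq ac Ux uu vv uv).
have pa := chart_patch ac; have [sF _ mF] := iF; have [sP hP _] := Phi_imm.
set q := Phi (chart_inv c x); have Hq : HH q by exact: hP.
pose T w : E := ('d (chart_fst c) x w, 'd (chart_snd c) x w).
have tT w : tangentHH q (T w).
  by split; [exact: (patch_tangent1 pa w Ux)|exact: (patch_tangent2 pa w Ux)].
have dd w : ('d F q (T w)).1 = ('d F q (T w)).2.
  have df := smooth_on_differentiable (sP c ac) Ux.
  have dF : differentiable F ((Phi \o chart_inv c) x) by exact: differentiable_selfmap.
  have dc := differentiable_comp df dF.
  have -> : 'd F q (T w) = 'D_w (F \o (Phi \o chart_inv c)) x.
    rewrite (derive_comp_dir w df dF) (deriveE _ df) (deriveE _ dF).
    exact: (congr1 ('d F q) (esym (dchart_pair w ac Ux))).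
  rewrite -[LHS](derive_lin_comp (L := fstL) (@fst_continuous R _ _) w dc).
  rewrite -[RHS](derive_lin_comp (L := sndL) (@snd_continuous R _ _) w dc).
  by apply: (derive_eq_in (patch_open pa) w Ux) => y _ /=; exact: Fd.
exact: (diagonal_gram (dd u) (dd v) (etrans (mF q _ _ Hq (tT u) (tT u)) uu)
  (etrans (mF q _ _ Hq (tT v) (tT v)) vv) (etrans (mF q _ _ Hq (tT u) (tT v)) uv)
  (isometry_gram iF Hq (tT u) (tT v)) (plane_gram_eq (patch_plane pa Ux) u v)).
Qed.

End Charts.

(** * Moving frames and local congruence *)

Section Frames.
Context {R : realType}.
Implicit Types (p a b z w : 'rV[R]_3).

Lemma lcrossDl z z' w : lcross (z + z') w = lcross z w + lcross z' w.
Proof. exact: linearDl. Qed.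
Lemma lcrossDr z w w' : lcross z (w + w') = lcross z w + lcross z w'.
Proof. exact: linearDr. Qed.
Lemma lcrossZl k z w : lcross (k *: z) w = k *: lcross z w.
Proof. exact: linearZl_LR. Qed.
Lemma lcrossZr k z w : lcross z (k *: w) = k *: lcross z w.
Proof. exact: linearZr_LR. Qed.
Lemma lcrossvv z : lcross z z = 0.
Proof. by apply: rowP3; rewrite !(lcrossE, mxE); ring. Qed.

Record oframe p a b : Prop := OFrame {
  oframe_pp : lor p p = -1;
  oframe_pa : lor p a = 0;
  oframe_aa : lor a a = 1;
  oframe_b : b = lcross p a }.

Section OneFrame.
Variables (p a b : 'rV[R]_3) (fr : oframe p a b).

Lemma oframe_pb : lor p b = 0.
Proof. by rewrite (oframe_b fr) lorC lor_lcross_l. Qed.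

Lemma oframe_ab : lor a b = 0.
Proof. by rewrite (oframe_b fr) lorC lor_lcross_r. Qed.

Lemma oframe_bb : lor b b = 1.
Proof.
rewrite (oframe_b fr) lor_lcross2 (oframe_pp fr) (oframe_aa fr) (oframe_pa fr).
by ring.
Qed.

(** The difference of the two sides is orthogonal to p and a, hence a tangent
    vector at p, and its product with b is the Kaehler form against a; by
    [kahler_sq] its length vanishes. *)
Lemma oframe_expand z : z = - lor z p *: p + lor z a *: a + lor z b *: b.
Proof.
set w := - lor z p *: p + lor z a *: a + lor z b *: b.
have [pp pa aa eb] := fr; have pb := oframe_pb; have ab := oframe_ab; have bb := oframe_bb.
have tp : lor p (z - w) = 0.
  by rewrite /w lorDr lorNr !lorDr !lorZr pp pa pb (lorC p z); ring.
have ta : lor a (z - w) = 0.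
  by rewrite /w lorDr lorNr !lorDr !lorZr aa (lorC a p) pa ab (lorC a z); ring.
have tb : lor b (z - w) = 0.
  by rewrite /w lorDr lorNr !lorDr !lorZr bb (lorC b p) pb (lorC b a) ab (lorC b z); ring.
apply/eqP; rewrite -subr_eq0; apply/eqP; apply: (tangent_eq0 pp tp).
have := kahler_sq pp pa tp; rewrite -eb tb aa ta expr0n /=.
by rewrite mul1r subr0.
Qed.

Lemma oframe_lcross (z0 z1 z2 w0 w1 w2 : R) :
  lcross (z0 *: p + z1 *: a + z2 *: b) (w0 *: p + w1 *: a + w2 *: b) =
  (z2 * w1 - z1 * w2) *: p + (z2 * w0 - z0 * w2) *: a + (z0 * w1 - z1 * w0) *: b.
Proof.
have [pp pa aa eb] := fr.
have xpa : lcross p a = b by [].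
have xpb : lcross p b = - a.
  by rewrite eb lcross_lcross pp pa scaleN1r scale0r subr0.
have xab : lcross a b = - p.
  by rewrite eb lcross_lcross (lorC a p) pa aa scale0r scale1r sub0r.
have xap : lcross a p = - b by rewrite lcrossC xpa.
have xbp : lcross b p = a by rewrite lcrossC xpb opprK.
have xba : lcross b a = p by rewrite lcrossC xab opprK.
rewrite !(lcrossDl, lcrossDr, lcrossZl, lcrossZr) !lcrossvv xpa xpb xab xap xbp xba.
by apply: rowP3; rewrite !mxE; ring.
Qed.

End OneFrame.

(** The linear map sending the first frame to the second, in the form of a sum
    of rank one tensors: this form can be differentiated when the frames move. *)
Definition frame_map p1 a1 b1 p2 a2 b2 z : 'rV[R]_3 :=
  - lor z p1 *: p2 + lor z a1 *: a2 + lor z b1 *: b2.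

Fact frame_map_is_linear p1 a1 b1 p2 a2 b2 : linear (frame_map p1 a1 b1 p2 a2 b2).
Proof.
move=> k z w; rewrite /frame_map !lorDl !lorZl.
by apply: rowP3; rewrite !mxE; ring.
Qed.

HB.instance Definition _ p1 a1 b1 p2 a2 b2 :=
  GRing.isLinear.Build R 'rV[R]_3 'rV[R]_3 _ (frame_map p1 a1 b1 p2 a2 b2)
    (frame_map_is_linear p1 a1 b1 p2 a2 b2).

Section TwoFrames.
Variables (p1 a1 b1 p2 a2 b2 : 'rV[R]_3).
Hypotheses (fr1 : oframe p1 a1 b1) (fr2 : oframe p2 a2 b2).

Let L := frame_map p1 a1 b1 p2 a2 b2.

Let L_coord (z0 z1 z2 : R) :
  L (z0 *: p1 + z1 *: a1 + z2 *: b1) = z0 *: p2 + z1 *: a2 + z2 *: b2.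
Proof.
have [pp pa aa _] := fr1.
rewrite /L /frame_map !lorDl !lorZl pp aa pa (oframe_pb fr1) (oframe_bb fr1).
rewrite (lorC a1 p1) pa (lorC b1 p1) (oframe_pb fr1) (lorC b1 a1) (oframe_ab fr1).
by apply: rowP3; rewrite !mxE; ring.
Qed.

Lemma frame_map_p : L p1 = p2.
Proof.
have := L_coord 1 0 0; rewrite !scale1r !scale0r !addr0; exact.
Qed.

Lemma frame_map_lor z w : lor (L z) (L w) = lor z w.
Proof.
have [pp pa aa _] := fr2.
rewrite {2}(oframe_expand fr1 z) /L /frame_map !lorDl !lorZl !lorDr !lorZr.
rewrite pp aa pa (oframe_pb fr2) (oframe_bb fr2).
rewrite (lorC a2 p2) pa (lorC b2 p2) (oframe_pb fr2) (lorC b2 a2) (oframe_ab fr2).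
by rewrite (lorC p1 w) (lorC a1 w) (lorC b1 w); ring.
Qed.

Lemma frame_map_lcross z w : lcross (L z) (L w) = L (lcross z w).
Proof.
rewrite {2}(oframe_expand fr1 z) {2}(oframe_expand fr1 w).
by rewrite (oframe_lcross fr1) L_coord /L /frame_map (oframe_lcross fr2).
Qed.

Lemma frame_map_hyp z : hyp (-1) p1 -> hyp (-1) p2 -> hyp (-1) z -> hyp (-1) (L z).
Proof.
move=> h1 h2 hz; apply: (hyp_of_lor_lt0 h2).
  by rewrite frame_map_lor; have /hypN1P[] := hz.
by rewrite -frame_map_p frame_map_lor; exact: hyp_lor_lt0.
Qed.

Lemma frame_mapK z : frame_map p2 a2 b2 p1 a1 b1 (L z) = z.
Proof.
have [pp pa aa _] := fr2.
rewrite [RHS](oframe_expand fr1 z) /L /frame_map !lorDl !lorZl pp aa pa.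
rewrite (oframe_pb fr2) (oframe_bb fr2).
rewrite (lorC a2 p2) pa (lorC b2 p2) (oframe_pb fr2) (lorC b2 a2) (oframe_ab fr2).
by apply: rowP3; rewrite !mxE; ring.
Qed.

End TwoFrames.

End Frames.

Section MovingFrameAlgebra.
Context {R : realType}.

(** A moving Lorentz frame has an infinitesimally Lorentz derivative, given by the
    three coefficients s, t, o. If two frames share them, the tensor that carries
    one to the other has derivative 0. *)
Lemma frame_derivative_alg (xi eta : 'rV[R]_3) (p1 a1 b1 p2 a2 b2 : 'rV[R]_3)
    (dp1 da1 db1 dp2 da2 db2 : 'rV[R]_3) (s t o : R) :
  dp1 = s *: a1 + t *: b1 -> da1 = s *: p1 + o *: b1 -> db1 = t *: p1 - o *: a1 ->
  dp2 = s *: a2 + t *: b2 -> da2 = s *: p2 + o *: b2 -> db2 = t *: p2 - o *: a2 ->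
  - (lor xi dp1 * lor p2 eta + lor xi p1 * lor dp2 eta) +
   (lor xi da1 * lor a2 eta + lor xi a1 * lor da2 eta) +
   (lor xi db1 * lor b2 eta + lor xi b1 * lor db2 eta) = 0.
Proof.
move=> -> -> -> -> -> ->.
rewrite !(lorDl, lorDr, lorZl, lorZr, lorNl, lorNr).
by ring.
Qed.

End MovingFrameAlgebra.

Section TensorDerivative.
Context {R : realType} {V : normedModType R}.
Implicit Types (g h : V -> 'rV[R]_3).

Lemma derive_tensor (xi eta : 'rV[R]_3) g h (x c : V) :
  differentiable g x -> differentiable h x ->
  differentiable (fun y => lor xi (g y) * lor (h y) eta) x /\
  'D_c (fun y => lor xi (g y) * lor (h y) eta) x =
   lor xi ('D_c g x) * lor (h x) eta + lor xi (g x) * lor ('D_c h x) eta.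
Proof.
move=> dg dh.
have dxi : differentiable (cst xi : V -> 'rV[R]_3) x by exact: differentiable_cst.
have deta : differentiable (cst eta : V -> 'rV[R]_3) x by exact: differentiable_cst.
have d1 := differentiable_lor dxi dg; have d2 := differentiable_lor dh deta.
have [d E] := differentiable_scale d1 d2; split; first exact: d.
apply: etrans (E c) _.
rewrite (derive_lor c dxi dg) (derive_lor c dh deta) !derive_cst lor0l lor0r.
by rewrite add0r addr0.
Qed.

End TensorDerivative.

Lemma lor_skew (R : realType) (d h d2 g : 'rV[R]_3) :
  lor d h + lor g d2 = 0 -> lor d2 g = - lor d h.
Proof. by rewrite (lorC g) => /eqP; rewrite addrC addr_eq0 => /eqP. Qed.

(** The frame attached to a map f into the hyperboloid: the unit vector along
    the derivative in the direction v0, and its rotation by the complex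
    structure; s is the inverse length of that derivative. *)
Section MovingFrame.
Context {R : realType} {V : normedModType R} (U : set V) (oU : open U).
Variables (f : V -> 'rV[R]_3) (sf : smooth_on U f).
Hypothesis f1 : forall x, U x -> lor (f x) (f x) = -1.
Variables (v0 : V) (s : V -> R).
Hypothesis ds : forall x, U x -> differentiable s x.
Hypothesis s1 : forall x, U x -> s x ^+ 2 * lor ('D_v0 f x) ('D_v0 f x) = 1.

Definition frame_a x := s x *: 'D_v0 f x.
Definition frame_b x := lcross (f x) (frame_a x).

Let df x : U x -> differentiable f x.
Proof. exact: smooth_on_differentiable. Qed.

Let dD x : U x -> differentiable ('D_v0 f) x.
Proof. exact: smooth_on_differentiable (smooth_on_derive v0 sf). Qed.

Lemma differentiable_frame_a x : U x -> differentiable frame_a x.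
Proof. by move=> Ux; exact: (differentiable_scale (ds Ux) (dD Ux)).1. Qed.

Lemma differentiable_frame_b x : U x -> differentiable frame_b x.
Proof.
by move=> Ux; exact: (differentiable_lcross (df Ux) (differentiable_frame_a Ux)).
Qed.

Lemma moving_oframe x : U x -> oframe (f x) (frame_a x) (frame_b x).
Proof.
move=> Ux; split=> //; first exact: f1.
  by rewrite lorZr (unit_derive oU sf f1) // mulr0.
by rewrite lorZl lorZr mulrA -expr2 s1.
Qed.

Section Structure.
Variables (x c : V) (Ux : U x).

Let fr := moving_oframe Ux.
Let s_ := lor ('D_c f x) (frame_a x).
Let t_ := lor ('D_c f x) (frame_b x).
Let o_ := lor ('D_c frame_a x) (frame_b x).

Lemma moving_frame_f : 'D_c f x = s_ *: frame_a x + t_ *: frame_b x.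
Proof.
rewrite {1}(oframe_expand fr ('D_c f x)) (lorC ('D_c f x) (f x)).
by rewrite (unit_derive oU sf f1) // oppr0 scale0r add0r.
Qed.

Lemma moving_frame_a : 'D_c frame_a x = s_ *: f x + o_ *: frame_b x.
Proof.
have e1 := lor_const_derive c oU (fun y Uy => oframe_pa (moving_oframe Uy)) Ux
  (df Ux) (differentiable_frame_a Ux).
have e2 := lor_const_derive c oU (fun y Uy => oframe_aa (moving_oframe Uy)) Ux
  (differentiable_frame_a Ux) (differentiable_frame_a Ux).
apply: etrans (oframe_expand fr ('D_c frame_a x)) _.
by rewrite (lor_skew e1) (lor_half e2) opprK scale0r addr0.
Qed.

Lemma moving_frame_b : 'D_c frame_b x = t_ *: f x - o_ *: frame_a x.
Proof.
have e1 := lor_const_derive c oU (fun y Uy => oframe_pb (moving_oframe Uy)) Ux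
  (df Ux) (differentiable_frame_b Ux).
have e2 := lor_const_derive c oU (fun y Uy => oframe_ab (moving_oframe Uy)) Ux
  (differentiable_frame_a Ux) (differentiable_frame_b Ux).
have e3 := lor_const_derive c oU (fun y Uy => oframe_bb (moving_oframe Uy)) Ux
  (differentiable_frame_b Ux) (differentiable_frame_b Ux).
apply: etrans (oframe_expand fr ('D_c frame_b x)) _.
by rewrite (lor_skew e1) (lor_skew e2) (lor_half e3) opprK scale0r addr0 scaleNr.
Qed.

(** The remaining coefficient of the frame is the connection form. The derivative
    of the normalising factor s does not contribute, being multiplied by a vector
    orthogonal to the second frame vector. *)
Lemma moving_frame_connection :
  o_ = s x ^+ 2 * lor ('D_c ('D_v0 f) x) (lcross (f x) ('D_v0 f x)).
Proof.
rewrite /o_ /frame_b lcrossZr lorZr.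
have -> : 'D_c frame_a x = 'D_c s x *: 'D_v0 f x + s x *: 'D_c ('D_v0 f) x.
  exact: (differentiable_scale (ds Ux) (dD Ux)).2.
rewrite lorDl !lorZl (lorC ('D_v0 f x)) lor_lcross_r mulr0 add0r.
by rewrite mulrA expr2.
Qed.

End Structure.
End MovingFrame.

(** In an oriented plane the rotation of d0 is, up to a factor, the part of d1
    orthogonal to d0. This expresses the rotated vector through the metric and
    the area alone. *)
Lemma tangent_rotation (R : realType) (p d0 d1 : 'rV[R]_3) :
  lor p p = -1 -> lor p d0 = 0 -> lor p d1 = 0 ->
  lor (lcross p d0) d1 *: lcross p d0 = lor d0 d0 *: d1 - lor d0 d1 *: d0.
Proof.
move=> pp t0 t1.
have e : lcross d0 d1 = - lor (lcross p d0) d1 *: p.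
  have := lcross_lcross p p (lcross d0 d1).
  have -> : lcross p (lcross d0 d1) = 0.
    by rewrite lcross_lcross t0 t1 !scale0r subrr.
  rewrite (_ : lcross p 0 = 0); last exact: linear0r.
  rewrite pp scaleN1r (lorC p) -(lor_lcross_cycle p) => /eqP.
  by rewrite eq_sym subr_eq add0r eqr_oppLR scaleNr => /eqP.
have := lcross_lcross d0 d0 d1; rewrite e lcrossZr (lcrossC d0 p) => <-.
by rewrite scalerN scaleNr opprK.
Qed.

Lemma lor_frame_b (R : realType) (d p e : 'rV[R]_3) (k : R) :
  lor d (lcross p (k *: e)) = k * lor (lcross p e) d.
Proof. by rewrite lcrossZr lorZr lorC. Qed.

(** By [tangent_rotation] the product of a second derivative with the rotated
    vector is a combination of its products with d0 and d1, with coefficients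
    read off the metric and the area. *)
Lemma connection_alg (R : realType) (p d0 d1 q e0 e1 k l : 'rV[R]_3) :
  lor p p = -1 -> lor p d0 = 0 -> lor p d1 = 0 ->
  lor q q = -1 -> lor q e0 = 0 -> lor q e1 = 0 ->
  lor (lcross p d0) d1 != 0 -> lor (lcross p d0) d1 = lor (lcross q e0) e1 ->
  lor d0 d0 = lor e0 e0 -> lor d0 d1 = lor e0 e1 ->
  lor k d1 = lor l e1 -> lor k d0 = lor l e0 ->
  lor k (lcross p d0) = lor l (lcross q e0).
Proof.
move=> pp p0 p1 qq q0 q1 n0 W g00 g01 k1 k0; apply: (mulfI n0).
rewrite -lorZr (tangent_rotation pp p0 p1) W -lorZr (tangent_rotation qq q0 q1).
by rewrite !lorDr !lorNr !lorZr g00 g01 k1 k0.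
Qed.

Lemma derive_dir_sub (R : realType) (V W : normedModType R) (f : V -> W) (x : V) (k l : R)
  (u v : V) : differentiable f x ->
  'D_(k *: u - l *: v) f x = k *: 'D_u f x - l *: 'D_v f x.
Proof. by move=> df; rewrite !(deriveE _ df) linearB !linearZ. Qed.

Lemma basis_comb_eq0 (R : realType) (k l : R) :
  k *: delta_mx 0 1 - l *: delta_mx 0 0 = 0 :> 'rV[R]_2 -> k = 0.
Proof. by move=> /rowP /(_ 1); rewrite !mxE /= mulr1 mulr0 subr0. Qed.

Section IsometricPatch.
Context {R : realType}.
Variables (U : set 'rV[R]_2) (f1 f2 : 'rV[R]_2 -> 'rV[R]_3).
Hypothesis pa : lagrangian_patch U f1 f2.
Hypothesis iso : forall x w z, U x ->
  lor ('d f1 x w) ('d f1 x z) = lor ('d f2 x w) ('d f2 x z).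

Let oU := patch_open pa.
Let sf1 := patch_smooth1 pa.
Let sf2 := patch_smooth2 pa.
Let u1 := patch_lor1 pa.
Let u2 := patch_lor2 pa.
Let v0 : 'rV[R]_2 := delta_mx 0 0.
Let v1 : 'rV[R]_2 := delta_mx 0 1.

Let form_eq a b x : U x -> first_form f1 a b x = first_form f2 a b x.
Proof.
move=> Ux; have := iso a b Ux; rewrite /first_form.
rewrite (deriveE a (patch_diff1 pa Ux)) (deriveE b (patch_diff1 pa Ux)).
by rewrite (deriveE a (patch_diff2 pa Ux)) (deriveE b (patch_diff2 pa Ux)).
Qed.

Let koszul_eq a b c x : U x ->
  lor ('D_c ('D_a f1) x) ('D_b f1 x) = lor ('D_c ('D_a f2) x) ('D_b f2 x).
Proof.
move=> Ux.
have d a' b' c' : 'D_c' (first_form f1 a' b') x = 'D_c' (first_form f2 a' b') x.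
  by apply: (derive_eq_in oU c' Ux) => y; rewrite inE => Uy; exact: form_eq.
apply: etrans (koszul oU sf1 a b c Ux) _.
apply: etrans _ (esym (koszul oU sf2 a b c Ux)).
exact: (congr1 ( *%R 2^-1) (congr2 (fun p q : R => p - q) (congr2 +%R (d a b c) (d c b a)) (d c a b))).
Qed.

Let lag_eq a b x : U x -> lor (lcross (f1 x) ('D_a f1 x)) ('D_b f1 x) =
  lor (lcross (f2 x) ('D_a f2 x)) ('D_b f2 x).
Proof.
move=> Ux; have := patch_lagrangian pa a b Ux.
rewrite (deriveE a (patch_diff1 pa Ux)) (deriveE b (patch_diff1 pa Ux)).
by rewrite (deriveE a (patch_diff2 pa Ux)) (deriveE b (patch_diff2 pa Ux)).
Qed.

Let imm x w : U x -> 'D_w f1 x = 0 -> w = 0.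
Proof.
move=> Ux e; have e1 : 'd f1 x w = 0 by rewrite -(deriveE w (patch_diff1 pa Ux)).
apply: (patch_immersion pa Ux e1).
apply: (tangent_eq0 (u2 Ux) (patch_tangent2 pa w Ux)).
by rewrite -iso // e1 lor0l.
Qed.

Let t1 a x : U x -> lor (f1 x) ('D_a f1 x) = 0.
Proof. exact: unit_derive. Qed.
Let t2 a x : U x -> lor (f2 x) ('D_a f2 x) = 0.
Proof. exact: unit_derive. Qed.

Let speed x := first_form f1 v0 v0 x.

Let speed_gt0 x : U x -> 0 < speed x.
Proof.
move=> Ux; rewrite lt_neqAle (tangent_ge0 (u1 Ux) (t1 v0 Ux)) andbT eq_sym.
apply/eqP => e.
have /(imm Ux) := tangent_eq0 (u1 Ux) (t1 v0 Ux) e.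
by move=> /rowP /(_ 0); rewrite !mxE /= => /eqP; rewrite oner_eq0.
Qed.

Let s x := (Num.sqrt (speed x))^-1.

Let ds x : U x -> differentiable s x.
Proof.
move=> Ux; have dsp : differentiable speed x.
  exact: smooth_on_differentiable (smooth_first_form oU sf1 v0 v0) Ux.
exact: (derive_rsqrt 0 dsp (speed_gt0 Ux)).1.
Qed.

Let s_1 x : U x -> s x ^+ 2 * lor ('D_v0 f1 x) ('D_v0 f1 x) = 1.
Proof.
move=> Ux; have g := speed_gt0 Ux.
by rewrite /s exprVn sqr_sqrtr ?ltW // mulVf // gt_eqF.
Qed.

Let s_2 x : U x -> s x ^+ 2 * lor ('D_v0 f2 x) ('D_v0 f2 x) = 1.
Proof. by move=> Ux; rewrite -[X in _ * X](form_eq v0 v0 Ux); exact: s_1. Qed.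

Let a1 := frame_a f1 v0 s.
Let a2 := frame_a f2 v0 s.
Let b1 := frame_b f1 v0 s.
Let b2 := frame_b f2 v0 s.

Lemma patch_frame1 x : U x -> oframe (f1 x) (a1 x) (b1 x).
Proof. exact: (moving_oframe oU sf1 u1 s_1). Qed.

Lemma patch_frame2 x : U x -> oframe (f2 x) (a2 x) (b2 x).
Proof. exact: (moving_oframe oU sf2 u2 s_2). Qed.

Let area x := lor (lcross (f1 x) ('D_v0 f1 x)) ('D_v1 f1 x).

Let area_neq0 x : U x -> area x != 0.
Proof.
move=> Ux; apply/eqP => e.
have := tangent_rotation (u1 Ux) (t1 v0 Ux) (t1 v1 Ux).
rewrite -/(area x) e scale0r => /esym e0.
have e1 := etrans (derive_dir_sub (speed x) (first_form f1 v0 v1 x) v1 v0 (patch_diff1 pa Ux)) e0.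
have k0 := basis_comb_eq0 (imm Ux e1).
by have := speed_gt0 Ux; rewrite k0 ltxx.
Qed.

Let connection_eq c x : U x ->
  lor ('D_c ('D_v0 f1) x) (lcross (f1 x) ('D_v0 f1 x)) =
  lor ('D_c ('D_v0 f2) x) (lcross (f2 x) ('D_v0 f2 x)).
Proof.
move=> Ux.
exact: (connection_alg (u1 Ux) (t1 v0 Ux) (t1 v1 Ux) (u2 Ux) (t2 v0 Ux) (t2 v1 Ux)
  (area_neq0 Ux) (lag_eq v0 v1 Ux) (form_eq v0 v0 Ux) (form_eq v0 v1 Ux)
  (koszul_eq v0 v1 c Ux) (koszul_eq v0 v0 c Ux)).
Qed.

Let tensor (xi eta : 'rV[R]_3) x : R :=
  - (lor xi (f1 x) * lor (f2 x) eta) + lor xi (a1 x) * lor (a2 x) eta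
   + lor xi (b1 x) * lor (b2 x) eta.

Let tensor_derive xi eta x : U x ->
  differentiable (tensor xi eta) x /\ forall c, 'D_c (tensor xi eta) x = 0.
Proof.
move=> Ux.
have df1 := patch_diff1 pa Ux; have df2 := patch_diff2 pa Ux.
have da1 : differentiable a1 x by exact: (differentiable_frame_a sf1 v0 ds Ux).
have da2 : differentiable a2 x by exact: (differentiable_frame_a sf2 v0 ds Ux).
have db1 : differentiable b1 x by exact: (differentiable_frame_b sf1 v0 ds Ux).
have db2 : differentiable b2 x by exact: (differentiable_frame_b sf2 v0 ds Ux).
have [e1 _] := derive_tensor xi eta 0 df1 df2.
have [e2 _] := derive_tensor xi eta 0 da1 da2.
have [e3 _] := derive_tensor xi eta 0 db1 db2.
have e1n := differentiableN e1.
have e12 := differentiableD e1n e2.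
split=> [|c]; first exact: differentiableD e12 e3.
have dv (g : _ -> R) : differentiable g x -> derivable g x c by exact: diff_derivable.
apply: etrans (deriveD (dv _ e12) (dv _ e3)) _.
apply: etrans (congr2 +%R (etrans (deriveD (dv _ e1n) (dv _ e2))
    (congr2 +%R (etrans (deriveN (dv _ e1)) (congr1 -%R (derive_tensor xi eta c df1 df2).2))
      (derive_tensor xi eta c da1 da2).2))
    (derive_tensor xi eta c db1 db2).2) _.
have s_eq : lor ('D_c f2 x) (a2 x) = lor ('D_c f1 x) (a1 x).
  apply: etrans (lorZr _ _ _) (etrans _ (esym (lorZr _ _ _))).
  exact: (congr1 ( *%R (s x)) (esym (form_eq c v0 Ux))).
have t_eq : lor ('D_c f2 x) (b2 x) = lor ('D_c f1 x) (b1 x).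
  apply: etrans (lor_frame_b _ _ _ _) (etrans _ (esym (lor_frame_b _ _ _ _))).
  exact: (congr1 ( *%R (s x)) (esym (lag_eq v0 c Ux))).
have o_eq : lor ('D_c a2 x) (b2 x) = lor ('D_c a1 x) (b1 x).
  apply: etrans (moving_frame_connection sf2 v0 ds c Ux) _.
  apply: etrans _ (esym (moving_frame_connection sf1 v0 ds c Ux)).
  exact: (congr1 ( *%R (s x ^+ 2)) (esym (connection_eq c Ux))).
have g1 := moving_frame_f oU sf1 u1 s_1 c Ux.
have g2 := moving_frame_a oU sf1 u1 ds s_1 c Ux.
have g3 := moving_frame_b oU sf1 u1 ds s_1 c Ux.
have h1 := moving_frame_f oU sf2 u2 s_2 c Ux.
have h2 := moving_frame_a oU sf2 u2 ds s_2 c Ux.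
have h3 := moving_frame_b oU sf2 u2 ds s_2 c Ux.
rewrite s_eq t_eq in h1; rewrite s_eq o_eq in h2; rewrite t_eq o_eq in h3.
exact: (frame_derivative_alg xi eta g1 g2 g3 h1 h2 h3).
Qed.

(** The tensor that carries the frame along f1 to the frame along f2 has derivative
    0, since both frames have the same coefficients: the metric determines the
    derivative of the point along the first frame vector, the Kaehler form that
    along the second, and the formula of Koszul the connection form. Evaluating
    the constant tensor on f1 x, which only sees the first frame vector, gives
    f2 x. *)
Lemma local_congruence x0 r : ball x0 r `<=` U -> ball x0 r x0 ->
  exists p1' a1' b1' p2' a2' b2', [/\ oframe p1' a1' b1', oframe p2' a2' b2',
    hyp (-1) p1', hyp (-1) p2' &
    forall x, ball x0 r x -> f2 x = frame_map p1' a1' b1' p2' a2' b2' (f1 x)].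
Proof.
move=> BU Bx0; have Ux0 := BU _ Bx0.
exists (f1 x0), (a1 x0), (b1 x0), (f2 x0), (a2 x0), (b2 x0); split.
- exact: patch_frame1.
- exact: patch_frame2.
- exact: patch_hyp1 pa _ Ux0.
- exact: patch_hyp2 pa _ Ux0.
move=> x Bx; apply/eqP; rewrite -subr_eq0; apply/eqP; apply: lor_nondeg => eta.
rewrite lorDl lorNl; apply/eqP; rewrite subr_eq0; apply/eqP.
have := const_on_ball (fun y By => tensor_derive (f1 x) eta (BU y By)) Bx Bx0.
rewrite {1}/tensor (u1 (BU _ Bx)) (oframe_pa (patch_frame1 (BU _ Bx))).
rewrite (oframe_pb (patch_frame1 (BU _ Bx))) !mul0r !addr0 mulN1r opprK => ->.
by rewrite /tensor /frame_map !lorDl !lorZl mulNr.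
Qed.

(** Differentiating L o f1 = L' o f1 shows that L and L' agree on the tangent plane
    as well as on the point, and these span the space. *)
Lemma image_determines (L L' : {linear 'rV[R]_3 -> 'rV[R]_3}) (W : set 'rV[R]_2) x :
  open W -> W `<=` U -> W x -> (forall y, W y -> L (f1 y) = L' (f1 y)) -> L =1 L'.
Proof.
move=> oW WU Wx LL; have Ux := WU _ Wx; have df := patch_diff1 pa Ux.
have D c : L ('D_c f1 x) = L' ('D_c f1 x).
  rewrite -(derive_lin_comp (@linear_row_continuous _ _ _ L) c df).
  rewrite -(derive_lin_comp (@linear_row_continuous _ _ _ L') c df).
  by apply: (derive_eq_in oW c Wx) => y; rewrite inE => Wy /=; exact: LL.
have Db : L (lcross (f1 x) ('D_v0 f1 x)) = L' (lcross (f1 x) ('D_v0 f1 x)).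
  have rot := tangent_rotation (u1 Ux) (t1 v0 Ux) (t1 v1 Ux).
  have comb X Y p q : L X = L' X -> L Y = L' Y -> L (p *: X - q *: Y) = L' (p *: X - q *: Y).
    by move=> eX eY; rewrite !linearB !linearZ /= eX eY.
  apply: (scalerI (area_neq0 Ux)); rewrite -!linearZ /= /area rot.
  exact: (comb _ _ _ _ (D _) (D _)).
move=> z; rewrite (oframe_expand (patch_frame1 Ux) z) !linearD !linearZ /=.
rewrite (LL _ Wx) /a1 /b1 /frame_b /frame_a lcrossZr !linearZ /= D Db.
by [].
Qed.

End IsometricPatch.

(** * Extremal surfaces lie in the diagonal *)

Section ChartTopology.
Context {R : realType} {S : surface R}.

Lemma chart_preimage_open (c : chart R S) (W : set 'rV[R]_2) : open W ->
  open (chart_dom c `&` chart_map c @^-1` W).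
Proof.
move=> oW; rewrite openE => p [Dp Wp]; rewrite /interior.
apply: filterI; first by apply: open_nbhs_nbhs; split=> //; exact: chart_dom_open.
have cp : {for p, continuous (chart_map c)} by apply: (chart_map_cont (c := c)); rewrite inE.
by apply: cp; exact: open_nbhs_nbhs.
Qed.

Lemma chart_inv_preimage_open (c : chart R S) (V : set S) : open V ->
  open (chart_img c `&` chart_inv c @^-1` V).
Proof.
move=> oV; rewrite openE => x [Ux Vx]; rewrite /interior.
apply: filterI; first by apply: open_nbhs_nbhs; split=> //; exact: chart_img_open.
have cx : {for x, continuous (chart_inv c)} by apply: (chart_inv_cont (c := c)); rewrite inE.
by apply: cx; exact: open_nbhs_nbhs.
Qed.

Lemma chart_invK (c : chart R S) x : chart_img c x -> chart_map c (chart_inv c x) = x.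
Proof. by move=> [p Dp <-]; rewrite chart_mapK. Qed.

Lemma chart_inv_dom (c : chart R S) x : chart_img c x -> chart_dom c (chart_inv c x).
Proof. by move=> [p Dp <-]; rewrite chart_mapK. Qed.

End ChartTopology.

Section RowOfFunctions.
Context {R : realType} (n : nat).
Variables (U : set 'rV[R]_n) (oU : open U) (g : 'I_n -> 'rV[R]_n -> R).
Hypothesis sg : forall j, smooth_on U (g j).

Definition row_of (x : 'rV[R]_n) : 'rV[R]_n := \row_j g j x.

Lemma row_ofE x j : row_of x 0 j = g j x.
Proof. by rewrite mxE. Qed.

Lemma smooth_row_of : smooth_on U row_of.
Proof.
apply: smooth_row => // j; apply: eq_smooth (sg j) => // x _.
by rewrite row_ofE.
Qed.

Lemma diff_row_of x u j : U x -> 'd row_of x u 0 j = 'D_u (g j) x.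
Proof.
move=> Ux; have df := smooth_on_differentiable smooth_row_of Ux.
rewrite -(deriveE u df); apply: etrans (esym (derive_entry u 0 j df)) _.
by apply: (derive_eq_in oU u Ux) => y _; exact: row_ofE.
Qed.

End RowOfFunctions.

Section SecondFactorMap.
Context {R : realType}.
Local Notation E := ('rV[R]_3 * 'rV[R]_3)%type.
Variable L : {linear 'rV[R]_3 -> 'rV[R]_3}.

Definition second_map (z : E) : E := (z.1, L z.2).

Fact second_map_is_linear : linear second_map.
Proof. by move=> a u v; rewrite /second_map /= linearP. Qed.

HB.instance Definition _ := GRing.isLinear.Build R E E _ second_map second_map_is_linear.

Lemma second_map_continuous : continuous second_map.
Proof.
move=> z; apply: differentiable_continuous.
apply: (differentiable_pair (f := fst) (g := L \o snd)).
  by apply: linear_differentiable; exact: fst_continuous.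
apply: differentiable_comp; apply: linear_differentiable.
  exact: snd_continuous.
exact: linear_row_continuous.
Qed.

Lemma diff_second_map z : 'd second_map z = second_map :> (E -> E).
Proof. by rewrite diff_lin //; exact: second_map_continuous. Qed.

Lemma second_map_selfmap : (forall x, hyp (-1) x -> hyp (-1) (L x)) ->
  smooth_selfmap second_map.
Proof.
move=> hL; split; last by move=> p [h1 h2]; split=> //; exact: hL.
exists setT; split=> //; first exact: openT.
by apply: smooth_lin; exact: second_map_continuous.
Qed.

Lemma second_map_holomorphic : (forall x y, lcross (L x) (L y) = L (lcross x y)) ->
  holomorphicHH second_map.
Proof.
move=> cL p u _ _; rewrite !diff_second_map /second_map /JHH /= !hypJN1.
by rewrite linearN cL.
Qed.

End SecondFactorMap.

Lemma second_map_isometry (R : realType) (L L' : {linear 'rV[R]_3 -> 'rV[R]_3}) :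
  (forall x, hyp (-1) x -> hyp (-1) (L x)) -> (forall x, hyp (-1) x -> hyp (-1) (L' x)) ->
  cancel L L' -> cancel L' L -> (forall x y, lor (L x) (L y) = lor x y) ->
  isometryHH (second_map L).
Proof.
move=> hL hL' LK LK' mL; split; first exact: second_map_selfmap.
  exists (second_map L'); split; first exact: second_map_selfmap.
  - by move=> [p1 p2] _; rewrite /second_map /= LK.
  - by move=> [p1 p2] _; rewrite /second_map /= LK'.
move=> p u z _ _ _; rewrite -[RHS]/(lor u.1 z.1 + lor u.2 z.2) -(mL u.2 z.2).
have dE w : 'd (second_map L) p w = second_map L w by rewrite diff_second_map.
exact: (congr2 metricHH (dE u) (dE z)).
Qed.

Section Diagonal.
Context {R : realType} {S : surface R}.
Local Notation E := ('rV[R]_3 * 'rV[R]_3)%type.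

Lemma diagonalHHP (z : E) : diagonalHH z <-> z.1 = z.2 /\ hyp (-1) z.1.
Proof.
have s2 : Num.sqrt (2 : R) != 0 by rewrite gt_eqF // sqrtr_gt0.
have s0 : (0 : R) < (Num.sqrt 2)^-1 by rewrite invr_gt0 sqrtr_gt0.
split=> [[x [hx x0] <-] /=|[e /hypN1P[h h0]]].
  split=> //; apply/hypN1P; split; last by rewrite mxE mulr_gt0.
  rewrite lorZl lorZr hx mulrA -invfM -expr2 sqr_sqrtr // invrN invrK mulrN mulVf //.
exists (Num.sqrt 2 *: z.1); last first.
  by rewrite scalerA mulVf // scale1r {2}e -surjective_pairing.
split; last by rewrite mxE mulr_gt0 // sqrtr_gt0.
by rewrite lorZl lorZr h mulrA -expr2 sqr_sqrtr // invrN invrK mulrN1.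
Qed.

Variables (Phi : S -> E) (Phi_imm : immersionHH Phi) (Phi_lag : lagrangian Phi).
Variables (Gam : S -> R) (Gam_Phi : associated_function Phi Gam).
Hypothesis Gam_max : forall p, Gam p ^+ 2 = 4^-1.

Let iso c x w z (ac : atlas c) (Ux : chart_img c x) :=
  associated_function_max Phi_imm Phi_lag Gam_Phi ac Ux (Gam_max (chart_inv c x)) w z.

(** When g1 = g2 the metric g1 is nondegenerate, so phi1 is an immersion between
    surfaces. The two space coordinates are a global chart of the hyperbolic
    plane; in this chart phi1 has injective differential and is therefore
    open. *)
Lemma first_component_open (p : S) :
  nbhs (Phi p).1 [set y | hyp (-1) y -> exists q, (Phi q).1 = y].
Proof.
have [c [x0 [ac Ux0 <-]]] := surface_point p.
have pa := chart_patch Phi_imm Phi_lag ac.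
set f1 := chart_fst Phi c in pa; have oU := patch_open pa.
(* lift ord0 skips the time coordinate. *)
pose g (j : 'I_2) x := f1 x 0 (lift ord0 j).
have sg j : smooth_on (chart_img c) (g j) by exact: smooth_entry oU (patch_smooth1 pa).
have dinj x : chart_img c x -> injective ('d (row_of g) x).
  move=> Ux; apply: raddf_inj => u e0.
  have ej j : 'd f1 x u 0 (lift ord0 j) = 0.
    have df := patch_diff1 pa Ux; rewrite -(deriveE _ df).
    apply: etrans (esym (derive_entry u 0 (lift ord0 j) df)) _.
    by apply: etrans (esym (diff_row_of oU sg u j Ux)) _; rewrite e0 mxE.
  have a1 : 'd f1 x u 0 1 = 0.
    by rewrite (_ : 1 = lift ord0 (0 : 'I_2)) ?ej //; exact: val_inj.
  have a2 : 'd f1 x u 0 2%:R = 0.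
    by rewrite (_ : 2%:R = lift ord0 (1 : 'I_2)) ?ej //; exact: val_inj.
  have t := patch_tangent1 pa u Ux.
  have l0 : lor ('d f1 x u) ('d f1 x u) = 0.
    have := tangent_norm (patch_lor1 pa Ux) t.
    rewrite a1 a2 !mulr0 subrr expr0n /= !addr0 => /eqP; rewrite mulf_eq0.
    by rewrite gt_eqF ?hyp_coord0_sq ?(patch_lor1 pa Ux) //= => /eqP.
  apply: (patch_immersion pa Ux); first exact: (tangent_eq0 (patch_lor1 pa Ux) t l0).
  apply: (tangent_eq0 (patch_lor2 pa Ux) (patch_tangent2 pa _ Ux)).
  by rewrite -(iso u u ac Ux).
have [r [m [r0 m0 BU low]]] := local_lower_bound oU (smooth_row_of oU sg) Ux0 (dinj x0 Ux0).
have [e e0 He] := local_open_map r0 m0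
  (fun x Bx => smooth_on_differentiable (smooth_row_of oU sg) (BU x Bx))
  (fun x Bx => dinj x (BU x Bx)) low.
apply/nbhs_ballP; exists e => //= w Bw hw.
have Bz : ball (row_of g x0) e (\row_j w 0 (lift ord0 j)).
  rewrite -ball_normE /ball_ /=; apply: normr_row_lt => // j; rewrite !mxE.
  move: Bw; rewrite -ball_normE /ball_ /= => Bw; apply: le_lt_trans Bw.
  by have := normr_entry_le (f1 x0 - w) (lift ord0 j); rewrite !mxE.
have [x Bx Ex] := He _ Bz.
exists (chart_inv c x).
have ex j : f1 x 0 (lift ord0 j) = w 0 (lift ord0 j).
  by have /rowP/(_ j) := Ex; rewrite !mxE.
apply: (hyp_fst_eq (patch_hyp1 pa (BU x Bx)) hw).
  by have := ex 0; rewrite (_ : lift ord0 0 = 1) //; exact: val_inj.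
by have := ex 1; rewrite (_ : lift ord0 1 = 2%:R) //; exact: val_inj.
Qed.

Lemma nearby_congruence (p : S) : exists p1 a1 b1 p2 a2 b2, [/\ oframe p1 a1 b1,
    oframe p2 a2 b2, hyp (-1) p1, hyp (-1) p2 &
    exists V : set S, [/\ open V, V p &
     forall q, V q -> (Phi q).2 = frame_map p1 a1 b1 p2 a2 b2 (Phi q).1]].
Proof.
have [c [x0 [ac Ux0 px]]] := surface_point p.
have pa := chart_patch Phi_imm Phi_lag ac.
have /nbhs_ballP[r /= r0 BU] : nbhs x0 (chart_img c).
  by apply: open_nbhs_nbhs; split=> //; exact: patch_open pa.
have Bx0 : ball x0 r x0 by exact: ballxx.
have [p1 [a1 [b1 [p2 [a2 [b2 [fr1 fr2 h1 h2 C]]]]]]] :=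
  local_congruence pa (fun x w z Ux => iso w z ac Ux) BU Bx0.
exists p1, a1, b1, p2, a2, b2; split=> //.
exists (chart_dom c `&` chart_map c @^-1` ball x0 r); split.
- by apply: chart_preimage_open; exact: ball_open.
- by rewrite -px; split; [exact: chart_inv_dom|rewrite /= chart_invK].
- move=> q [Dq Bq]; have := C _ Bq.
  by rewrite /chart_fst /chart_snd /= chart_mapK.
Qed.

Lemma congruence_unique (V : set S) (q : S) (L L' : {linear 'rV[R]_3 -> 'rV[R]_3}) :
  open V -> V q -> (forall s, V s -> L (Phi s).1 = L' (Phi s).1) -> L =1 L'.
Proof.
move=> oV Vq LL; have [c [x0 [ac Ux0 qx]]] := surface_point q.
have pa := chart_patch Phi_imm Phi_lag ac.
apply: (image_determines pa (fun x w z Ux => iso w z ac Ux)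
   (W := chart_img c `&` chart_inv c @^-1` V) (x := x0)).
- exact: chart_inv_preimage_open.
- by move=> x [].
- by split=> //=; rewrite qx.
- by move=> x [_ Vx]; exact: LL.
Qed.

(** The points near which phi2 = L0 phi1 form an open set; it is closed because two
    local congruences that agree on a nonempty open set are equal. *)
Lemma global_congruence (p0 : S) : connected [set: S] ->
  exists p1 a1 b1 p2 a2 b2, [/\ oframe p1 a1 b1,
    oframe p2 a2 b2, hyp (-1) p1, hyp (-1) p2 &
    forall q, (Phi q).2 = frame_map p1 a1 b1 p2 a2 b2 (Phi q).1].
Proof.
move=> conn; have [p1 [a1 [b1 [p2 [a2 [b2 [fr1 fr2 h1 h2 [V0 [oV0 V0p E0]]]]]]]]] :=
  nearby_congruence p0.
exists p1, a1, b1, p2, a2, b2; split=> // q.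
set L0 := frame_map p1 a1 b1 p2 a2 b2 in E0 *.
pose B : set S := [set p | exists V : set S, [/\ open V, V p &
  forall s, V s -> (Phi s).2 = L0 (Phi s).1]].
have oB : open B.
  rewrite openE => p [V [oV Vp E]]; rewrite /interior.
  have : nbhs p V by exact: open_nbhs_nbhs.
  by apply: filterS => s Vs; exists V.
have cB : closed B.
  move=> p clp.
  have [p1' [a1' [b1' [p2' [a2' [b2' [_ _ _ _ [V [oV Vp E]]]]]]]]] := nearby_congruence p.
  have [s [[V' [oV' V's E']] Vs]] := clp V (open_nbhs_nbhs (conj oV Vp)).
  exists V; split=> // t Vt; rewrite (E t Vt).
  apply: (congruence_unique (V := V `&` V') (q := s)
    (L := frame_map p1' a1' b1' p2' a2' b2') (L' := frame_map p1 a1 b1 p2 a2 b2)).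
  - exact: openI.
  - by split.
  - by move=> t' [Vt' V't']; exact: (etrans (esym (E t' Vt')) (E' t' V't')).
have BT : B = [set: S].
  apply: conn; first by exists p0; exists V0.
    by exists B => //; rewrite setTI.
  by exists B => //; rewrite setTI.
have [V [_ Vq E]] : B q by rewrite BT.
exact: E.
Qed.

Lemma max_associated_function_diagonal : connected [set: S] ->
  exists F : E -> E, [/\ isometryHH F, holomorphicHH F &
    open_part (F @` range Phi) diagonalHH].
Proof.
move=> conn.
(* The empty surface has no point at which a congruence could be based; its image
   is the empty part of the diagonal. *)
have [[p0 _]|S0] := pselect ([set: S] !=set0); last first.
  exists (second_map idfun); split.
  - by apply: (second_map_isometry (L := idfun) (L' := idfun)).
  - by apply: second_map_holomorphic.
  - exists set0; first exact: open0.
    rewrite set0I; apply/seteqP; split=> // z [_ [p _ _] _].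
    by case: S0; exists p.
have [p1 [a1 [b1 [p2 [a2 [b2 [fr1 fr2 h1 h2 C]]]]]]] := global_congruence p0 conn.
pose L : {linear 'rV[R]_3 -> 'rV[R]_3} := frame_map p2 a2 b2 p1 a1 b1.
pose L' : {linear 'rV[R]_3 -> 'rV[R]_3} := frame_map p1 a1 b1 p2 a2 b2.
have FE q : second_map L (Phi q) = ((Phi q).1, (Phi q).1).
  by rewrite /second_map C; congr pair; exact: (frame_mapK fr1 fr2).
exists (second_map L); split.
- apply: (second_map_isometry (L' := L')).
  + by move=> x; exact: (frame_map_hyp fr2 fr1 h2 h1).
  + by move=> x; exact: (frame_map_hyp fr1 fr2 h1 h2).
  + by move=> x; exact: (frame_mapK fr2 fr1).
  + by move=> x; exact: (frame_mapK fr1 fr2).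
  + by move=> x y; exact: (frame_map_lor fr2 fr1).
- by apply: second_map_holomorphic => x y; exact: (frame_map_lcross fr2 fr1).
- pose T : set 'rV[R]_3 := [set y | hyp (-1) y -> exists q, (Phi q).1 = y].
  exists (fst @^-1` (interior T)).
    apply: open_comp; last exact: open_interior.
    by move=> z _; exact: fst_continuous.
  apply/seteqP; split=> [z [_ [q _ <-] <-]|z [Tz /diagonalHHP[e hz]]].
    rewrite FE; split; first exact: first_component_open.
    by apply/diagonalHHP; split=> //; have [_ hP _] := Phi_imm; exact: (hP q).1.
  have [q qz] := interior_subset Tz hz.
  exists (Phi q); first by exists q.
  by rewrite FE qz {2}e -surjective_pairing.
Qed.

End Diagonal.

(** * Maps into the trace of a regular curve *)

(** Completeness as a uniform space is what the theorem of Baire requires of the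
    plane. *)
HB.instance Definition _ (R : realType) m n :=
  Uniform_isComplete.Build 'M[R]_(m, n) (@mx_complete R m n).

Lemma derive_real (R : realType) (W : normedModType R) (f : R -> W) (z h : R) :
  differentiable f z -> 'D_h f z = h *: 'D_1 f z.
Proof. by move=> df; rewrite !(deriveE _ df) -linearZ /= [_ *: _]mulr1. Qed.

Section CurvePieces.
Context {R : realType}.
Variables (I : set R) (oI : open I) (beta : R -> 'rV[R]_3).
Hypothesis sb : smooth_on I beta.

(** An index of an entry, the rational end points of an interval and an integer
    constant: a countable type, so that the corresponding pieces of the curve
    form a countable family. *)
Definition piece_code : Type := ('I_3 * (rat * rat) * nat)%type.

Definition controlled_piece (c : piece_code) : Prop :=
  let: (i, (q1, q2), k) := c in
  (forall t, ratr q1 <= t <= ratr q2 -> I t) /\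
  (forall t t' j, ratr q1 <= t <= ratr q2 -> ratr q1 <= t' <= ratr q2 ->
    `|beta t 0 j - beta t' 0 j| <= k%:R * `|beta t 0 i - beta t' 0 i|).

Definition piece_image (c : piece_code) : set 'rV[R]_3 :=
  [set y | controlled_piece c /\
    exists2 t, ratr c.1.2.1 <= t <= ratr c.1.2.2 & beta t = y].

Lemma piece_image_closed c : closed (piece_image c).
Proof.
have [good|bad] := pselect (controlled_piece c); last first.
  have -> : piece_image c = set0 by apply/seteqP; split=> // y [].
  exact: closed0.
case: c good => [[i [q1 q2]] k] good; have [gI _] := good.
have -> : piece_image (i, (q1, q2), k) = beta @` `[ratr q1, ratr q2].
  apply/seteqP; split=> [y [_ [t tq <-]]|y [t tq <-]].
    by exists t => //=; rewrite in_itv.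
  by split=> //; exists t => //; move: tq; rewrite /= in_itv.
apply: compact_closed; first exact: norm_hausdorff.
apply: continuous_compact; last exact: segment_compact.
apply: continuous_in_subspaceT => t; rewrite inE /= in_itv /= => tq.
by apply: differentiable_continuous; apply: smooth_on_differentiable sb (gI t tq).
Qed.

(** At t0 some entry of the velocity is nonzero. On a small interval it stays at
    least half as large while the other entries stay bounded, and the mean value
    theorem compares the variations of the entries. *)
Lemma controlled_piece_exists t0 : I t0 -> 'D_1 beta t0 != 0 ->
  exists2 c, controlled_piece c & ratr c.1.2.1 <= t0 <= ratr c.1.2.2.
Proof.
move=> It0 nz.
have [i ni] := entry_neq0 nz.
pose b j t := beta t 0 j.
have sbj j : smooth_on I (b j) by exact: smooth_entry.
have dbj j t : I t -> differentiable (b j) t by exact: smooth_on_differentiable.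
pose d j := 'D_1 (b j).
have cd j : {for t0, continuous (d j)}.
  apply: differentiable_continuous; apply: smooth_on_differentiable It0.
  exact: smooth_on_derive.
have di : d i t0 != 0 by rewrite /d derive_entry //; exact: smooth_on_differentiable sb It0.
pose m := `|d i t0| / 2.
have m0 : 0 < m by rewrite divr_gt0 // normr_gt0.
have nd : \forall t \near t0, forall j, `|d j t0 - d j t| < m.
  apply: (@filter_forall _ _ _ _ (nbhs_filter t0)) => j.
  by have /cvgrPdist_lt/(_ _ m0) := cd j.
have /nbhs_ballP[e /= e0 He] : nbhs t0 [set t | I t /\ forall j, `|d j t0 - d j t| < m].
  by apply: filterI => //; exact: open_nbhs_nbhs.
have lo t : ball t0 e t -> m <= `|d i t|.
  move=> /He[_ /(_ i) h]; have : `|d i t0| <= m + `|d i t|.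
    rewrite -[d i t0](subrK (d i t)); apply: le_trans (ler_normD _ _) _.
    by rewrite lerD2r ltW.
  by rewrite {1}(splitr `|d i t0|) -/m lerD2l.
pose M := \sum_j `|d j t0| + m.
have hi j t : ball t0 e t -> `|d j t| <= M.
  move=> /He[_ /(_ j) h]; rewrite -[d j t](subKr (d j t0)).
  apply: le_trans (ler_normB _ _) _; rewrite lerD ?(ltW h) //.
  by rewrite (bigD1 j) //= lerDl sumr_ge0.
have [k kP] : exists k : nat, M <= k%:R * m.
  exists (Num.truncn (M / m)).+1; rewrite -ler_pdivrMr //; apply: ltW.
  exact: truncnS_gt.
have mv j t t' : ball t0 e t -> ball t0 e t' ->
    exists2 z, ball t0 e z & b j t - b j t' = (t - t') * d j z.
  move=> Bt Bt'.
  have [z Bz E] := mean_value_ball (fun z Bz => dbj j z (He z Bz).1) Bt' Bt.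
  by exists z => //; rewrite E (derive_real _ (dbj j z (He z Bz).1)).
have lt1 : t0 - e < t0 by rewrite gtrBl.
have lt2 : t0 < t0 + e by rewrite ltrDl.
have [q1] := rat_in_itvoo lt1; rewrite in_itv /= => /andP[q1l q1r].
have [q2] := rat_in_itvoo lt2; rewrite in_itv /= => /andP[q2l q2r].
have inB t : ratr q1 <= t <= ratr q2 -> ball t0 e t.
  move=> /andP[l u]; rewrite -ball_normE /ball_ /= distrC ltr_distl.
  by rewrite (lt_le_trans q1l l) (le_lt_trans u q2r).
exists (i, (q1, q2), k); last by rewrite /= !ltW.
split=> [t tq|t t' j tq tq']; first exact: (He t (inB t tq)).1.
have [z Bz Ez] := mv j t t' (inB t tq) (inB t' tq').
have [z' Bz' Ez'] := mv i t t' (inB t tq) (inB t' tq').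
rewrite -/(b j t) -/(b j t') -/(b i t) -/(b i t') Ez Ez' !normrM mulrCA.
rewrite ler_wpM2l //; apply: le_trans (hi j z Bz) _.
by apply: le_trans kP _; rewrite ler_wpM2l // lo.
Qed.

End CurvePieces.

Section RankDrop.
Context {R : realType}.

(** Difference quotients inherit the bound, and it passes to the limit. *)
Lemma derive_entry_bound (V : normedModType R) (f : V -> 'rV[R]_3) (O : set V) x w
    (i j : 'I_3) (k : R) : open O -> O x -> differentiable f x ->
  (forall x', O x' -> `|f x' 0 j - f x 0 j| <= k * `|f x' 0 i - f x 0 i|) ->
  `|('D_w f x) 0 j| <= k * `|('D_w f x) 0 i|.
Proof.
move=> oO Ox df fk.
have cv l : (fun h => h^-1 *: (((fun y => f y 0 l) \o shift x) (h *: w) - f x 0 l)) @ 0^'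
    --> ('D_w f x) 0 l.
  rewrite -(derive_entry w 0 l df).
  by apply: diff_derivable; exact: differentiable_entry.
apply: (ler_cvg_to (cvg_norm (cv j)) (cvgMl_tmp (a := k) (cvg_norm (cv i)))).
have nO : \forall h \near (0 : R)^', O (h *: w + x).
  apply: (nbhs_dnbhs (x := 0 : R)).
  have cs : {for (0 : R), continuous (fun h : R => h *: w + x)}.
    apply: continuousD; last exact: cst_continuous.
    exact: scalel_continuous.
  by apply: cs; rewrite scale0r add0r; exact: open_nbhs_nbhs.
near=> h; rewrite !normrZ mulrCA ler_wpM2l //=.
by apply: fk; near: h.
Unshelve. all: by end_near. Qed.

(** The combination of a and b that kills the entry i vanishes, so a and b are
    dependent. *)
Lemma gram_of_dependent (a b : 'rV[R]_3) (i : 'I_3) (A : R -> R -> 'rV[R]_3) :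
  (forall s t, A s t = s *: a + t *: b) ->
  (forall s t, A s t 0 i = 0 -> A s t = 0) -> gram a b = 0.
Proof.
move=> AE A0.
have e : A (b 0 i) (- a 0 i) = 0 by apply: A0; rewrite AE !mxE; ring.
have [ai|ai] := eqVneq (a 0 i) 0.
  have a0 : a = 0.
    by have := A0 1 0; rewrite AE scale1r scale0r addr0 => ->.
  by rewrite /gram a0 !lor0l; ring.
have bE : b = (b 0 i / a 0 i) *: a.
  move: e; rewrite AE scaleNr => /subr0_eq e; apply: (scalerI ai).
  by rewrite scalerA mulrC divfK // -e.
by rewrite /gram bE !(lorZl, lorZr); ring.
Qed.

Variables (I : set R) (oI : open I) (beta : R -> 'rV[R]_3).
Hypothesis sb : smooth_on I beta.
Hypothesis regular : forall t, I t -> 'D_1 beta t != 0.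
Variables (U : set 'rV[R]_2) (oU : open U) (f : 'rV[R]_2 -> 'rV[R]_3).
Hypothesis sf : smooth_on U f.
Hypothesis fI : forall x, U x -> exists2 t, I t & beta t = f x.

(** The values of f lie in countably many closed pieces of the curve, so by the
    theorem of Baire some piece contains the values of f on a nonempty open
    subset of the ball. There one entry of f controls the others, and so it does
    for the differential, whose rank is at most 1. *)
Lemma rank_drop_somewhere (x0 : 'rV[R]_2) (r : R) : 0 < r -> closed_ball x0 r `<=` U ->
  exists2 x, closed_ball x0 r x & forall w z, gram ('d f x w) ('d f x z) = 0.
Proof.
move=> r0 BU.
pose C c : set 'rV[R]_2 := closed_ball x0 r `&` f @^-1` piece_image I beta c.
have cC c : closed (C c).
  move=> x clx.
  have Bx : closed_ball x0 r x.
    apply: (closed_ball_closed (x := x0) (r := r)); apply: closure_subset clx.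
    by move=> y [].
  split=> //=; apply: contrapT => nK.
  have oK : open (~` piece_image I beta c) by apply: closed_openC; exact: piece_image_closed.
  have cf : {for x, continuous f}.
    by apply: differentiable_continuous; apply: smooth_on_differentiable sf (BU _ Bx).
  have nb : nbhs x (f @^-1` (~` piece_image I beta c)).
    by apply: cf; exact: open_nbhs_nbhs.
  by have [y [[_ Ky]]] := clx _ nb.
(* If all these open sets were dense they would have a common point in the ball,
   whose value would lie on no piece. *)
pose F n : set 'rV[R]_2 := if unpickle n is Some c then ~` C c else setT.
have oF n : open (F n).
  by rewrite /F; case: unpickle => [c|]; [exact: closed_openC|exact: openT].
have [n nd] : exists n, ~ dense (F n).
  apply: contrapT => h.
  have dF n : open (F n) /\ dense (F n).
    by split=> //; apply: contrapT => nd; apply: h; exists n.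
  have [x [Bx Fx]] := Baire dF (ex_intro _ x0 (ballxx x0 r0)) (ball_open x0 r).
  have Bx' := subset_closed_ball Bx.
  have [t It bt] := fI (BU _ Bx').
  have [c good tc] := controlled_piece_exists oI sb It (regular It).
  have := Fx (pickle c) Logic.I; rewrite /F pickleK; apply.
  by split=> //=; split=> //; exists t.
have [Q [[x [oO Ox]] disj]] := denseNE nd.
move: disj; rewrite /F; case: unpickle => [c|]; last first.
  by rewrite setIT => /seteqP[/(_ x Ox)].
move=> /seteqP[OC _].
have inC y : Q y -> C c y.
  by move=> Oy; apply: contrapT => nC; apply: (OC y).
have [Bx _] := inC x Ox.
exists x => // w z; have df := smooth_on_differentiable sf (BU _ Bx).
case: c {OC} inC => [[i [q1 q2]] k] inC.
have bound x' : Q x' -> forall j, `|f x' 0 j - f x 0 j| <= k%:R * `|f x' 0 i - f x 0 i|.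
  move=> Ox' j; have [_ [good [t tq bt]]] := inC x Ox.
  have [_ [_ [t' tq' bt']]] := inC x' Ox'.
  by rewrite -bt -bt'; exact: good.2.
apply: (@gram_of_dependent _ _ i (fun s t => 'd f x (s *: w + t *: z))).
  by move=> s t; rewrite linearD !linearZ.
move=> s t; rewrite -(deriveE _ df) => e; apply/rowP => j; rewrite mxE.
have := derive_entry_bound (s *: w + t *: z) oO Ox df (fun x' Ox' => bound x' Ox' j).
by rewrite e normr0 mulr0 normr_le0 => /eqP.
Qed.

(** Otherwise the Gram determinant would be nonzero on a ball, contradicting
    [rank_drop_somewhere]. *)
Lemma rank_drop_everywhere x w z : U x -> gram ('d f x w) ('d f x z) = 0.
Proof.
move=> Ux; apply/eqP; apply: contrapT => /negP nz.
pose G y := gram ('D_w f y) ('D_z f y).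
have dG : {for x, continuous G}.
  have dw := smooth_on_differentiable (smooth_on_derive w sf) Ux.
  have dz := smooth_on_differentiable (smooth_on_derive z sf) Ux.
  have cww := differentiable_continuous (differentiable_lor dw dw).
  have czz := differentiable_continuous (differentiable_lor dz dz).
  have cwz := differentiable_continuous (differentiable_lor dw dz).
  exact: (cvgB (cvgM cww czz) (cvgM cwz cwz)).
have GE y : U y -> G y = gram ('d f y w) ('d f y z).
  by move=> Uy; have df := smooth_on_differentiable sf Uy; rewrite /G !(deriveE _ df).
have Gx : G x != 0 by rewrite GE.
have nG : nbhs x (G @^-1` [set g | g != 0]).
  by apply: dG; apply: open_nbhs_nbhs; split; [exact: open_neq|].
have nU : nbhs x U by exact: open_nbhs_nbhs.
have /nbhs_ballP[r /= r0 Br] : nbhs x (U `&` G @^-1` [set g | g != 0]).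
  exact: filterI.
have r2 : 0 < r / 2 by rewrite divr_gt0.
have sub := subset_closure_half (x := x) r0.
have [y By gy] := rank_drop_somewhere r2 (fun y By => (Br y (sub y By)).1).
have := (Br y (sub y By)).2; rewrite /= GE ?gy ?eqxx //.
exact: (Br y (sub y By)).1.
Qed.

End RankDrop.

(** * Inverse functions and arc length on the line *)

Section InverseFunction.
Context {R : realType} (a b : R) (f : R -> R).
Local Notation I := (`]a, b[%classic : set R).
Hypothesis sf : smooth_on I f.
Hypothesis f' : forall t, I t -> 0 < 'D_1 f t.

Let df t : I t -> differentiable f t.
Proof. exact: smooth_on_differentiable. Qed.

Let oI : open I. Proof. exact: itv_open. Qed.

Let seg t t' s : I t -> I t' -> t <= s <= t' -> I s.
Proof.
rewrite /= !in_itv /= => /andP[at_ _] /andP[_ tb] /andP[ts st].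
by rewrite (lt_le_trans at_ ts) (le_lt_trans st tb).
Qed.

Lemma positive_derivative_mono t t' : I t -> I t' -> t < t' -> f t < f t'.
Proof.
move=> It It' tt'.
have inI (s : R) : 0 <= s <= 1 -> I (t + s *: (t' - t)).
  move=> /andP[s0 s1]; apply: (seg It It').
  have d0 : 0 <= t' - t by rewrite subr_ge0 ltW.
  rewrite lerDl mulr_ge0 //= -lerBrDl; exact: ler_piMl.
have [s /andP[/ltW s0 /ltW s1]] := mean_value_segment (fun s s01 => df (inI s s01)).
have Is : I (t + s *: (t' - t)) by apply: inI; rewrite s0.
rewrite addrCA subrr addr0 (derive_real _ (df Is)) => e.
by rewrite -subr_gt0 e mulr_gt0 ?subr_gt0 // f'.
Qed.

Let fcont t t' : I t -> I t' -> {within `[t, t'], continuous f}.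
Proof.
move=> It It'; apply: continuous_in_subspaceT => s; rewrite inE /= in_itv /= => st.
exact: differentiable_continuous (df (seg It It' st)).
Qed.

Lemma image_between t t' s : I t -> I t' -> t <= t' -> f t <= s <= f t' -> (f @` I) s.
Proof.
move=> It It' tt' fs.
have fm : f t <= f t' by case/andP: fs => h1 h2; exact: le_trans h1 h2.
have [|u] := IVT tt' (fcont It It') (v := s).
  by rewrite (min_idPl fm) (max_idPr fm).
by rewrite in_itv /= => tu <-; exists u => //; exact: seg It It' tu.
Qed.

(** The derivative of the inverse g is the composite of 1 / f' with g, so smoothness
    follows by induction on the order; f' being positive, 1 / f' is the square of
    the smooth function f'^(-1/2). *)
Lemma smooth_inverse : exists g : R -> R,
  [/\ open (f @` I), is_interval (f @` I), smooth_on (f @` I) g &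
   forall t, I t -> g (f t) = t].
Proof.
have oJ : open (f @` I).
  rewrite openE => _ [t It <-]; rewrite /interior.
  have /nbhs_ballP[d /= d0 Bd] : nbhs t I by exact: open_nbhs_nbhs.
  have d2 : 0 < d / 2 by rewrite divr_gt0.
  have B1 : I (t - d / 2).
    apply: Bd; rewrite -ball_normE /ball_ /= opprB addrC subrK gtr0_norm //.
    by rewrite ltr_pdivrMr // ltr_pMr // ltr1n.
  have B2 : I (t + d / 2).
    apply: Bd; rewrite -ball_normE /ball_ /= opprD addNKr normrN gtr0_norm //.
    by rewrite ltr_pdivrMr // ltr_pMr // ltr1n.
  have l1 : f (t - d / 2) < f t by apply: positive_derivative_mono => //; rewrite gtrBl.
  have l2 : f t < f (t + d / 2) by apply: positive_derivative_mono => //; rewrite ltrDl.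
  have : nbhs (f t) `](f (t - d / 2)), (f (t + d / 2))[%classic.
    by apply: open_nbhs_nbhs; split; [exact: itv_open|rewrite /= in_itv /= l1 l2].
  apply: filterS => s; rewrite /= in_itv /= => /andP[s1 s2].
  apply: (image_between B1 B2); last by rewrite !ltW.
  by rewrite lerD2l ge0_cp // ltW.
have iJ : is_interval (f @` I).
  move=> _ _ [t It <-] [t' It' <-] s fs.
  have [tt'|t't] := leP t t'; first exact: image_between It It' tt' fs.
  have := positive_derivative_mono It' It t't.
  by case/andP: fs => h1 h2; rewrite ltNge (le_trans h1 h2).
have [g gP] : exists g : R -> R, forall s, (f @` I) s -> I (g s) /\ f (g s) = s.
  have /choice[g gP] : forall s, exists t, (f @` I) s -> I t /\ f t = s.
    move=> s; have [[t It <-]|nJ] := pselect ((f @` I) s); first by exists t.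
    by exists a => /nJ.
  by exists g.
exists g.
have gK t : I t -> g (f t) = t.
  move=> It; have [Ig fg] := gP (f t) (ex_intro2 _ _ t It erefl).
  have [h|h|//] := ltgtP (g (f t)) t.
    by have := positive_derivative_mono Ig It h; rewrite fg ltxx.
  by have := positive_derivative_mono It Ig h; rewrite fg ltxx.
split=> //.
have dg s : (f @` I) s -> is_derive s (1 : R) g ('D_1 f (g s))^-1.
  move=> [t It <-]; rewrite gK //.
  have nI : nbhs t I by exact: open_nbhs_nbhs.
  apply: is_derive_inverse.
  - by apply: filterS nI => u; exact: gK.
  - by apply: filterS nI => u Iu; exact: differentiable_continuous (df Iu).
  - by apply: DeriveDef => //; exact: diff_derivable (df It).
  - by rewrite gt_eqF // f'.
have sq : smooth_on I (fun t => (Num.sqrt ('D_1 f t))^-1 * (Num.sqrt ('D_1 f t))^-1).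
  by apply: smoothM => //; apply: smooth_rsqrt => //; exact: smooth_on_derive.
apply/smooth_onP; elim=> //= n IH; split=> [s Js|v].
  by apply/derivable1_diffP; have [] := dg s Js.
have C : Cn n (f @` I) (fun s => (fun=> v) s *:
   ((fun t => (Num.sqrt ('D_1 f t))^-1 * (Num.sqrt ('D_1 f t))^-1) \o g) s).
  apply: CnZ => //; first exact: Cn_cst.
  apply: (Cn_comp_real oJ (J := I)) => //; first by move=> s /gP[].
  exact: (smooth_onP _ _).1 sq n.
apply: eq_Cn C => // s; rewrite inE => Js /=.
have [d1 d2] := dg s Js.
rewrite (derive_real v); last exact/derivable1_diffP.
rewrite d2 -expr2 exprVn sqr_sqrtr // ltW // f' //.
exact: (gP s Js).1.
Qed.

End InverseFunction.

Section Antiderivative.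
Context {R : realType} (a b : R) (s : R -> R).
Hypothesis cs : forall t, a <= t <= b -> {for t, continuous s}.

Lemma antiderivative : exists F : R -> R, forall t, a < t < b ->
  is_derive t (1 : R) F (s t).
Proof.
exists (fun x => (\int[lebesgue_measure]_(t in `[a, x]) s t)%R).
move=> t /andP[at_ tb].
have int : lebesgue_measure.-integrable `[a, b] (EFin \o s).
  apply: continuous_compact_integrable; first exact: segment_compact.
  apply: continuous_in_subspaceT => u; rewrite inE /= in_itv /=; exact: cs.
have ct : {for t, continuous s} by apply: cs; rewrite !ltW.
have [d E] := continuous_FTC1_closed tb int at_ ct.
by apply: DeriveDef; [exact: d|rewrite -derive1E; exact: E].
Qed.

End Antiderivative.

Section ArcLength.
Context {R : realType} (eta : R) (eta0 : 0 < eta) (b : R -> 'rV[R]_3).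
Local Notation K := (`](- eta), eta[%classic : set R).
Local Notation K' := (`](- (eta / 2)), (eta / 2)[%classic : set R).
Hypothesis sb : smooth_on K b.
Hypothesis hb : forall t, K t -> hyp (-1) (b t).
Hypothesis regular : forall t, K t -> 0 < lor ('D_1 b t) ('D_1 b t).

Let half_lt : eta / 2 < eta.
Proof. by rewrite ltr_pdivrMr // ltr_pMr // ltr1n. Qed.

Let closed_sub t : - (eta / 2) <= t <= eta / 2 -> K t.
Proof.
move=> /andP[l u]; rewrite /= in_itv /= (le_lt_trans u half_lt) andbT.
by apply: lt_le_trans l; rewrite ltrN2.
Qed.

Let sub t : K' t -> K t.
Proof. by rewrite /= in_itv /= => /andP[/ltW l /ltW u]; apply: closed_sub; rewrite l u. Qed.

Let oK : open K. Proof. exact: itv_open. Qed.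
Let oK' : open K'. Proof. exact: itv_open. Qed.

(** The speed, written as L L^(-1/2) instead of the root of L so that its
    smoothness is an instance of [smooth_rsqrt]. *)
Let len t := lor ('D_1 b t) ('D_1 b t) * (Num.sqrt (lor ('D_1 b t) ('D_1 b t)))^-1.

Let smooth_len : smooth_on K len.
Proof.
have sL : smooth_on K (fun t => lor ('D_1 b t) ('D_1 b t)).
  by apply: smooth_lor => //; exact: smooth_on_derive.
by apply: smoothM => //; exact: smooth_rsqrt.
Qed.

Let len_sq t : K t -> len t ^+ 2 = lor ('D_1 b t) ('D_1 b t).
Proof.
move=> /regular L0; rewrite exprMn exprVn sqr_sqrtr ?ltW // expr2 mulfK //.
by rewrite gt_eqF.
Qed.

Let len_gt0 t : K t -> 0 < len t.
Proof. by move=> /regular L0; rewrite mulr_gt0 // invr_gt0 sqrtr_gt0. Qed.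

(** The arc length sigma is an antiderivative of the speed and has a smooth inverse
    g; the velocity of b o g has length 1 because sigma' is the speed. The passage
    to the half interval makes the speed continuous up to the end points, as
    needed for integrating it. *)
Lemma arclength_reparametrization : exists (I : set R) (beta : R -> 'rV[R]_3),
  [/\ open_interval I, arclength_curve I beta & beta @` I = b @` K'].
Proof.
have [sigma ds] : exists F : R -> R, forall t, - (eta / 2) < t < eta / 2 ->
    is_derive t (1 : R) F (len t).
  apply: antiderivative => t /closed_sub Kt.
  exact: differentiable_continuous (smooth_on_differentiable smooth_len Kt).
have ds1 t : K' t -> differentiable sigma t.
  by rewrite /= in_itv /= => /ds[d _]; exact/derivable1_diffP.
have ds2 t : K' t -> 'D_1 sigma t = len t.
  by rewrite /= in_itv /= => /ds[_].
have ssig : smooth_on K' sigma.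
  apply/smooth_onP => -[|n] //=; split=> // v.
  have C : Cn n K' (fun t => (fun=> v) t *: len t).
    apply: CnZ => //; first exact: Cn_cst.
    apply: sub_Cn ((smooth_onP _ _).1 smooth_len n) => t; exact: sub.
  apply: eq_Cn C => // t; rewrite inE => Kt.
  by rewrite (derive_real v (ds1 t Kt)) (ds2 t Kt).
have sig' t : K' t -> 0 < 'D_1 sigma t.
  by move=> Kt; rewrite ds2 // len_gt0 //; exact: sub.
have [g [oJ iJ sg gK]] := smooth_inverse ssig sig'.
have gJ u : (sigma @` K') u -> K' (g u) by move=> [t Kt <-]; rewrite gK.
exists (sigma @` K'), (b \o g); split.
- split=> //; exists (sigma 0); exists 0 => //.
  by rewrite /= in_itv /= oppr_lt0 divr_gt0.
- split.
  + apply: (smooth_comp_real (J := K)) => // u /gJ; exact: sub.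
  + by move=> u /gJ/sub; exact: hb.
  + move=> u Ju; have Kg := gJ u Ju.
    have dg := smooth_on_differentiable sg Ju.
    have db := smooth_on_differentiable sb (sub Kg).
    have E : {in sigma @` K', sigma \o g =1 id}.
      by move=> v; rewrite inE => -[t Kt <-] /=; rewrite gK.
    have := derive_eq_in oJ (1 : R) Ju E.
    rewrite (derive_comp_dir (1 : R) dg (ds1 _ Kg)) (derive_real _ (ds1 _ Kg)) ds2 // derive_id.
    move=> e1; rewrite derive1E (derive_comp_dir (1 : R) dg db) (derive_real _ db).
    rewrite lorZl lorZr mulrA -expr2 -len_sq; last exact: sub.
    by rewrite -exprMn (e1 : _ * _ = 1) expr1n.
- apply/seteqP; split=> [_ [u Ju <-]|_ [t Kt <-]].
    by exists (g u) => //; exact: gJ.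
  by exists (sigma t); [exists t|rewrite /= gK].
Qed.

End ArcLength.

(** * Functional dependence *)

Section Dependence.
Context {R : realType}.

Lemma diff_eps (V W : normedModType R) (f : V -> W) x (e : R) : differentiable f x ->
  0 < e -> exists2 d : R, 0 < d & forall h, `|h| < d ->
    `|f (h + x) - f x - 'd f x h| <= e * `|h|.
Proof.
move=> df e0.
have /diff_locally/eqaddoP/(_ e e0) := df.
move=> /nbhs_ballP[d /= d0 H]; exists d => // h hd.
have Bh : ball (0 : V) d h by rewrite -ball_normE /ball_ /= sub0r normrN.
have := H h Bh; rewrite !fctE /=; apply: le_trans.
by rewrite opprD addrA.
Qed.

Lemma diff_lower_bound (V W : normedModType R) (y : V -> W) (x0 x : V) (r m : R) :
  ball x0 r x -> differentiable y x ->
  (forall x', ball x0 r x' -> m * `|x - x'| <= `|y x - y x'|) ->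
  forall w, m * `|w| <= `|'d y x w|.
Proof.
move=> Bx dy low w.
have [->|w0] := eqVneq w 0; first by rewrite linear0 !normr0 mulr0.
apply/ler_addgt0Pl => e e0.
have nw : 0 < `|w| by rewrite normr_gt0.
have e1 : 0 < e / `|w| by rewrite divr_gt0.
have [d d0 H] := diff_eps dy e1.
have /nbhs_ballP[s /= s0 Bs] : nbhs x (ball x0 r).
  by apply: open_nbhs_nbhs; split=> //; exact: ball_open.
have ms0 : 0 < Num.min d s by rewrite lt_min d0 s0.
have [k k0 kwl] : exists2 k : R, 0 < k & `|k *: w| < Num.min d s.
  exists (Num.min d s / (2 * `|w|)); first by rewrite divr_gt0 // mulr_gt0.
  rewrite normrZ gtr0_norm; last by rewrite divr_gt0 // mulr_gt0.
  rewrite invfM mulrA mulfVK; last exact: lt0r_neq0.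
  by rewrite ltr_pdivrMr // ltr_pMr // ltr1n.
move: kwl; rewrite lt_min => /andP[kd ks].
have Bk : ball x0 r (k *: w + x).
  by apply: Bs; rewrite -ball_normE /ball_ /= opprD addrCA subrr addr0 normrN.
have := low _ Bk; rewrite opprD addrCA subrr addr0 normrN => l1.
have l2 := H _ kd.
have : m * `|k *: w| <= e / `|w| * `|k *: w| + `|'d y x (k *: w)|.
  apply: le_trans l1 _; rewrite distrC.
  rewrite -(subrK ('d y x (k *: w)) (y (k *: w + x) - y x)).
  by apply: le_trans (ler_normD _ _) _; rewrite lerD2r.
rewrite linearZ /= !normrZ (gtr0_norm k0) mulrCA [X in _ <= X + _]mulrCA -mulrDr.
by rewrite ler_pM2l // divfK // gt_eqF.
Qed.

(** Let th be the local inverse of y. On the segment from y x to y x', along which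
    the coordinate j is constant, f o th has derivative 0: the increment D of th is
    of the order of h by the lower bound, the coordinate j of 'd y D is an o(h)
    because that coordinate does not move, and it controls 'd f D. This avoids
    differentiability of th. *)
Lemma functional_dependence (n k : nat) (y : 'rV[R]_n -> 'rV[R]_n) (f : 'rV[R]_n -> 'rV[R]_k)
    (x0 : 'rV[R]_n) (r m e : R) (j : 'I_n) : 0 < m ->
  (forall x, ball x0 r x -> differentiable y x) ->
  (forall x, ball x0 r x -> differentiable f x) ->
  (forall x x', ball x0 r x -> ball x0 r x' -> m * `|x - x'| <= `|y x - y x'|) ->
  (forall x, ball x0 r x -> exists C : R, forall w, `|'d f x w| <= C * `|('d y x w) 0 j|) ->
  (forall z, ball (y x0) e z -> exists2 x, ball x0 r x & y x = z) ->
  forall x x', ball x0 r x -> ball x0 r x' -> ball (y x0) e (y x) -> ball (y x0) e (y x') ->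
    y x 0 j = y x' 0 j -> f x = f x'.
Proof.
move=> m0 dy df low ctrl onto x x' Bx Bx' Qx Qx' yj.
have /choice[th thP] : forall z, exists x, ball (y x0) e z -> ball x0 r x /\ y x = z.
  move=> z; have [Qz|nQ] := pselect (ball (y x0) e z); last by exists x0.
  by have [u Bu yu] := onto z Qz; exists u.
have inj u u' : ball x0 r u -> ball x0 r u' -> y u = y u' -> u = u'.
  move=> Bu Bu' yy; have := low u u' Bu Bu'; rewrite yy subrr normr0.
  by rewrite pmulr_rle0 // normr_le0 subr_eq0 => /eqP.
have thK u : ball x0 r u -> ball (y x0) e (y u) -> th (y u) = u.
  by move=> Bu Qu; have [Bt yt] := thP _ Qu; exact: inj.
pose d := y x' - y x; pose z (t : R) := y x + t *: d.
have Qz (t : R) : 0 <= t <= 1 -> ball (y x0) e (z t) by exact: ball_segment.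
have dj : d 0 j = 0 by rewrite !mxE yj subrr.
apply/rowP => i; pose F (t : R) : R := f (th (z t)) 0 i.
have DF (t : R) : 0 <= t <= 1 -> is_derive t (1 : R) F 0.
  move=> /Qz Qt; have [Bu yu] := thP _ Qt.
  set u := th (z t) in Bu yu.
  have [C0 C0P] := ctrl u Bu.
  pose C := `|C0| + 1; have C1 : 0 < C by rewrite ltr_wpDl.
  have CP w : `|'d f u w| <= C * `|('d y u w) 0 j|.
    apply: le_trans (C0P w) _; rewrite ler_wpM2r //.
    by apply: le_trans (ler_norm _) _; rewrite lerDl.
  have L : (fun h : R => h^-1 *: ((F \o shift t) (h *: 1) - F t)) @ 0^' --> (0 : R).
    apply/cvgrPdist_le => a a0.
    (* The factor by which the two approximation errors are multiplied in the end. *)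
    pose B := (1 + C) * (`|d| + 1) / m.
    have d1 : 0 < `|d| + 1 by rewrite ltr_wpDl.
    have B0 : 0 < B by rewrite divr_gt0 // mulr_gt0 // addr_gt0.
    have ep0 : 0 < a / B by rewrite divr_gt0.
    have [s1 s10 H1] := diff_eps (df u Bu) ep0.
    have [s2 s20 H2] := diff_eps (dy u Bu) ep0.
    have nQ : \forall h \near (0 : R)^', ball (y x0) e (z (h + t)).
      apply: (nbhs_dnbhs (x := 0 : R)).
      have cz : {for (0 : R), continuous (fun h : R => z (h + t))}.
        apply: differentiable_continuous.
        have -> : (fun h : R => z (h + t)) = (fun h : R => h *: d) + cst (z t).
          by apply/funext => h; rewrite /z scalerDl addrCA.
        apply: differentiableD; last exact: differentiable_cst.
        exact: ex_diff.
      apply: cz; rewrite add0r; apply: open_nbhs_nbhs; split=> //; exact: ball_open.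
    near=> h.
    have Qh : ball (y x0) e (z (h + t)) by near: h.
    have [Bv yv] := thP _ Qh; set v := th (z (h + t)) in Bv yv.
    have yvu : y v - y u = h *: d.
      have shuffle (p q s : 'rV[R]_n) : p + (q + s) - (p + s) = q.
        by rewrite addrCA addrK.
      by rewrite yv yu /z scalerDl; exact: shuffle.
    pose D := v - u.
    have vD : v = D + u by rewrite subrK.
    have nD : `|D| <= `|h| * (`|d| + 1) / m.
      rewrite ler_pdivlMr // mulrC; apply: le_trans (low v u Bv Bu) _.
      by rewrite yvu normrZ ler_wpM2l // lerDl.
    have small : `|D| < Num.min s1 s2.
      apply: le_lt_trans nD _; rewrite ltr_pdivrMr // -ltr_pdivlMr //.
      near: h; apply: dnbhs0_lt.
      by rewrite divr_gt0 // mulr_gt0 // lt_min s10 s20.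
    move: small; rewrite lt_min => /andP[D1 D2].
    have e2 : `|('d y u D) 0 j| <= a / B * `|D|.
      apply: le_trans (H2 D D2); rewrite -vD yvu.
      have := normr_entry_le (h *: d - 'd y u D) j.
      have -> : (h *: d - 'd y u D) 0 j = - ('d y u D) 0 j.
        by rewrite mxE [X in X + _]mxE dj mulr0 add0r mxE.
      by rewrite normrN.
    have e1 : `|f v - f u| <= (1 + C) * (a / B * `|D|).
      rewrite -(subrK ('d f u D) (f v - f u)); apply: le_trans (ler_normD _ _) _.
      rewrite mulrDl mul1r lerD //; first by rewrite vD; exact: H1.
      by apply: le_trans (CP D) _; rewrite ler_pM2l.
    have h0 : h != 0 by near: h; exact: nbhs_dnbhs_neq.
    rewrite sub0r normrN normrZ normfV ler_pdivrMl ?normr_gt0 //.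
    have -> : (F \o shift t) (h *: 1) = f v 0 i by rewrite /F /= [h *: 1]mulr1.
    have := normr_entry_le (f v - f u) i; rewrite !mxE => /le_trans; apply.
    apply: le_trans e1 _.
    have : a / B * `|D| <= a / B * (`|h| * (`|d| + 1) / m) by rewrite ler_pM2l.
    move=> le1; apply: (@le_trans _ _ ((1 + C) * (a / B * (`|h| * (`|d| + 1) / m)))).
      by rewrite ler_pM2l // addr_gt0.
    have -> : (1 + C) * (a / B * (`|h| * (`|d| + 1) / m)) = `|h| * a * (B / B).
      by rewrite /B; move: B^-1 m^-1 => p q; ring.
    by rewrite divff ?mulr1 // gt_eqF.
  by apply: DeriveDef; [apply/cvg_ex; exists 0|exact: cvg_lim].
have dF (t : R) : 0 <= t <= 1 -> differentiable F ((0 : R) + t *: (1 : R)).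
  by rewrite add0r [t *: (1 : R)]mulr1 => /DF[dd _]; exact/derivable1_diffP.
have [t /andP[/ltW t0 /ltW t1]] := @mean_value_segment R R F 0 1 dF.
have t01 : 0 <= t <= 1 by rewrite t0 t1.
rewrite !add0r [t *: (1 : R)]mulr1; have [_ ->] := DF t t01 => /subr0_eq.
rewrite /F /z scale1r scale0r addr0 addrC subrK thK // thK //.
Unshelve. all: by end_near. Qed.

End Dependence.

(** * Surfaces with vanishing associated function *)

Section DegenerateTangents.
Context {R : realType}.

(** A tangent vector orthogonal to b in the plane of a and b has length 0 when the
    Gram determinant vanishes, so a is a multiple of b. *)
Lemma tangent_dependent (p a b : 'rV[R]_3) (i : 'I_3) :
  lor p p = -1 -> lor p a = 0 -> lor p b = 0 -> gram a b = 0 -> b 0 i != 0 ->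
  a = (a 0 i / b 0 i) *: b.
Proof.
move=> pp pa pb g0 bi.
have bb : lor b b != 0.
  apply/eqP => b0; case/eqP: bi.
  by rewrite (tangent_eq0 pp pb b0) mxE.
pose w := a - (lor a b / lor b b) *: b.
have pw : lor p w = 0 by rewrite lorDr lorNr lorZr pa pb; ring.
have ww : lor w w = 0.
  have -> : lor w w = gram a b / lor b b.
    rewrite /w /gram !(lorDl, lorDr, lorNl, lorNr, lorZl, lorZr) (lorC b a).
    by field.
  by rewrite g0 mul0r.
have /subr0_eq aE := tangent_eq0 pp pw ww.
have -> : a 0 i = lor a b / lor b b * b 0 i by rewrite {1}aE mxE.
by rewrite mulfK.
Qed.

Lemma degenerate_kernel (p : 'rV[R]_3) (A : {linear 'rV[R]_2 -> 'rV[R]_3}) :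
  lor p p = -1 -> (forall w, lor p (A w) = 0) ->
  (forall w z, gram (A w) (A z) = 0) -> exists2 v, v != 0 & A v = 0.
Proof.
move=> pp t g0.
pose e0 : 'rV[R]_2 := delta_mx 0 0; pose e1 : 'rV[R]_2 := delta_mx 0 1.
have [A1|/entry_neq0[i ni]] := eqVneq (A e1) 0.
  exists e1 => //; apply/eqP => /rowP /(_ 1); rewrite !mxE /= => /eqP.
  by rewrite oner_eq0.
have E := tangent_dependent pp (t e0) (t e1) (g0 e0 e1) ni.
exists (e0 - (A e0 0 i / A e1 0 i) *: e1); last by rewrite linearB linearZ /= -E subrr.
apply/eqP => /rowP /(_ 0); rewrite !mxE /= mulr0 subr0 => /eqP.
by rewrite oner_eq0.
Qed.

End DegenerateTangents.

Lemma smooth_line (R : realType) (V W : normedModType R) (U : set V) (f : V -> W) (x v : V) :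
  open [set t : R | U (x + t *: v)] -> smooth_on U f ->
  smooth_on [set t : R | U (x + t *: v)] (fun t : R => f (x + t *: v)).
Proof.
move=> oT /smooth_onP cf; apply/smooth_onP => n.
elim: n f {cf}(cf n) => //= n IH f [df Df]; split=> [t Ut|h].
  by apply/derivable1_diffP; have [] := is_derive_line (df _ Ut).
have C : Cn n [set t : R | U (x + t *: v)] (fun t : R => (fun=> h) t *: 'D_v f (x + t *: v)).
  by apply: CnZ => //; [exact: Cn_cst|exact: (IH ('D_v f) (Df v))].
apply: eq_Cn C => // t; rewrite inE => Ut.
have [d1 d2] := is_derive_line (df _ Ut).
by rewrite (derive_real h) ?d2 //; exact/derivable1_diffP.
Qed.

Section ComponentCurve.
Context {R : realType}.
Variables (U : set 'rV[R]_2) (oU : open U) (f : 'rV[R]_2 -> 'rV[R]_3).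
Hypothesis sf : smooth_on U f.
Hypothesis hf : forall x, U x -> hyp (-1) (f x).
Variables (Y : 'rV[R]_2 -> 'rV[R]_2) (k : 'I_2) (i : 'I_3) (x0 : 'rV[R]_2) (r e : R).
Hypothesis YE : forall x, U x -> Y x 0 k = f x 0 i.
Hypothesis cY : forall x, U x -> {for x, continuous Y}.
Hypotheses (r0 : 0 < r) (e0 : 0 < e) (BU : ball x0 r `<=` U).

(** A curve whose points are values of f at points x near x0, and a set J of values
    of the coordinate k of Y, tied to each other by such points; their Y-images
    stay close to Y x0, so that f can be compared on and off the curve by
    [functional_dependence]. *)
Definition has_curve : Prop :=
  exists (I : set R) (beta : R -> 'rV[R]_3) (J : set R),
  [/\ open_interval I, arclength_curve I beta, open J /\ J (Y x0 0 k),
   forall s, J s -> exists x, [/\ ball x0 r x, ball (Y x0) e (Y x), Y x 0 k = s &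
     exists2 t, I t & beta t = f x] &
   forall t, I t -> exists x, [/\ ball x0 r x, ball (Y x0) e (Y x), J (Y x 0 k) &
     beta t = f x]].

Let Ux0 : U x0. Proof. by apply: BU; exact: ballxx. Qed.

(** The restriction of f to the line through x0 with direction v is a regular curve
    near x0, since its entry i has positive derivative; it can be parametrized by
    arc length. That entry is also the coordinate k of Y, so the coordinates
    reached by the curve fill an open interval J. *)
Lemma component_curve_pos v : 0 < ('d f x0 v) 0 i -> has_curve.
Proof.
move=> vpos.
pose c (t : R) := x0 + t *: v.
have df x : U x -> differentiable f x by exact: smooth_on_differentiable.
have cc : continuous c.
  move=> t; apply: differentiable_continuous; apply: differentiableD.
    exact: differentiable_cst.
  by have [] := is_diff_scalel t v.
have c0 : c 0 = x0 by rewrite /c scale0r addr0.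
pose g x := ('D_v f x) 0 i.
have cg : {for x0, continuous g}.
  apply: differentiable_continuous; apply: differentiable_entry.
  exact: smooth_on_differentiable (smooth_on_derive v sf) Ux0.
have gx0 : 0 < g x0 by rewrite /g (deriveE _ (df _ Ux0)).
have nx0 : nbhs x0 [set x | [/\ ball x0 r x, ball (Y x0) e (Y x) & 0 < g x]].
  have n1 : nbhs x0 (ball x0 r) by exact: nbhsx_ballx.
  have n2 : nbhs x0 (Y @^-1` ball (Y x0) e) by apply: (cY Ux0); exact: nbhsx_ballx.
  have n3 : nbhs x0 (g @^-1` [set s | 0 < s]).
    by apply: cg; apply: open_nbhs_nbhs; split=> //; exact: open_gt.
  by apply: filterS (filterI n1 (filterI n2 n3)) => x [? [? ?]].
have n0 : nbhs (0 : R) (c @^-1` [set x | [/\ ball x0 r x, ball (Y x0) e (Y x) & 0 < g x]]).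
  by apply: (cc 0); rewrite c0; exact: nx0.
have /nbhs_ballP[eta /= eta0 Heta] := n0.
have inB (t : R) : `](- eta), eta[%classic t -> [/\ ball x0 r (c t), ball (Y x0) e (Y (c t)) & 0 < g (c t)].
  rewrite /= in_itv /= -ltr_norml => te.
  by apply: Heta; rewrite -ball_normE /ball_ /= sub0r normrN.
have oT : open [set t : R | U (x0 + t *: v)].
  by apply: (open_comp (f := c)) => // t _; exact: cc.
have KT : `](- eta), eta[%classic `<=` [set t : R | U (x0 + t *: v)].
  by move=> t /inB[B _ _]; exact: BU.
pose b t := f (c t).
have sb : smooth_on `](- eta), eta[%classic b by exact: sub_smooth KT (smooth_line oT sf).
have db (t : R) : `](- eta), eta[%classic t -> 'D_1 b t = 'D_v f (c t).
  by move=> /KT/df/is_derive_line[_].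
have bpos (t : R) : `](- eta), eta[%classic t -> 0 < lor ('D_1 b t) ('D_1 b t).
  move=> Kt; have Uc : U (c t) := KT t Kt; have [_ _ gt] := inB t Kt.
  rewrite db //; have /hypN1P[pp _] := hf Uc.
  have uf x : U x -> lor (f x) (f x) = -1 by move=> /hf/hypN1P[].
  have tt : lor (f (c t)) ('D_v f (c t)) = 0 := unit_derive oU sf uf v Uc.
  rewrite lt_neqAle (tangent_ge0 pp tt) andbT eq_sym; apply/eqP => z.
  by move: gt; rewrite /g (tangent_eq0 pp tt z) mxE ltxx.
have hb (t : R) : `](- eta), eta[%classic t -> hyp (-1) (b t).
  by move=> /KT; exact: hf.
have [I [beta [oI ab bE]]] := arclength_reparametrization eta0 sb hb bpos.
have half : eta / 2 < eta by rewrite ltr_pdivrMr // ltr_pMr // ltr1n.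
have K'K : `](- (eta / 2)), (eta / 2)[%classic `<=` `](- eta), eta[%classic.
  move=> t; rewrite /= !in_itv /= => /andP[l u]; rewrite (lt_trans u half) andbT.
  by apply: lt_trans l; rewrite ltrN2.
pose h (t : R) := b t 0 i.
have sh : smooth_on `](- (eta / 2)), (eta / 2)[%classic h.
  by apply: smooth_entry; [exact: itv_open|exact: sub_smooth K'K sb].
have hpos (t : R) : `](- (eta / 2)), (eta / 2)[%classic t -> 0 < 'D_1 h t.
  move=> /K'K Kt; have [_ _ gt] := inB t Kt.
  by rewrite /h (derive_entry _ _ _ (smooth_on_differentiable sb Kt)) db.
have [_ [oJ _ _ _]] := smooth_inverse sh hpos.
have hE (t : R) : `](- (eta / 2)), (eta / 2)[%classic t -> h t = Y (c t) 0 k.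
  by move=> /K'K/KT Uc; rewrite (YE Uc).
exists I, beta, (h @` `](- (eta / 2)), (eta / 2)[%classic); split=> //.
- split=> //; exists 0; last by rewrite /h /b c0 YE.
  by rewrite /= in_itv /= oppr_lt0 divr_gt0.
- move=> _ [t Kt <-]; have [B1 B2 _] := inB t (K'K t Kt).
  exists (c t); split=> //; first by rewrite hE.
  have : (beta @` I) (b t) by rewrite bE; exists t.
  by move=> [s Is bs]; exists s.
- move=> t It; have : (b @` `](- (eta / 2)), (eta / 2)[%classic) (beta t).
    by rewrite -bE; exists t.
  move=> [s Ks bs]; have [B1 B2 _] := inB s (K'K s Ks).
  by exists (c s); split=> //; exists s => //; rewrite hE.
Qed.

Lemma component_curve v : ('d f x0 v) 0 i != 0 -> has_curve.
Proof.
rewrite neq_lt => /orP[neg|]; last exact: component_curve_pos.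
by apply: (component_curve_pos (v := - v)); rewrite linearN mxE oppr_gt0.
Qed.

End ComponentCurve.

Section LocalProduct.
Context {R : realType}.
Variables (U : set 'rV[R]_2) (f1 f2 : 'rV[R]_2 -> 'rV[R]_3).
Hypothesis pa : lagrangian_patch U f1 f2.
Hypothesis deg1 : forall x w z, U x -> gram ('d f1 x w) ('d f1 x z) = 0.

Let deg2 x w z : U x -> gram ('d f2 x w) ('d f2 x z) = 0.
Proof.
move=> Ux.
exact: (etrans (esym (plane_gram_eq (patch_plane pa Ux) w z)) (deg1 w z Ux)).
Qed.

Let oU := patch_open pa.

(** Choose v with 'd Y x v the basis vector k; then the entry i of 'd f x v is 1,
    and degeneracy makes every value of 'd f x the multiple of 'd f x v given by
    its entry i. *)
Lemma degenerate_control f (Y : 'rV[R]_2 -> 'rV[R]_2) (k : 'I_2) (i : 'I_3) x :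
  lor (f x) (f x) = -1 -> (forall w, lor (f x) ('d f x w) = 0) ->
  (forall w z, gram ('d f x w) ('d f x z) = 0) ->
  (forall w, ('d Y x w) 0 k = ('d f x w) 0 i) -> injective ('d Y x) ->
  exists C : R, forall w, `|'d f x w| <= C * `|('d Y x w) 0 k|.
Proof.
move=> pp t g YE inj; have [v vE] := inj_linear_surj inj (delta_mx 0 k).
have vi : ('d f x v) 0 i = 1 by rewrite -YE vE mxE !eqxx.
exists (`|'d f x v|) => w.
have vi0 : ('d f x v) 0 i != 0 by rewrite vi oner_neq0.
rewrite (tangent_dependent pp (t w) (t v) (g w v) vi0) vi divr1.
by rewrite normrZ mulrC YE.
Qed.

(** Let v1 and v2 span the kernels of the differentials of f1 and f2 at x0. By
    injectivity f1 moves along v2 and f2 along v1; an entry of f1 moving along v2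
    and an entry of f2 moving along v1 are coordinates Y near x0, in which f1
    depends only on the first and f2 only on the second. The set of points whose
    coordinates lie in the rectangle J1 x J2 of [component_curve] is mapped onto
    the product of the two curves. *)
Lemma local_product x0 : U x0 -> exists V0 : set 'rV[R]_2,
  [/\ open V0, V0 x0, V0 `<=` U & product_of_curves ((fun x => (f1 x, f2 x)) @` V0)].
Proof.
move=> Ux0.
have [v2 v2n v20] := degenerate_kernel (patch_lor2 pa Ux0)
  (fun w => patch_tangent2 pa w Ux0) (fun w z => deg2 w z Ux0).
have [v1 v1n v10] := degenerate_kernel (patch_lor1 pa Ux0)
  (fun w => patch_tangent1 pa w Ux0) (fun w z => deg1 w z Ux0).
have [i1 i1n] : exists i, ('d f1 x0 v2) 0 i != 0.
  apply: entry_neq0; apply/eqP => z; case/eqP: v2n.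
  exact: (patch_immersion pa Ux0 z v20).
have [i2 i2n] : exists i, ('d f2 x0 v1) 0 i != 0.
  apply: entry_neq0; apply/eqP => z; case/eqP: v1n.
  exact: (patch_immersion pa Ux0 v10 z).
pose g (j : 'I_2) : 'rV[R]_2 -> R :=
  if j == 0 then (fun x => f1 x 0 i1) else (fun x => f2 x 0 i2).
have sg j : smooth_on U (g j).
  rewrite /g; case: ifP => _.
    exact: smooth_entry oU (patch_smooth1 pa).
  exact: smooth_entry oU (patch_smooth2 pa).
pose Y := row_of g.
have sY : smooth_on U Y := smooth_row_of oU sg.
have dY0 x w : U x -> ('d Y x w) 0 0 = ('d f1 x w) 0 i1.
  move=> Ux; apply: etrans (diff_row_of oU sg w 0 Ux) _.
  have df := patch_diff1 pa Ux; rewrite -(deriveE w df).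
  exact: (derive_entry w 0 i1 df).
have dY1 x w : U x -> ('d Y x w) 0 1 = ('d f2 x w) 0 i2.
  move=> Ux; apply: etrans (diff_row_of oU sg w 1 Ux) _.
  have df := patch_diff2 pa Ux; rewrite -(deriveE w df).
  exact: (derive_entry w 0 i2 df).
have YE0 x : Y x 0 0 = f1 x 0 i1 by rewrite row_ofE.
have YE1 x : Y x 0 1 = f2 x 0 i2 by rewrite row_ofE.
have inj0 : injective ('d Y x0).
  apply: raddf_inj => u z; apply: (patch_immersion pa Ux0).
    rewrite (tangent_dependent (patch_lor1 pa Ux0) (patch_tangent1 pa u Ux0)
      (patch_tangent1 pa v2 Ux0) (deg1 u v2 Ux0) i1n).
    by rewrite -dY0 // z mxE mul0r scale0r.
  rewrite (tangent_dependent (patch_lor2 pa Ux0) (patch_tangent2 pa u Ux0)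
    (patch_tangent2 pa v1 Ux0) (deg2 u v1 Ux0) i2n).
  by rewrite -dY1 // z mxE mul0r scale0r.
have [r [m [r0 m0 BU low]]] := local_lower_bound oU sY Ux0 inj0.
have dYB x : ball x0 r x -> differentiable Y x.
  by move=> /BU Ux; exact: smooth_on_differentiable sY Ux.
have injB x : ball x0 r x -> injective ('d Y x).
  move=> Bx; apply: raddf_inj => u z.
  have := diff_lower_bound Bx (dYB x Bx) (fun x' Bx' => low x x' Bx Bx') u.
  by rewrite z normr0 pmulr_rle0 // normr_le0 => /eqP.
have [e e0 onto] := local_open_map r0 m0 dYB injB low.
have cY x : U x -> {for x, continuous Y}.
  by move=> Ux; exact: differentiable_continuous (smooth_on_differentiable sY Ux).
have [I1 [beta1 [J1 [oI1 ab1 [oJ1 J1x] J1P I1P]]]] :=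
  component_curve oU (patch_smooth1 pa) (patch_hyp1 pa) (fun x _ => YE0 x) cY r0 e0 BU i1n.
have [I2 [beta2 [J2 [oI2 ab2 [oJ2 J2x] J2P I2P]]]] :=
  component_curve oU (patch_smooth2 pa) (patch_hyp2 pa) (fun x _ => YE1 x) cY r0 e0 BU i2n.
(* The norm is the maximum norm, so the rectangle lies in the square ball covered
   by Y as soon as its sides do. *)
have JQ (z : 'rV[R]_2) : J1 (z 0 0) -> J2 (z 0 1) -> ball (Y x0) e z.
  move=> /J1P[x1 [_ Q1 E1 _]] /J2P[x2 [_ Q2 E2 _]].
  rewrite -ball_normE /ball_ /=; apply: normr_row_lt => // j; rewrite !mxE.
  move: Q1 Q2; rewrite -ball_normE /ball_ /= => Q1 Q2.
  have [->|->] : j = 0 \/ j = 1.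
    by case: j => [[|[|//]]] hj; [left|right]; exact: val_inj.
    rewrite -E1; apply: le_lt_trans Q1.
    by have := normr_entry_le (Y x0 - Y x1) 0; rewrite mxE [X in _ + X]mxE mxE.
  rewrite -E2; apply: le_lt_trans Q2.
  by have := normr_entry_le (Y x0 - Y x2) 1; rewrite mxE [X in _ + X]mxE mxE.
have same1 x x' : ball x0 r x -> ball x0 r x' -> ball (Y x0) e (Y x) ->
    ball (Y x0) e (Y x') -> Y x 0 0 = Y x' 0 0 -> f1 x = f1 x'.
  apply: (functional_dependence m0 dYB (fun x Bx => patch_diff1 pa (BU x Bx)) low _ onto).
  move=> u Bu; have Uu := BU u Bu.
  apply: (degenerate_control (patch_lor1 pa Uu) (fun w => patch_tangent1 pa w Uu)
    (fun w z => deg1 w z Uu) (fun w => dY0 u w Uu) (injB u Bu)).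
have same2 x x' : ball x0 r x -> ball x0 r x' -> ball (Y x0) e (Y x) ->
    ball (Y x0) e (Y x') -> Y x 0 1 = Y x' 0 1 -> f2 x = f2 x'.
  apply: (functional_dependence m0 dYB (fun x Bx => patch_diff2 pa (BU x Bx)) low _ onto).
  move=> u Bu; have Uu := BU u Bu.
  apply: (degenerate_control (patch_lor2 pa Uu) (fun w => patch_tangent2 pa w Uu)
    (fun w z => deg2 w z Uu) (fun w => dY1 u w Uu) (injB u Bu)).
have cYk j x : U x -> {for x, continuous (fun x => Y x 0 j)}.
  move=> Ux; apply: differentiable_continuous; apply: differentiable_entry.
  exact: smooth_on_differentiable sY Ux.
exists [set x | [/\ ball x0 r x, J1 (Y x 0 0) & J2 (Y x 0 1)]]; split.
- rewrite openE => x [Bx j1 j2]; rewrite /interior; have Ux := BU x Bx.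
  have n1 : nbhs x (ball x0 r) by apply: open_nbhs_nbhs; split=> //; exact: ball_open.
  have n2 : nbhs x ((fun x => Y x 0 0) @^-1` J1) by apply: cYk => //; exact: open_nbhs_nbhs.
  have n3 : nbhs x ((fun x => Y x 0 1) @^-1` J2) by apply: cYk => //; exact: open_nbhs_nbhs.
  by apply: filterS (filterI n1 (filterI n2 n3)) => y [? [? ?]].
- by split=> //; exact: ballxx.
- by move=> x [/BU].
exists I1, I2, beta1, beta2; split=> //.
apply/seteqP; split=> [_ [x [Bx j1 j2] <-]|_ [[t1 t2] [/= It1 It2] <-]].
  have Qx := JQ (Y x) j1 j2.
  have [x1 [B1 Q1 E1 [t1 It1 bt1]]] := J1P _ j1.
  have [x2 [B2 Q2 E2 [t2 It2 bt2]]] := J2P _ j2.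
  exists (t1, t2) => //=; rewrite bt1 bt2.
  by rewrite (same1 x1 x B1 Bx Q1 Qx E1) (same2 x2 x B2 Bx Q2 Qx E2).
have [x1 [B1 Q1 j1 ->]] := I1P t1 It1; have [x2 [B2 Q2 j2 ->]] := I2P t2 It2.
pose z : 'rV[R]_2 := \row_j (if j == 0 then Y x1 0 0 else Y x2 0 1).
have z0 : z 0 0 = Y x1 0 0 by rewrite mxE.
have z1 : z 0 1 = Y x2 0 1 by rewrite mxE.
have Qz : ball (Y x0) e z by apply: JQ; rewrite ?z0 ?z1.
have [x Bx Yx] := onto z Qz.
exists x; first by split=> //; rewrite Yx ?z0 ?z1.
congr pair.
  by apply: same1 => //; rewrite Yx // z0.
by apply: same2 => //; rewrite Yx // z1.
Qed.

End LocalProduct.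

Section ZeroLocus.
Context {R : realType} {S : surface R}.
Local Notation E := ('rV[R]_3 * 'rV[R]_3)%type.
Variables (Phi : S -> E) (Phi_imm : immersionHH Phi) (Phi_lag : lagrangian Phi).
Variables (Gam : S -> R) (Gam_Phi : associated_function Phi Gam).

Lemma zero_locally_product : (forall p, Gam p ^+ 2 = 0) -> locally_product_of_curves Phi.
Proof.
move=> G0 p; have [c [x0 [ac Ux0 px]]] := surface_point p.
have pa := chart_patch Phi_imm Phi_lag ac.
have deg x w z : chart_img c x -> gram ('d (chart_fst Phi c) x w) ('d (chart_fst Phi c) x z) = 0.
  move=> Ux.
  exact: ((associated_function_eq0 Phi_imm Phi_lag Gam_Phi ac Ux).1 (G0 (chart_inv c x)) w z).
have [V0 [oV0 V0x V0U prod]] := local_product pa deg Ux0.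
exists (chart_dom c `&` chart_map c @^-1` V0); split.
- exact: chart_preimage_open.
- by rewrite -px; split; [exact: chart_inv_dom|rewrite /= chart_invK].
have -> : Phi @` (chart_dom c `&` chart_map c @^-1` V0) =
    (fun x => (chart_fst Phi c x, chart_snd Phi c x)) @` V0; last exact: prod.
apply/seteqP; split=> [_ [q [Dq Vq] <-]|_ [x Vx <-]].
  exists (chart_map c q) => //.
  by rewrite /chart_fst /chart_snd /= chart_mapK // -surjective_pairing.
have Ux := V0U x Vx; exists (chart_inv c x); last exact: surjective_pairing.
by split; [exact: chart_inv_dom|rewrite /= chart_invK].
Qed.

(** The first component takes its values on a regular curve, so its metric is
    degenerate. *)
Lemma product_zero (V : set S) p : open V -> V p -> product_of_curves (Phi @` V) ->
  Gam p ^+ 2 = 0.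
Proof.
move=> oV Vp [I1 [I2 [beta1 [beta2 [[_ oI1 _] _ [sb _ ub] _ PV]]]]].
have [c [x0 [ac Ux0 px]]] := surface_point p.
have pa := chart_patch Phi_imm Phi_lag ac.
pose W := chart_img c `&` chart_inv c @^-1` V.
have oW : open W by exact: chart_inv_preimage_open.
have Wx0 : W x0 by split=> //=; rewrite px.
have reg t : I1 t -> 'D_1 beta1 t != 0.
  move=> It; apply/eqP => z; have := ub t It.
  by rewrite derive1E z lor0l => /eqP; rewrite eq_sym oner_eq0.
have sW : smooth_on W (chart_fst Phi c).
  by apply: sub_smooth (patch_smooth1 pa) => x [].
have WI x : W x -> exists2 t, I1 t & beta1 t = chart_fst Phi c x.
  move=> [_ Vx]; have : (Phi @` V) (Phi (chart_inv c x)) by exists (chart_inv c x).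
  by rewrite PV => -[[t1 t2] [/= It _] e]; exists t1 => //; rewrite /chart_fst /= -e.
rewrite -px; apply/(associated_function_eq0 Phi_imm Phi_lag Gam_Phi ac Ux0) => w z.
exact: (rank_drop_everywhere oI1 sb reg oW sW WI w z Wx0).
Qed.

End ZeroLocus.

Theorem theorem3p8 (R : realType) (S : surface R)
    (Phi : S -> 'rV[R]_3 * 'rV[R]_3) (Gam : S -> R)
    (S_connected : connected [set: S])
    (Phi_immersion : immersionHH Phi) (Phi_lagrangian : lagrangian Phi)
    (Gam_Phi : associated_function Phi Gam) :
  [/\ forall p : S, 0 <= Gam p ^+ 2 <= 4^-1,
      ((forall p : S, Gam p ^+ 2 = 0) <-> locally_product_of_curves Phi) /\
      (product_of_curves (range Phi) -> forall p : S, Gam p ^+ 2 = 0) &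
      (forall p : S, Gam p ^+ 2 = 4^-1) <->
      exists F : 'rV[R]_3 * 'rV[R]_3 -> 'rV[R]_3 * 'rV[R]_3,
        [/\ isometryHH F, holomorphicHH F \/ antiholomorphicHH F &
            open_part (F @` range Phi) diagonalHH]].
Proof.
split; [|split; [split|]|split].
- exact: (associated_function_le Phi_immersion Phi_lagrangian Gam_Phi).
- exact: (zero_locally_product Phi_immersion Phi_lagrangian Gam_Phi).
- move=> loc p; have [V [oV Vp prod]] := loc p.
  exact: (product_zero Phi_immersion Phi_lagrangian Gam_Phi oV Vp prod).
- move=> prod p.
  exact: (product_zero Phi_immersion Phi_lagrangian Gam_Phi openT Logic.I prod).
- move=> Gmax.
  have [F [iF hF oF]] := max_associated_function_diagonal Phi_immersion Phi_lagrangian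
    Gam_Phi Gmax S_connected.
  by exists F; split=> //; left.
- move=> [F [iF _ [W oW FO]]].
  apply: (diagonal_associated_function Phi_immersion Phi_lagrangian Gam_Phi iF) => p.
  have : (F @` range Phi) (F (Phi p)) by exists (Phi p) => //; exists p.
  by rewrite FO => -[_ /diagonalHHP[]].
Qed.
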